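(* $\rho(3,7)=\frac{1}{2}\left(1-\frac{1}{r(3,4)-1}\right)=\frac{7}{16}$; equivalently $RT(n,3,7,o(n))=\frac{7}{16}n^2+o(n^2)$. Moreover, the weak stability property holds for $RT(n,3,7,o(n))$: if $(S_n)$ and $(Z_n)$ are two sequences of graphs such that, for each $n$, both $S_n$ and $Z_n$ have $n$ vertices and are $(K_3,K_7)$-free, $\alpha(S_n)=o(n)$, $\alpha(Z_n)=o(n)$, and $e(S_n)=\frac{7}{16}n^2+o(n^2)$, $e(Z_n)=\frac{7}{16}n^2+o(n^2)$, then $\Delta(S_n,Z_n)=o(n^2)$.
   Context: For integers $p,q\ge 2$, a graph $G$ is $(K_p,K_q)$-free if there is a colouring of the edges of $G$ with two colours (colour 1 and colour 2) containing no $K_p$ all of whose edges have colour 1 and no $K_q$ all of whose edges have colour 2. $\alpha(G)$ is the independence number and $e(G)$ the number of edges. $RT(n,p,q,m)$ is the maximum number of edges in an $n$-vertex $(K_p,K_q)$-free graph $G$ with $\alpha(G)<m$. For $0<\delta<1$, $\rho(p,q,\delta)=\lim_{n\to\infty}RT(n,p,q,\delta n)/n^2$ and $\rho(p,q)=\lim_{\delta\to 0}\rho(p,q,\delta)$. $r(p,q)$ denotes the classical two-colour Ramsey number (so $r(3,4)=9$). For graphs $S,Z$ on the same number of vertices, $\Delta(S,Z)$ is the minimum number of edges one must delete from and add to $S$ to obtain a graph isomorphic to $Z$. *)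

(* Defs.v *)
From HB Require Import structures.
From mathcomp Require Import all_boot all_order all_algebra all_fingroup.
From mathcomp Require Import all_classical all_reals all_analysis.
Set Implicit Arguments. Unset Strict Implicit. Unset Printing Implicit Defensive.
Import Order.TTheory GRing.Theory Num.Theory.

Definition is_graph n (G : {set {set 'I_n}}) : bool := [forall e in G, #|e| == 2].

Definition adj n (G : {set {set 'I_n}}) (x y : 'I_n) : bool := [set x; y] \in G.

Definition nedges n (G : {set {set 'I_n}}) : nat := #|G|.

(* S spans a clique of size k in G all of whose edges {x,y} have colour b
   under the colouring c (colour 1 = true, colour 2 = false). *)
Definition mono_clique n (G : {set {set 'I_n}}) (c : {ffun {set 'I_n} -> bool})
  (b : bool) (k : nat) (S : {set 'I_n}) : bool :=
  (#|S| == k) && [forall x in S, forall y in S,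
     (x != y) ==> (adj G x y && (c [set x; y] == b))].

Definition KpKq_free n (G : {set {set 'I_n}}) (p q : nat) : bool :=
  [exists c : {ffun {set 'I_n} -> bool},
     ~~ [exists S, mono_clique G c true p S] &&
     ~~ [exists S, mono_clique G c false q S]].

Definition independent n (G : {set {set 'I_n}}) (S : {set 'I_n}) : bool :=
  [forall x in S, forall y in S, (x != y) ==> ~~ adj G x y].

Definition alpha n (G : {set {set 'I_n}}) : nat :=
  \max_(S : {set 'I_n} | independent G S) #|S|.

Definition RT (R : realType) (n p q : nat) (m : R) : nat :=
  \max_(G : {set {set 'I_n}} | [&& is_graph G, KpKq_free G p q & ((alpha G)%:R < m)%R])
     nedges G.

(* the sequence n |-> RT(n,p,q,delta n)/n^2, whose limit is rho(p,q,delta) *)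
Definition RT_ratio (R : realType) (p q : nat) (delta : R) (n : nat) : R :=
  ((RT n p q (delta * n%:R))%:R / (n%:R ^+ 2))%R.

Definition relabel n (s : {perm 'I_n}) (G : {set {set 'I_n}}) : {set {set 'I_n}} :=
  (fun e : {set 'I_n} => s @: e) @: G.

Definition isomorphic n (G H : {set {set 'I_n}}) : bool :=
  [exists s : {perm 'I_n}, G == relabel s H].

(* Delta(S,Z): minimum number of edges to delete from and add to S to obtain
   a graph isomorphic to Z, i.e. min over graphs T isomorphic to Z of |S (sym.diff) T|.
   (Z itself is such a T, so the default value of the min is never attained
   spuriously.) *)
Definition Delta n (S Z : {set {set 'I_n}}) : nat :=
  \big[minn/(#|S| + #|Z|)%N]_(T : {set {set 'I_n}} | is_graph T && isomorphic T Z)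
     #|(S :\: T) :|: (T :\: S)|.

(* Main.v *)
(* Upper bound. Instead of a regularity partition one regularises a k-tuple of (not
   necessarily disjoint) vertex sets: among large sub-tuples of (V, ..., V), an energy increment
   that starts from the potential [functional] yields a lower-regular tuple on which the average
   density of missing edges, minus a small multiple of the average of
   N(x,y) N(y,z) (2 - N(x,z)) (N is the indicator of a missing edge), has not increased. Its
   reduced graph has red, full (blue density over 1/2) and half (blue) pairs; a cluster is
   doubled if its large subsets contain blue edges, and otherwise its large subsets contain red
   edges. A Ramsey-Turan embedding turns (K_3, K_7)-freeness into: no red triangle, no red pair
   at a non-doubled cluster, and |S| + |D| <= 6 for a blue clique S with D a full clique of
   doubled clusters in S. With weight 1 on missing pairs and on the diagonal, 1/2 on half pairs
   and 0 elsewhere, the minimum of the quadratic form on the simplex is 1/8: its support may be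
   assumed complete, and the value is then bounded by the independence number of the half graph.
   The minimum exceeds 20/159 > 1/8 unless there are 8 doubled clusters that are pairwise red or
   full, and such an 8-set forces the missing pairs to be almost the pairs inside 8 classes.

   Stability. Both S and Z have average non-degree about n/8 and N(x,y) N(y,z) (2 - N(x,z)) has
   average about 1/64, so non-degrees concentrate, non-adjacency is almost transitive, and both
   graphs are close to the complete 8-partite graph with equal parts.

   Lower bound. Place a triangle-free graph with small independence number in blue inside each
   of 8 equal parts, and colour the pairs of parts by the colouring showing r(3,4) > 8. *)

(* A tuple of sets sees only a small part of the graph, so it gives only one-sided information; the
   potential is designed to make that enough. Every reduced graph has missing weight at least 1/8,
   so a graph with average non-degree near n/8 forces a nearly extremal tuple, whose path average is
   then at most about 1/64. The combined functional has not increased and all other errors are far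
   smaller than the coefficient of the path term, so dividing by this coefficient carries the bound
   1/64 back to the whole graph. Writing 2 - N(x,z) as 1 + (1 - N(x,z)) shows what it is worth: the
   first part sums to the squared non-degrees, the second counts failures of transitivity. Stability
   needs a gap above 1/8, and the case bounds leave little room: the weakest is 13/103. The hardest
   case, a largest set of six clusters without half pairs, ends in a configuration on ten clusters
   that is closed by a verified search over its red pairs. For the lower bound one graph for each
   delta is enough, because blowing up makes rho(3,7,delta) the supremum of the ratios over all
   n. *)
Require Import Defs.
From HB Require Import structures.
From mathcomp Require Import all_boot.
From mathcomp Require Import zify.
Set Implicit Arguments.
Unset Strict Implicit.
Unset Printing Implicit Defensive.

(** * Ramsey numbers r(3, k) *)

Section Ramsey.
Variables (T : finType) (r : rel T).
Hypotheses (r_sym : symmetric r).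
Hypothesis r_tri : forall x y z, r x y -> r y z -> r x z -> False.

Definition coclique (S : {set T}) := {in S &, forall x y, x != y -> ~~ r x y}.

Let nbr (K : {set T}) x := [set y in K | r x y].

Lemma nbr_coclique K x : coclique (nbr K x).
Proof.
move=> y z; rewrite !inE => /andP[_ xy] /andP[_ xz] _; apply/negP => yz.
exact: (r_tri xy yz xz).
Qed.

Lemma coclique_sub (S S' : {set T}) : S' \subset S -> coclique S -> coclique S'.
Proof. by move=> /subsetP s c x y /s xS /s yS; apply: c. Qed.

Lemma sub_card_eq (A : {set T}) m : m <= #|A| -> exists2 S : {set T}, S \subset A & #|S| = m.
Proof.
move=> mA; exists [set x in take m (enum A)].
  by apply/subsetP => x; rewrite inE => /mem_take; rewrite mem_enum.
rewrite cardsE (card_uniqP _) ?take_uniq ?enum_uniq // size_takel // -cardE //.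
Qed.

Definition ramsey N m := forall K : {set T}, N <= #|K| ->
  exists S : {set T}, [/\ S \subset K, #|S| = m & coclique S].

Lemma big_nbr_ramsey (K : {set T}) x m : m <= #|nbr K x| ->
  exists S : {set T}, [/\ S \subset K, #|S| = m & coclique S].
Proof.
move=> /sub_card_eq [S Ss Sm]; exists S; split=> //.
  by apply: subset_trans Ss _; apply/subsetP => y; rewrite inE => /andP[].
exact: coclique_sub Ss (@nbr_coclique K x).
Qed.

(* The 1 in the count is [x] itself. *)
Lemma ramsey_vertex N m (K : {set T}) x : ramsey N m -> x \in K -> N + 1 + #|nbr K x| <= #|K| ->
  exists S : {set T}, [/\ S \subset K, #|S| = m.+1 & coclique S].
Proof.
move=> rN xK cK; have xK' : x \notin K :\ x by rewrite !inE eqxx.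
have [S [Ss Sm Sc]] : exists S : {set T},
    [/\ S \subset (K :\ x) :\: nbr K x, #|S| = m & coclique S].
  apply: rN; rewrite cardsD (cardsD1 x K) xK in cK *.
  have : #|(K :\ x) :&: nbr K x| <= #|nbr K x| by rewrite subset_leq_card // subsetIr.
  lia.
have Sx y : y \in S -> [/\ y != x, y \in K & ~~ r x y].
  move=> /(subsetP Ss); rewrite !inE => /andP[] + /andP[-> yK]; rewrite yK /=.
  by move=> ->.
exists (x |: S); split.
- by apply/subsetP => y; rewrite in_setU1 => /orP[/eqP->//|/Sx[]].
- by rewrite cardsU1 Sm; case: (boolP (x \in S)) => // /Sx[]; rewrite eqxx.
- move=> y z; rewrite !in_setU1 => /orP[/eqP->|yS] /orP[/eqP->|zS] yz.
  + by rewrite eqxx in yz.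
  + by case: (Sx _ zS).
  + by rewrite r_sym; case: (Sx _ yS).
  + exact: Sc.
Qed.

Lemma ramsey1 : ramsey 1 1.
Proof.
move=> K /card_gt0P[x xK]; exists [set x]; rewrite sub1set xK cards1; split=> //.
by move=> y z; rewrite !inE => /eqP-> /eqP->; rewrite eqxx.
Qed.

(** A vertex either has m + 1 red neighbours, which are pairwise not red, or has at most m and
    leaves N vertices not joined to it in red. *)
Lemma ramseyS N m : ramsey N m -> ramsey (N + m.+1) m.+1.
Proof.
move=> rN K cK; have /card_gt0P[x xK] : 0 < #|K| by lia.
have [|d] := leqP m.+1 #|nbr K x|; first exact: big_nbr_ramsey.
by apply: (ramsey_vertex rN xK); lia.
Qed.

Lemma ramsey3 : ramsey 6 3.
Proof. exact: (ramseyS (ramseyS ramsey1)). Qed.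

(** Handshake count: orienting each red pair by [enum_rank] splits the degree sum into two equal
    halves. *)
Lemma even_sum_sym (K : {set T}) : irreflexive r -> ~~ odd (\sum_(x in K) #|nbr K x|).
Proof.
move=> r_irr.
have -> : \sum_(x in K) #|nbr K x| = \sum_(x in K) \sum_(y in K) r x y.
  apply: eq_bigr => x _; rewrite -sum1_card big_mkcond [RHS]big_mkcond /=.
  by apply: eq_bigr => y _; rewrite inE; case: (y \in K); case: (r x y).
pose f x y := (r x y && (enum_rank x < enum_rank y) : nat).
have -> : \sum_(x in K) \sum_(y in K) (r x y : nat) =
    \sum_(x in K) \sum_(y in K) f x y + \sum_(x in K) \sum_(y in K) f x y.
  rewrite [X in _ = _ + X]exchange_big -big_split /=; apply: eq_bigr => x _.
  rewrite -big_split /=; apply: eq_bigr => y _; rewrite /f r_sym.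
  case: ltngtP => [||/val_inj/enum_rank_inj->]; rewrite ?andbT ?andbF ?addn0 //.
  by rewrite r_irr.
by rewrite addnn odd_double.
Qed.

(* The step from the 10 of [ramseyS] to 9 is parity: there is no 3-regular graph on 9 vertices. *)
Lemma ramsey4 : ramsey 9 4.
Proof.
move=> K' /sub_card_eq[K sK cK].
suff [S [Ss Sm Sc]] : exists S : {set T}, [/\ S \subset K, #|S| = 4 & coclique S].
  by exists S; split=> //; apply: subset_trans sK.
have r_irr : irreflexive r by move=> x; apply/negP => xx; apply: (r_tri xx xx xx).
have [/forall_inP reg|] := boolP [forall x in K, #|nbr K x| == 3].
  have := even_sum_sym K r_irr.
  by rewrite (eq_bigr (fun=> 3)) ?sum_nat_const ?cK // => x /reg/eqP.
case/forall_inPn => x xK d3; have [|d4] := leqP 4 #|nbr K x|.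
  exact: big_nbr_ramsey.
by apply: (ramsey_vertex ramsey3 xK); lia.
Qed.

Lemma ramsey5 : ramsey 14 5. Proof. exact: ramseyS ramsey4. Qed.

(** The true value is 18. The bound 20 serves to limit complete sets of doubled clusters to 19,
    which the later estimates can afford. *)
Lemma ramsey6 : ramsey 20 6. Proof. exact: ramseyS ramsey5. Qed.

End Ramsey.

(** * A verified backtracking search *)

(* In a nogood attached to variable [d], a variable is written as its distance below [d],
   so that it can be looked up in the stack of values assigned so far. *)
Fixpoint stack_get (a : seq bool) (i : nat) : bool :=
  match a, i with
  | b :: _, 0 => b
  | _ :: a', i'.+1 => stack_get a' i'
  | [::], _ => false
  end.

Fixpoint violated (a : seq bool) (ng : seq (nat * bool)) : bool :=
  match ng with
  | [::] => true
  | (i, b) :: ng' => if (if b then stack_get a i else if stack_get a i then false else true)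
                     then violated a ng' else false
  end.

Fixpoint some_violated (a : seq bool) (ngs : seq (seq (nat * bool))) : bool :=
  match ngs with
  | [::] => false
  | ng :: ngs' => if violated a ng then true else some_violated a ngs'
  end.

(** [true] means that every branch is cut by a nogood. Running out of variables means a surviving
    assignment, hence [false]. Conditionals replace boolean connectives so that call-by-value
    evaluation skips the branches already decided. *)
Fixpoint refute (gs : seq (seq (seq (nat * bool)))) (a : seq bool) : bool :=
  match gs with
  | [::] => false
  | g :: gs' =>
    if (if some_violated (true :: a) g then true else refute gs' (true :: a))
    then (if some_violated (false :: a) g then true else refute gs' (false :: a)) else false
  end.

(** A nogood is filed under its largest variable, so it is tested at the first moment when all its
    variables have values. *)
Definition nogood_groups (n : nat) (ngs : seq (seq (nat * bool))) :=
  [seq [seq [seq (d - l.1, l.2) | l <- ng] |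
         ng <- ngs & foldr maxn 0 (unzip1 ng) == d] | d <- iota 0 n].

Section Soundness.
Variable f : nat -> bool.

Let stack d := [seq f (d - i.+1) | i <- iota 0 d].

Lemma stackS d : stack d.+1 = f d :: stack d.
Proof.
rewrite /stack /= subSS subn0; congr cons.
by rewrite (iotaDl 1 0) -map_comp; apply: eq_map.
Qed.

Lemma stack_getE d i : i < d -> stack_get (stack d) i = f (d - i.+1).
Proof.
elim: d i => [//|d IH] [|i] id; rewrite stackS /= ?subSS ?subn0 //.
by rewrite IH // subSS.
Qed.

Lemma violatedE d ng : all (fun l => l.1 <= d) ng ->
  violated (stack d.+1) [seq (d - l.1, l.2) | l <- ng] = all (fun l => f l.1 == l.2) ng.
Proof.
have get i : i <= d -> stack_get (stack d.+1) (d - i) = f i.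
  by move=> id; rewrite stack_getE; [congr f|]; lia.
move: (stack _) get => st get.
elim: ng => [//|[i b] ng IH] /= /andP[/get -> /IH <-].
by case: b; case: (f i).
Qed.

Lemma some_violatedP a ngs : some_violated a ngs -> exists2 ng, ng \in ngs & violated a ng.
Proof.
elim: ngs => [//|ng ngs IH] /=; case E: (violated a ng) => h.
  by exists ng; rewrite ?mem_head.
by have [ng' i v] := IH h; exists ng'; rewrite // inE i orbT.
Qed.

Let groups (ngs : seq (seq (nat * bool))) d n := [seq [seq [seq (d - l.1, l.2) | l <- ng] |
  ng <- ngs & foldr maxn 0 (unzip1 ng) == d] | d <- iota d n].

(** The search is followed along the branch dictated by [f]; the cut met there comes from a nogood
    that [f] realises. *)
Lemma refute_stack n d ngs : refute (groups ngs d n) (stack d) ->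
  exists2 ng, ng \in ngs & all (fun l => f l.1 == l.2) ng.
Proof.
elim: n d => [//|n IH] d /=.
set G := [seq _ | ng <- ngs & _].
have step : (if some_violated (f d :: stack d) G then true
             else refute (groups ngs d.+1 n) (f d :: stack d)) ->
    exists2 ng, ng \in ngs & all (fun l => f l.1 == l.2) ng.
  rewrite -stackS; case: ifP => [/some_violatedP[ng /mapP[ng0 + ->] v] _|_]; last exact: IH.
  rewrite mem_filter => /andP[/eqP md i0]; exists ng0 => //.
  rewrite -(violatedE (d := d)) //; apply/allP => l li; rewrite -md.
  by elim: ng0 li {md i0 v} => // l' s IHs /=; rewrite inE => /orP[/eqP->|/IHs]; lia.
by case: (f d) step => step; case: ifP => // h1 h2; apply: step.
Qed.

Lemma refute_sound n ngs : refute (nogood_groups n ngs) [::] ->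
  exists2 ng, ng \in ngs & all (fun l => f l.1 == l.2) ng.
Proof. exact: (@refute_stack n 0). Qed.
End Soundness.

(** Triangular numbering of the pairs i < j: all pairs inside {0, ..., j} precede every pair with
    larger element j + 1. Ten vertices give 45 variables. *)
Definition pair_var (i j : nat) := (j * j.-1)./2 + i.

Definition clique_nogood (b : bool) (S : seq nat) : seq (nat * bool) :=
  [seq (pair_var p.1 p.2, b) | p <- [seq (i, j) | j <- S, i <- S] & p.1 < p.2].

Fixpoint subseqs (k : nat) (s : seq nat) : seq (seq nat) :=
  match k, s with
  | 0, _ => [:: [::]]
  | _, [::] => [::]
  | k'.+1, x :: s' => [seq x :: t | t <- subseqs k' s'] ++ subseqs k s'
  end.

(* Vertices 2,7 / 4,6 / 5,8 are the pairs joined by a half edge; 0,1,3 are the remaining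
   vertices of the independent set and 9 is the extra vertex. The labelling is the
   search order. *)
Definition half_pair (i j : nat) := (i, j) \in [:: (2, 7); (4, 6); (5, 8); (7, 2); (6, 4); (8, 5)].

Definition full_triple (t : seq nat) :=
  all (fun i => i < 9) t && all (fun i => all (fun j => ~~ half_pair i j) t) t.

Definition blue_pairs := [:: (2, 7); (4, 6); (5, 8); (2, 4); (2, 6); (4, 7); (6, 7); (5, 9); (8, 9)].

(* Symmetry breaking: the nogood [ij not red, kl red]. *)
Definition ordered_pairs := [:: ((1, 2), (2, 3)); ((2, 3), (0, 2)); ((1, 4), (1, 6)); ((1, 5), (1, 8))].

(** A variable tells whether a pair is red. The last two groups encode [blue_bound]: four vertices
    without red pairs but with a full triple would give 4 + 3 > 6, and five without red pairs
    contain a full pair and would give 5 + 2 > 6. *)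
Definition core_nogoods :=
  [seq [:: (pair_var p.1 p.2, true)] | p <- blue_pairs] ++
  [seq [:: (pair_var p.1.1 p.1.2, false); (pair_var p.2.1 p.2.2, true)] | p <- ordered_pairs] ++
  [seq clique_nogood true t | t <- subseqs 3 (iota 0 10)] ++
  [seq clique_nogood false t | t <- subseqs 4 (iota 0 10) & has full_triple (subseqs 3 t)] ++
  [seq clique_nogood false t | t <- subseqs 5 (iota 0 10)].

Lemma core_refuted : refute (nogood_groups 45 core_nogoods) [::].
Proof. by vm_compute. Qed.

Lemma subseqsP k s t : t \in subseqs k s -> size t = k /\ subseq t s.
Proof.
elim: s k t => [|x s IH] [|k] t //=; rewrite ?inE; try by move/eqP->.
rewrite mem_cat => /orP[/mapP[t' /IH[<- st] ->]|/IH[<- st]]; split=> //.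
  by rewrite /= eqxx.
exact: subseq_trans st (subseq_cons _ _).
Qed.

Lemma core_contradiction (r : rel nat) : symmetric r ->
  (forall p, p \in blue_pairs -> ~~ r p.1 p.2) ->
  (forall p, p \in ordered_pairs -> r p.2.1 p.2.2 -> r p.1.1 p.1.2) ->
  (forall t, size t = 3 -> uniq t -> all (fun i => i < 10) t ->
     ~ (forall i j, i \in t -> j \in t -> i != j -> r i j)) ->
  (forall t t', size t = 4 -> uniq t -> all (fun i => i < 10) t ->
     size t' = 3 -> subseq t' t -> full_triple t' ->
     ~ (forall i j, i \in t -> j \in t -> i != j -> ~~ r i j)) ->
  (forall t, size t = 5 -> uniq t -> all (fun i => i < 10) t ->
     ~ (forall i j, i \in t -> j \in t -> i != j -> ~~ r i j)) -> False.
Proof.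
move=> r_sym bl ord h3 h4 h5.
pose pairs := [seq (i, j) | j <- iota 0 10, i <- iota 0 j].
pose f n := nth false [seq r p.1 p.2 | p <- pairs] n.
have fE i j : i < j -> j < 10 -> f (pair_var i j) = r i j.
  by do 10 (case: j => [|j]; first by do 10 (case: i => [|i]; first by [])).
have sub_iota k t : t \in subseqs k (iota 0 10) ->
    [/\ size t = k, uniq t & all (fun i => i < 10) t].
  move=> /subseqsP[st ss]; split=> //; first exact: subseq_uniq ss (iota_uniq _ _).
  by apply/allP => i /(mem_subseq ss); rewrite mem_iota.
have cliqueP b t : all (fun i => i < 10) t ->
    all (fun l => f l.1 == l.2) (clique_nogood b t) ->
    forall i j, i \in t -> j \in t -> i != j -> r i j = b.
  move=> /allP t10 /allP H i j it jt.
  wlog ij : i j it jt / i < j.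
    by move=> W; case: ltngtP => // l _; [|rewrite r_sym]; apply: W => //; rewrite neq_ltn l.
  move=> _; have /H/eqP : (pair_var i j, b) \in clique_nogood b t.
    apply/mapP; exists (i, j) => //; rewrite mem_filter ij /=.
    by apply/allpairsP; exists (j, i).
  by rewrite /= fE //; apply: t10.
have [ng] := @refute_sound f _ _ core_refuted.
rewrite 4!mem_cat => /or4P[/mapP[p pb ->]|/mapP[p pb ->]|/mapP[t]|].
- have /andP[lt1 lt2] : (p.1 < p.2) && (p.2 < 10) by move: p pb; apply/allP.
  by rewrite /= andbT fE // eqb_id; apply/negP/bl.
- have /and4P[lt1 lt2 lt3 lt4] : [&& p.1.1 < p.1.2, p.1.2 < 10, p.2.1 < p.2.2 & p.2.2 < 10].
    by move: p pb; apply/allP.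
  by rewrite /= andbT !fE // eqb_id eqbF_neg => /andP[/negP + /(ord p pb)].
- move=> /sub_iota[s3 u t10] -> /(cliqueP true t t10); exact: h3.
- case/orP=> /mapP[t].
  + rewrite mem_filter => /andP[/hasP[t' t'i ft] /sub_iota[s4 u t10]] ->.
    move=> /(cliqueP false t t10) c; have [s3 ss] := subseqsP t'i.
    by apply: (h4 t t') => // i j it jt ij; rewrite (c i j).
  + move=> /sub_iota[s5 u t10] -> /(cliqueP false t t10) c.
    by apply: (h5 t) => // i j it jt ij; rewrite (c i j).
Qed.

(** * Reduced graphs *)

(* A vertex is a cluster of the regularity partition; a red pair has positive density in
   colour 1, a full (half) pair has density more (at most) 1/2 in colour 2 and essentially
   none in colour 1. In a doubled cluster every large set contains an edge of colour 2; in
   the other ones every large set contains an edge of colour 1. *)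
Record reduced (T : finType) := Reduced {
  red : rel T; ful : rel T; hal : rel T; dbl : pred T;
  red_sym : symmetric red; ful_sym : symmetric ful; hal_sym : symmetric hal;
  red_irr : irreflexive red; ful_irr : irreflexive ful; hal_irr : irreflexive hal;
  red_ful : forall x y, red x y -> ful x y = false;
  red_hal : forall x y, red x y -> hal x y = false;
  ful_hal : forall x y, ful x y -> hal x y = false;
  red_triangle : forall x y z, red x y -> red y z -> red x z -> False;
  red_dbl : forall x y, red x y -> dbl x;
  blue_bound : forall S D : {set T},
    {in S &, forall x y, x != y -> ful x y || hal x y} -> D \subset S ->
    {in D, forall x, dbl x} -> {in D &, forall x y, x != y -> ful x y} -> #|S| + #|D| <= 6 }.

Section Reduced.
Variables (T : finType) (g : reduced T).

(** In terms of the missing weights used later, a complete set has no pair of weight 1, and a unit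
    clique has only pairs of weight 0. *)
Definition complete (K : {set T}) :=
  {in K &, forall x y, x != y -> [|| red g x y, ful g x y | hal g x y]}.
Definition unit_clique (K : {set T}) := {in K &, forall x y, x != y -> red g x y || ful g x y}.
Definition doubled (K : {set T}) := {in K, forall x, dbl g x}.
Definition blue_clique (K : {set T}) := {in K &, forall x y, x != y -> ful g x y || hal g x y}.

Lemma complete_sub (K K' : {set T}) : K' \subset K -> complete K -> complete K'.
Proof. by move=> /subsetP s c x y /s xK /s; apply: c. Qed.
Lemma unit_clique_sub (K K' : {set T}) : K' \subset K -> unit_clique K -> unit_clique K'.
Proof. by move=> /subsetP s c x y /s xK /s; apply: c. Qed.
Lemma doubled_sub (K K' : {set T}) : K' \subset K -> doubled K -> doubled K'.
Proof. by move=> /subsetP s c x /s; apply: c. Qed.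
Lemma unit_clique_complete K : unit_clique K -> complete K.
Proof. by move=> u x y xK yK /(u _ _ xK yK)/orP[]->; rewrite ?orbT. Qed.

Lemma coclique_blue K : complete K -> coclique (red g) K -> blue_clique K.
Proof. by move=> c r x y xK yK xy; have := c _ _ xK yK xy; rewrite (negbTE (r _ _ xK yK xy)). Qed.

Lemma ramsey_blue N m K : ramsey (red g) N m -> complete K -> N <= #|K| ->
  exists S : {set T}, [/\ S \subset K, #|S| = m & blue_clique S].
Proof.
move=> r c /r[S [sK Sm Sc]]; exists S; split=> //.
exact: coclique_blue (complete_sub sK c) Sc.
Qed.

Let r3 := ramsey3 (red_sym g) (@red_triangle _ g).
Let r4 := ramsey4 (red_sym g) (@red_triangle _ g).
Let r5 := ramsey5 (red_sym g) (@red_triangle _ g).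
Let r6 := ramsey6 (red_sym g) (@red_triangle _ g).

Lemma blue_unit_ful (S D : {set T}) : blue_clique S -> D \subset S -> unit_clique D ->
  {in D &, forall x y, x != y -> ful g x y}.
Proof.
move=> bS /subsetP DS uD x y xD yD xy.
have := uD _ _ xD yD xy; case/orP=> // r.
by have := bS _ _ (DS _ xD) (DS _ yD) xy; rewrite (red_ful r) (red_hal r).
Qed.

Lemma blue_unit_bound (S D : {set T}) : blue_clique S -> D \subset S -> doubled D ->
  unit_clique D -> #|S| + #|D| <= 6.
Proof. by move=> bS DS dD uD; apply: (blue_bound bS DS dD); apply: blue_unit_ful bS DS uD. Qed.

Lemma blue4_unit (S D : {set T}) : blue_clique S -> #|S| = 4 -> doubled S ->
  D \subset S -> unit_clique D -> #|D| <= 2.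
Proof.
move=> bS c4 dS DS uD; have := blue_unit_bound bS DS (doubled_sub DS dS) uD; lia.
Qed.

Lemma blue5_unit (S D : {set T}) : blue_clique S -> #|S| = 5 -> doubled S ->
  D \subset S -> unit_clique D -> #|D| <= 1.
Proof.
move=> bS c5 dS DS uD; have := blue_unit_bound bS DS (doubled_sub DS dS) uD; lia.
Qed.

(** This is where r(3,4) = 9 produces the number 8: nine clusters contain a blue 4-set, and at least
    three of its members differ from [u] and are pairwise full and doubled, so 4 + 3 > 6. *)
Lemma unit_star9 (K : {set T}) u : complete K -> 9 <= #|K| -> doubled (K :\ u) ->
  unit_clique (K :\ u) -> False.
Proof.
move=> cK n9 dK uK; have [S [sK S4 bS]] := ramsey_blue r4 cK n9.
have SD : S :\ u \subset K :\ u by apply: setSD.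
have := blue_unit_bound bS (subsetDl _ _) (doubled_sub SD dK) (unit_clique_sub SD uK).
by move: (cardsD1 u S); case: (u \in S); lia.
Qed.

Lemma unit_clique_le8 (K : {set T}) : doubled K -> unit_clique K -> #|K| <= 8.
Proof.
move=> dK uK; rewrite leqNgt; apply/negP => n9.
have [u _] : exists u, u \in K by apply/card_gt0P; lia.
apply: (@unit_star9 K u) => //; first exact: unit_clique_complete.
- exact: doubled_sub (subsetDl _ _) dK.
- exact: unit_clique_sub (subsetDl _ _) uK.
Qed.

(** By r(3,3) = 6 there is a blue triple in [K]. A red pair from [u] to it makes [u] doubled at
    once; without one, [u] and the triple form a blue 4-set with three doubled, pairwise full
    members, and 4 + 3 > 6. *)
Lemma doubled_neighbour (K : {set T}) u : doubled K -> unit_clique K -> 6 <= #|K| ->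
  {in K, forall v, u != v /\ (red g u v || ful g u v)} -> dbl g u.
Proof.
move=> dK uK n6 uv; have [S [sK S3 bS]] := ramsey_blue r3 (unit_clique_complete uK) n6.
case: (boolP [exists v in S, red g u v]) => [/exists_inP[v _]|]; first exact: red_dbl.
move=> /exists_inPn nr; have uS : u \notin S.
  by apply/negP => /(subsetP sK)/uv[]; rewrite eqxx.
have uvf v : v \in S -> ful g u v.
  by move=> vS; have [_] := uv _ (subsetP sK _ vS); rewrite (negbTE (nr _ vS)).
have bu : blue_clique (u |: S).
  move=> x y; rewrite !in_setU1 => /orP[/eqP->|xS] /orP[/eqP->|yS]; rewrite ?eqxx // => xy.
  - by rewrite uvf.
  - by rewrite ful_sym uvf.
  - exact: bS.
have := blue_unit_bound bu (subsetUr _ _) (doubled_sub sK dK) (unit_clique_sub sK uK).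
by rewrite cardsU1 uS S3.
Qed.

Section Core.
Variables (c1 c1' c2 c2' c3 c3' z1 z2 z3 x : T) (K : {set T}).
Let us := [:: z3; z1; c1; z2; c2; c3; c2'; c1'; c3'; x].
Hypotheses (us_uniq : uniq us) (usK : {subset us <= K}) (cK : complete K) (dK : doubled K).
Hypothesis us_hal : forall y z, y \in take 9 us -> z \in take 9 us -> hal g y z ->
  [set y; z] \in [:: [set c1; c1']; [set c2; c2']; [set c3; c3']].
Hypothesis blueC : all (fun p => ~~ red g p.1 p.2)
  [:: (c1, c1'); (c2, c2'); (c3, c3'); (c1, c2); (c1, c2'); (c2, c1'); (c2', c1'); (c3, x); (c3', x)].
Hypothesis ord1 : red g c1 z2 -> red g c1 z1.
Hypothesis ord2 : red g c1 z3 -> red g c1 z2.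

(** The positions in [us] are the search labels 0 to 9. The half pairs at [x], which has label 9,
    are not controlled; this is why full triples are only recognised among the first nine labels. *)
Lemma core_sorted : (red g z1 c2' -> red g z1 c2) -> (red g z1 c3' -> red g z1 c3) -> False.
Proof.
move=> ord3 ord4; pose u i := nth x us i.
have u_inj i j : i < 10 -> j < 10 -> (u i == u j) = (i == j) by move=> *; apply: nth_uniq.
have uK i : i < 10 -> u i \in K by move=> i10; apply/usK/mem_nth.
pose im (t : seq nat) := [set y in [seq u i | i <- t]].
have imK t : all (fun i => i < 10) t -> im t \subset K.
  by move=> /allP t10; apply/subsetP => y; rewrite inE => /mapP[i /t10 i10 ->]; apply: uK.
have im_card t : uniq t -> all (fun i => i < 10) t -> #|im t| = size t.
  move=> ut /allP t10; rewrite cardsE (card_uniqP _) ?size_map // map_inj_in_uniq // => i j it jt.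
  by move=> /eqP; rewrite u_inj ?t10 // => /eqP.
have im_blue t : all (fun i => i < 10) t ->
    (forall i j, i \in t -> j \in t -> i != j -> ~~ red g (u i) (u j)) -> blue_clique (im t).
  move=> t10 H; apply: coclique_blue; first exact: complete_sub (imK _ t10) cK.
  move=> y z; rewrite !inE => /mapP[i it ->] /mapP[j jt ->] ij.
  by apply: H => //; apply: contra_neq ij => ->.
have unit9 i j : i < 9 -> j < 9 -> ~~ half_pair i j -> u i != u j -> red g (u i) (u j) || ful g (u i) (u j).
  move=> i9 j9 nh ij; have /or3P[->|->|h] := cK (uK i (leqW i9)) (uK j (leqW j9)) ij; rewrite ?orbT //.
  have mt k : k < 9 -> u k \in take 9 us.
    by move=> k9; rewrite /u -(nth_take x k9) mem_nth.
  have := us_hal (mt i i9) (mt j j9) h; rewrite !inE => E.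
  have : (u i \in [set u i; u j]) && (u j \in [set u i; u j]) by rewrite !inE !eqxx orbT.
  case/or3P: E => /eqP->; rewrite !inE.
  - rewrite -[c1]/(u 2) -[c1']/(u 7) !u_inj ?(leqW i9) ?(leqW j9) //.
    by case/andP=> [/orP[]/eqP ei /orP[]/eqP ej]; move: nh ij; rewrite ei ej ?eqxx.
  - rewrite -[c2]/(u 4) -[c2']/(u 6) !u_inj ?(leqW i9) ?(leqW j9) //.
    by case/andP=> [/orP[]/eqP ei /orP[]/eqP ej]; move: nh ij; rewrite ei ej ?eqxx.
  - rewrite -[c3]/(u 5) -[c3']/(u 8) !u_inj ?(leqW i9) ?(leqW j9) //.
    by case/andP=> [/orP[]/eqP ei /orP[]/eqP ej]; move: nh ij; rewrite ei ej ?eqxx.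
apply: (@core_contradiction (fun i j => red g (u i) (u j))).
- by move=> i j; apply: red_sym.
- move: blueC; rewrite -[[:: _; _; _; _; _; _; _; _; _]]/[seq (u p.1, u p.2) | p <- blue_pairs].
  by rewrite all_map => /allP H p /H.
- move=> p; rewrite !inE => /or4P[]/eqP->; [|rewrite red_sym; exact: ord2|exact: ord3|exact: ord4].
  by move=> /ord1; rewrite red_sym.
- move=> t s3 ut t10 H; case: t s3 ut t10 H => [|i [|j [|k []]]] //= _.
  rewrite !in_cons !in_nil !orbF negb_or andbT => /andP[/andP[ij ik] jk] _ H.
  have := @red_triangle _ g (u i) (u j) (u k); apply; apply: H; rewrite ?inE ?eqxx ?orbT //.
- move=> t t' s4 ut t10 s3 ss /andP[/allP t9 /allP nh] H.
  have ut' := subseq_uniq ss ut; have sub := mem_subseq ss.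
  have t'10 : all (fun i => i < 10) t' by apply/allP => i /t9/leqW.
  have /(_ (im t')) := blue4_unit (im_blue t t10 H) _ (doubled_sub (imK t t10) dK).
  rewrite !im_card // s4 s3 => /(_ erefl); case/(_ _ _)/negP => //.
    by apply/subsetP => y; rewrite !inE => /mapP[i /sub it ->]; apply: map_f.
  move=> y z; rewrite !inE => /mapP[i it ->] /mapP[j jt ->] ij.
  by apply: unit9 => //; [exact: t9|exact: t9|have /allP := nh _ it; apply].
- move=> t s5 ut t10 H.
  (* At most one of the five labels is 9, and no label has two half partners, so among three labels
     below 9 some pair is not half. *)
  have [i [j [it jt ij nh /andP[i9 j9]]]] : exists i j,
      [/\ i \in t, j \in t, i != j, ~~ half_pair i j & (i < 9) && (j < 9)].
    pose s := [seq i <- t | i < 9]; have s_uniq : uniq s by apply: filter_uniq.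
    have s9 i : i \in s -> i < 9 /\ i \in t by rewrite mem_filter => /andP[].
    have : 3 <= size s.
      have := count_predC (fun i => i < 9) t; rewrite -size_filter -/s s5.
      have : count (predC (fun i => i < 9)) t <= 1.
        2: by move: (size s) (count _ t) => a b; clear; lia.
      rewrite -size_filter; apply: (@uniq_leq_size _ _ [:: 9]); first exact: filter_uniq.
      move=> i; rewrite mem_filter mem_seq1 /= -leqNgt => /andP[i9 /(allP t10) /=].
      by rewrite ltnS eqn_leq i9 => ->.
    case: s s_uniq s9 => [|i [|j [|k s]]] //= + s9 _.
    rewrite !in_cons !negb_or => /andP[/and3P[ij ik _] /andP[/andP[jk' _] _]].
    have [i9 it] := s9 i (mem_head _ _).
    have [|j9 jt] := s9 j; first by rewrite !inE eqxx orbT.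
    have [|k9 kt] := s9 k; first by rewrite !inE eqxx !orbT.
    have chk : all (fun i => all (fun j => all (fun k =>
      [|| j == k, ~~ half_pair i j | ~~ half_pair i k]) (iota 0 9)) (iota 0 9)) (iota 0 9) by [].
    have := allP chk i; rewrite mem_iota => /(_ i9)/allP/(_ j); rewrite mem_iota => /(_ j9)/allP/(_ k).
    rewrite mem_iota => /(_ k9)/or3P[jk|nh|nh].
    - by rewrite jk in jk'.
    - by exists i, j; rewrite i9 j9.
    - by exists i, k; rewrite i9 k9.
  have sij : im [:: i; j] \subset im t.
    by apply/subsetP => y; rewrite !inE => /orP[]/eqP->; apply: map_f.
  have := blue5_unit (im_blue t t10 H) _ (doubled_sub (imK t t10) dK) sij.
  have i10 := leqW i9; have j10 := leqW j9.
  rewrite !im_card //= ?inE ?ij ?i10 ?j10 // => /(_ s5); case/(_ _)/negP => //.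
  move=> y z; rewrite !inE => /orP[]/eqP-> /orP[]/eqP->; rewrite ?eqxx // => yz; first exact: unit9.
  by rewrite red_sym ful_sym unit9 // u_inj.
Qed.

End Core.

(** The other hypotheses survive exchanging [c2] with [c2'] or [c3] with [c3'], so each of these
    pairs may be put in the order, by colour at [z1], that the search assumes. *)
Lemma core_impossible c1 c1' c2 c2' c3 c3' z1 z2 z3 x (K : {set T}) :
  uniq [:: z3; z1; c1; z2; c2; c3; c2'; c1'; c3'; x] ->
  {subset [:: z3; z1; c1; z2; c2; c3; c2'; c1'; c3'; x] <= K} -> complete K -> doubled K ->
  (forall y z, y \in [:: z3; z1; c1; z2; c2; c3; c2'; c1'; c3'] ->
     z \in [:: z3; z1; c1; z2; c2; c3; c2'; c1'; c3'] -> hal g y z ->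
     [set y; z] \in [:: [set c1; c1']; [set c2; c2']; [set c3; c3']]) ->
  [&& ~~ red g c1 c1', ~~ red g c2 c2', ~~ red g c3 c3',
      ~~ red g c1 c2, ~~ red g c1 c2', ~~ red g c2 c1', ~~ red g c2' c1',
      ~~ red g c3 x & ~~ red g c3' x] ->
  (red g c1 z2 -> red g c1 z1) -> (red g c1 z3 -> red g c1 z2) -> False.
Proof.
move=> u uK cK dK uh bl o1 o2.
have sort_pair a b : exists p : T * T,
    (p = (a, b) \/ p = (b, a)) /\ (red g z1 p.2 -> red g z1 p.1).
  by case E: (red g z1 a); [exists (a, b)|exists (b, a)]; split=> //=; [left|right|rewrite E].
have [[d d'] /= [e2 o3]] := sort_pair c2 c2'; have [[e e'] /= [e3 o4]] := sort_pair c3 c3'.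
pose us := [:: z3; z1; c1; z2; d; e; d'; c1'; e'; x].
have [pus [p9 [s2 [s3 bl']]]] : us =i [:: z3; z1; c1; z2; c2; c3; c2'; c1'; c3'; x] /\
   take 9 us =i [:: z3; z1; c1; z2; c2; c3; c2'; c1'; c3'] /\ [set d; d'] = [set c2; c2'] /\
   [set e; e'] = [set c3; c3'] /\
   all (fun p => ~~ red g p.1 p.2)
     [:: (c1, c1'); (d, d'); (e, e'); (c1, d); (c1, d'); (d, c1'); (d', c1'); (e, x); (e', x)].
  rewrite /us; case/and5P: bl => b1 b2 b3 b4 /and5P[b5 b6 b7 b8 b9]; case: e2 => [[-> ->]|[-> ->]]; case: e3 => [[-> ->]|[-> ->]]; rewrite /= ?(setUC [set c2']) ?(setUC [set c3']); do !split => //;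
    try (by do !(apply/andP; split=> //); rewrite // red_sym);
    by move=> t; rewrite !inE; do ?case: eqP => //=.
apply: (@core_sorted c1 c1' d d' e e' z1 z2 z3 x K) => //.
- by rewrite (eq_uniq _ pus).
- by move=> y; rewrite pus; apply: uK.
- by move=> y z; rewrite !p9 s2 s3; apply: uh.
Qed.

End Reduced.

(** * Half pairs leaving a set without half pairs *)

Section Private.
Variables (T : finType) (g : reduced T) (K : {set T}).
Hypotheses (cK : complete g K) (dK : doubled g K).
Let blue_clique := blue_clique g.
Let r4 := ramsey4 (red_sym g) (@red_triangle _ g).

Lemma blue_clique_sub (S S' : {set T}) : S' \subset S -> blue_clique S -> blue_clique S'.
Proof. by move=> /subsetP s c x y /s xS /s; apply: c. Qed.

Lemma blue_cliqueU (A B : {set T}) : blue_clique A -> blue_clique B ->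
  {in A & B, forall x y, x != y -> ful g x y || hal g x y} -> blue_clique (A :|: B).
Proof.
move=> bA bB AB x y; rewrite !in_setU => /orP[] xA /orP[] yA xy.
- exact: bA.
- exact: AB.
- by rewrite ful_sym hal_sym AB // eq_sym.
- exact: bB.
Qed.

Lemma hal_in_triple (S D : {set T}) : S \subset K -> blue_clique S -> #|S| = 4 -> D \subset S ->
  2 < #|D| -> exists y z, [/\ y \in D, z \in D & hal g y z].
Proof.
move=> SK bS S4 DS; rewrite ltnNge => /negP D3.
have [/existsP[y /existsP[z /and3P[]]]|/existsPn nh] :=
  boolP [exists y, exists z, [&& y \in D, z \in D & hal g y z]]; first by exists y, z.
case: D3; apply: (blue4_unit bS S4 (doubled_sub SK dK) DS) => y z yD zD yz.
have /orP[->|h] := bS _ _ (subsetP DS _ yD) (subsetP DS _ zD) yz; first by rewrite orbT.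
by case/existsP: (nh y); exists z; apply/and3P.
Qed.

Variable I : {set T}.
Hypotheses (IK : I \subset K) (uI : unit_clique g I).

(** As [K] is complete, [b] is then red or full to every other vertex of [I]. *)
Definition private (v b : T) :=
  [/\ v \in I, b \in K :\: I, hal g v b & {in I, forall w, hal g w b -> w = v}].

Lemma unit_hal y z : y \in I -> z \in I -> hal g y z -> False.
Proof.
move=> yI zI h; have yz : y != z by apply: contraTneq h => ->; rewrite hal_irr.
by have := uI yI zI yz; case/orP=> [/red_hal|/ful_hal]; rewrite h.
Qed.

Lemma blue4_I (S : {set T}) : S \subset K -> blue_clique S -> #|S| = 4 -> #|S :&: I| <= 2.
Proof.
move=> SK bS S4; apply: (blue4_unit bS S4 (doubled_sub SK dK) (subsetIl _ _)).
exact: unit_clique_sub (subsetIr _ _) uI.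
Qed.

(** Without [v], the vertex [b] and two members of [S] in [I] would be a triple free of half pairs
    inside a blue 4-set of doubled clusters. *)
Lemma private_mem (S : {set T}) v b : S \subset K -> blue_clique S -> #|S| = 4 -> private v b ->
  b \in S -> 2 <= #|S :&: I| -> v \in S.
Proof.
move=> SK bS S4 [vI bKI vb vu] bS' SI2.
have bI : b \notin I by move: bKI; rewrite inE => /andP[].
have DS : b |: (S :&: I) \subset S by rewrite subUset sub1set bS' subsetIl.
have D3 : 2 < #|b |: (S :&: I)| by rewrite cardsU1 inE (negbTE bI) andbF /= add1n ltnS.
have [y [z [yD zD h]]] := hal_in_triple SK bS S4 DS D3.
move: yD zD h; rewrite !inE => /orP[/eqP->|/andP[yS yI]] /orP[/eqP->|/andP[zS zI]].
- by rewrite hal_irr.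
- by rewrite hal_sym => /(vu _ zI) <-.
- by move/(vu _ yI) => <-.
- by move/(unit_hal yI zI).
Qed.

Lemma blue4_extra (S U : {set T}) : S \subset I :|: U -> S \subset K -> blue_clique S -> #|S| = 4 ->
  #|S :&: I| <= 2 /\ #|S :\: I| = 4 - #|S :&: I|.
Proof. by move=> SU SK bS S4; rewrite cardsD S4 blue4_I. Qed.

Section Seven.
Hypothesis I7 : #|I| = 7.

(** The seven vertices of [I] with [b] and [x] are nine, so they contain a blue 4-set; it has at
    most two members in [I], hence contains both [b] and [x]. *)
Lemma seven_pair v b x : private v b -> x \in K :\: I -> x != b ->
  exists S : {set T}, [/\ S \subset K, blue_clique S, #|S| = 4, #|S :&: I| = 2 & [/\ v \in S, b \in S & x \in S]].
Proof.
move=> pb xKI xb; have [vI + vb vu] := pb; move: xKI; rewrite !inE => /andP[xI xK] /andP[bI bK].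
have UK : I :|: [set b; x] \subset K by rewrite subUset IK subUset !sub1set bK xK.
have dis : [disjoint I & [set b; x]].
  by rewrite disjoint_sym disjoints_subset subUset !sub1set !inE bI xI.
have c9 : 9 <= #|I :|: [set b; x]|.
  by rewrite cardsU I7 cards2 eq_sym xb (disjoint_setI0 dis) cards0.
have [S [SU S4 bS]] := ramsey_blue r4 (complete_sub UK cK) c9.
have SK := subset_trans SU UK; have [SI SD] := blue4_extra SU SK bS S4.
have Dbx : S :\: I \subset [set b; x] by rewrite subDset.
have c2 : #|S :\: I| <= 2 by rewrite (leq_trans (subset_leq_card Dbx)) // cards2; case: (b != x).
have Deq : S :\: I = [set b; x].
  by apply/eqP; rewrite eqEcard Dbx cards2 SD; case: (b != x); move: SI; case: #|_| => [|[|[]]].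
have SI2 : #|S :&: I| = 2 by move: SD c2 SI; case: (#|S :&: I|) => [|[|[]]] // ->.
have /andP[_ bS'] : (b \notin I) && (b \in S) by rewrite -in_setD Deq !inE eqxx.
have /andP[_ xS'] : (x \notin I) && (x \in S) by rewrite -in_setD Deq !inE eqxx orbT.
by exists S; split=> //; split=> //; apply: private_mem pb _ _ => //; rewrite SI2.
Qed.

(** The 4-sets obtained for the pairs b1 b2, b1 x and b2 x fit together into a blue 5-set v1, b1,
    v2, b2, x. Its pair v1 v2 is full, and 5 + 2 > 6. *)
Lemma seven_no_extra v1 b1 v2 b2 x : private v1 b1 -> private v2 b2 -> v1 != v2 ->
  x \in K :\: I -> x != b1 -> x != b2 -> False.
Proof.
move=> p1 p2 v12 xKI xb1 xb2.
have [v1I b1KI v1b1 u1] := p1; have [v2I b2KI v2b2 u2] := p2.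
have b12 : b2 != b1.
  by apply: contra_neq v12 => b12; apply: u2; rewrite // b12.
have [S [SK bS S4 SI [v1S b1S b2S]]] := seven_pair p1 b2KI b12.
have v2S : v2 \in S by apply: (private_mem SK bS S4 p2) => //; rewrite SI.
have [S1 [SK1 bS1 _ _ [v1S1 b1S1 xS1]]] := seven_pair p1 xKI xb1.
have [S2 [SK2 bS2 _ _ [v2S2 b2S2 xS2]]] := seven_pair p2 xKI xb2.
have nI y z : y \in I -> z \in K :\: I -> y != z.
  by move=> yI; apply: contraTneq => <-; rewrite inE yI.
have Seq : [set v1; b1; v2; b2] = S.
  apply/eqP; rewrite eqEcard S4 !subUset !sub1set v1S b1S v2S b2S /=.
  have -> : [set v1; b1; v2; b2] = [set v1; v2] :|: [set b1; b2].
    by apply/setP => y; rewrite !inE; do ?case: eqP => //=.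
  rewrite cardsU !cards2 v12 eq_sym b12 (_ : _ :&: _ = set0) ?cards0 //.
  apply/setP => y; rewrite !inE; apply/negP => /andP[/orP[]/eqP-> /orP[]/eqP E].
  - by have := nI _ _ v1I b1KI; rewrite E eqxx.
  - by have := nI _ _ v1I b2KI; rewrite E eqxx.
  - by have := nI _ _ v2I b1KI; rewrite E eqxx.
  - by have := nI _ _ v2I b2KI; rewrite E eqxx.
have xS : x \notin S.
  by rewrite -Seq !inE (eq_sym x v1) (eq_sym x v2) !(negbTE (nI _ _ _ xKI)) // (negbTE xb1) (negbTE xb2).
have b5 : blue_clique (x |: S).
  apply: blue_cliqueU => //; first by move=> y z /set1P-> /set1P->; rewrite eqxx.
  move=> y z /set1P->; rewrite -Seq !inE -!orbA => /or4P[]/eqP-> zx; [apply: bS1|apply: bS1|apply: bS2|apply: bS2] => //.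
have := @blue5_unit _ g (x |: S) [set v1; v2] b5.
rewrite cardsU1 xS S4 cards2 v12 => /(_ erefl).
case/(_ _ _ _)/negP => //.
- by apply: doubled_sub dK; rewrite subUset sub1set SK andbT; move: xKI; rewrite inE => /andP[].
- by rewrite subUset !sub1set !inE v1S v2S !orbT.
- by apply: unit_clique_sub uI; rewrite subUset !sub1set v1I.
Qed.
End Seven.

Section Six.
Hypothesis I6 : #|I| = 6.

Lemma six_triple (U : {set T}) : U \subset K :\: I -> #|U| = 3 ->
  exists S : {set T}, [/\ S \subset I :|: U, S \subset K, blue_clique S & #|S| = 4].
Proof.
move=> UKI U3; have UI : U :&: I = set0.
  by apply/eqP; rewrite setI_eq0 disjoints_subset; move: UKI; rewrite subsetD => /andP[_]; rewrite disjoints_subset.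
have UK : I :|: U \subset K by rewrite subUset IK; move: UKI; rewrite subsetD => /andP[].
have [|S [SU S4 bS]] := ramsey_blue r4 (complete_sub UK cK).
  by rewrite cardsU I6 U3 setIC UI cards0.
by exists S; split=> //; apply: subset_trans SU UK.
Qed.

(* With at most two vertices of the clique in [I], at least two others are in [U]; when
   exactly one is in [I], all of [U] is. *)
Lemma six_cases (S U : {set T}) : S \subset I :|: U -> S \subset K -> blue_clique S -> #|S| = 4 -> #|U| = 3 ->
  #|S :&: I| = 2 /\ 2 <= #|S :&: U| \/ U \subset S /\ 0 < #|S :&: I|.
Proof.
move=> SU SK bS S4 U3; have [SI SD] := blue4_extra SU SK bS S4.
have DU : S :\: I \subset S :&: U by rewrite subsetI subsetDl subDset.
have := subset_leq_card DU; have := subset_leq_card (subsetIr S U); rewrite U3 SD.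
case: (#|S :&: I|) SI => [|[|[]]] //= _ c3 c.
- by have := leq_trans c c3.
- right; split=> //; apply/setIidPr/eqP; rewrite eqEcard subsetIr U3 //.
- by left.
Qed.

Definition good v b v' b' := blue_clique [set v; b; v'; b'].

Lemma six_mem2 (S : {set T}) a b c : 2 <= #|S :&: [set a; b; c]| ->
  (a \in S) && (b \in S) || ((a \in S) && (c \in S) || (b \in S) && (c \in S)).
Proof.
have c1 y : #|S :&: [set y]| = (y \in S).
  by case: (boolP (y \in S)) => yS; [rewrite (setIidPr _) ?sub1set ?cards1|apply/eqP;
    rewrite cards_eq0 setI_eq0 disjoint_sym disjoints_subset sub1set inE].
have h : #|S :&: [set a; b; c]| <= (a \in S) + (b \in S) + (c \in S).
  rewrite !setIUr (leq_trans (leq_card_setU _ _).1) // c1 leq_add2r.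
  by rewrite (leq_trans (leq_card_setU _ _).1) // !c1.
by move=> /leq_trans/(_ h); do 3 case: (_ \in S).
Qed.

Lemma cards3 (a b c : T) : a != b -> a != c -> b != c -> #|[set a; b; c]| = 3.
Proof. by move=> ab ac bc; rewrite -setUA cardsU1 cards2 !inE negb_or ab ac bc. Qed.

Lemma good_of_mem (S : {set T}) v b v' b' : S \subset K -> blue_clique S -> #|S| = 4 -> #|S :&: I| = 2 ->
  private v b -> private v' b' -> b \in S -> b' \in S -> good v b v' b'.
Proof.
move=> SK bS S4 SI p p' bS' b'S; apply: (blue_clique_sub _ bS).
by rewrite !subUset !sub1set bS' b'S (private_mem SK bS S4 p) ?(private_mem SK bS S4 p') ?SI.
Qed.

Lemma blue_of_mem (S : {set T}) v b x : S \subset K -> blue_clique S -> #|S| = 4 -> #|S :&: I| = 2 ->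
  private v b -> b \in S -> x \in S -> blue_clique [set v; b; x].
Proof.
move=> SK bS S4 SI p bS' xS; apply: (blue_clique_sub _ bS).
by rewrite !subUset !sub1set bS' xS (private_mem SK bS S4 p) ?SI.
Qed.

(** Again nine vertices give a blue 4-set. It cannot contain all of [b1], [b2], [b3], which have no
    half pair among them, so it consists of two of them and two vertices of [I], which must be their
    partners. *)
Lemma six_good v1 b1 v2 b2 v3 b3 : private v1 b1 -> private v2 b2 -> private v3 b3 ->
  b1 != b2 -> b1 != b3 -> b2 != b3 -> ~~ hal g b1 b2 -> ~~ hal g b1 b3 -> ~~ hal g b2 b3 ->
  good v1 b1 v2 b2 \/ good v1 b1 v3 b3 \/ good v2 b2 v3 b3.
Proof.
move=> p1 p2 p3 b12 b13 b23 h12 h13 h23.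
have [[_ b1KI _ _] [_ b2KI _ _] [_ b3KI _ _]] := And3 p1 p2 p3.
have UKI : [set b1; b2; b3] \subset K :\: I by rewrite !subUset !sub1set b1KI b2KI.
have U3 := cards3 b12 b13 b23; have [S [SU SK bS S4]] := six_triple UKI U3.
have [[SI /six_mem2]|[US _]] := six_cases SU SK bS S4 U3.
  by case/or3P => /andP[x y]; [left|right; left|right; right]; apply: (good_of_mem SK bS S4 SI).
have [|y [z []]] := hal_in_triple SK bS S4 US; first by rewrite U3.
rewrite !inE -!orbA => /or3P[]/eqP-> /or3P[]/eqP->; rewrite ?hal_irr ?(negbTE h12) ?(negbTE h13) ?(negbTE h23) //;
  by rewrite hal_sym ?(negbTE h12) ?(negbTE h13) ?(negbTE h23).
Qed.

(** As in [six_good], except that the 4-set may now consist of [b1], [b2], [x] and one vertex of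
    [I]. The half pair required among [b1], [b2] and that vertex forces it to be [v1] or [v2]. *)
Lemma six_pair v1 b1 v2 b2 x : private v1 b1 -> private v2 b2 -> b1 != b2 -> ~~ hal g b1 b2 ->
  x \in K :\: I -> x != b1 -> x != b2 ->
  good v1 b1 v2 b2 \/ blue_clique [set v1; b1; x] \/ blue_clique [set v2; b2; x].
Proof.
move=> p1 p2 b12 h12 xKI xb1 xb2.
have [[v1I b1KI _ u1] [v2I b2KI _ u2]] := conj p1 p2.
have UKI : [set b1; b2; x] \subset K :\: I by rewrite !subUset !sub1set b1KI b2KI.
have U3 : #|[set b1; b2; x]| = 3 by apply: cards3; rewrite // eq_sym.
have [S [SU SK bS S4]] := six_triple UKI U3.
have [[SI /six_mem2]|[US /card_gt0P[p]]] := six_cases SU SK bS S4 U3.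
  case/or3P => /andP[y z].
  - by left; apply: (good_of_mem SK bS S4 SI).
  - by right; left; apply: (blue_of_mem SK bS S4 SI).
  - by right; right; apply: (blue_of_mem SK bS S4 SI).
rewrite inE => /andP[pS pI]; move: US; rewrite !subUset !sub1set -andbA => /and3P[b1S b2S xS].
have nI y : y \in K :\: I -> y != p by rewrite inE => /andP[yI _]; apply: contraNneq yI => ->.
have D3 := cards3 b12 (nI _ b1KI) (nI _ b2KI).
have DS : [set b1; b2; p] \subset S by rewrite !subUset !sub1set b1S b2S.
have blue v b : b \in S -> v = p -> blue_clique [set v; b; x].
  by move=> bS' ->; apply: (blue_clique_sub _ bS); rewrite !subUset !sub1set pS bS'.
have [|y [z []]] := hal_in_triple SK bS S4 DS; first by rewrite D3.
rewrite !inE -!orbA => /or3P[]/eqP-> /or3P[]/eqP->; rewrite ?hal_irr ?(negbTE h12) //.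
- by rewrite hal_sym => /(u1 _ pI)/esym/(blue _ b1 b1S); right; left.
- by rewrite hal_sym (negbTE h12).
- by rewrite hal_sym => /(u2 _ pI)/esym/(blue _ b2 b2S); right; right.
- by move=> /(u1 _ pI)/esym/(blue _ b1 b1S); right; left.
- by move=> /(u2 _ pI)/esym/(blue _ b2 b2S); right; right.
Qed.

Lemma good_blue_blue v1 b1 v2 b2 x : private v1 b1 -> private v2 b2 -> v1 != v2 -> b1 != b2 ->
  x \in K :\: I -> x != b1 -> x != b2 ->
  good v1 b1 v2 b2 -> blue_clique [set v1; b1; x] -> blue_clique [set v2; b2; x] -> False.
Proof.
move=> p1 p2 v12 b12 xKI xb1 xb2 g12 x1 x2.
have [[v1I b1KI _ _] [v2I b2KI _ _]] := conj p1 p2.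
have nI y z : y \in I -> z \in K :\: I -> y != z.
  by move=> yI; apply: contraTneq => <-; rewrite inE yI.
have b5 : blue_clique (x |: [set v1; b1; v2; b2]).
  apply: blue_cliqueU => //; first by move=> y z /set1P-> /set1P->; rewrite eqxx.
  by move=> y z /set1P->; rewrite !inE -!orbA => /or4P[]/eqP-> zx; [apply: x1|apply: x1|apply: x2|apply: x2];
    rewrite ?inE ?eqxx ?orbT.
have us : uniq [:: x; v1; b1; v2; b2].
  by rewrite /= !inE !negb_or xb1 xb2 b12 v12 (eq_sym x v1) (eq_sym x v2) (eq_sym b1 v2) !nI.
have Sus : x |: [set v1; b1; v2; b2] = [set y in [:: x; v1; b1; v2; b2]].
  by apply/setP => y; rewrite !inE -!orbA.
have c5 : #|x |: [set v1; b1; v2; b2]| = 5 by rewrite Sus cardsE (card_uniqP us).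
have in_K z : z \in K :\: I -> z \in K by rewrite inE => /andP[].
have := @blue5_unit _ g _ [set v1; v2] b5 c5; rewrite cards2 v12; case/(_ _ _ _)/negP => //.
- by apply: doubled_sub dK; rewrite !subUset !sub1set (in_K _ xKI) (in_K _ b1KI) (in_K _ b2KI) !(subsetP IK).
- by rewrite !subUset !sub1set !inE !eqxx !orbT.
- by apply: unit_clique_sub uI; rewrite subUset !sub1set v1I.
Qed.

Lemma good3 v1 b1 v2 b2 v3 b3 : private v1 b1 -> private v2 b2 -> private v3 b3 ->
  v1 != v2 -> v1 != v3 -> v2 != v3 -> b1 != b2 -> b1 != b3 -> b2 != b3 ->
  good v1 b1 v2 b2 -> good v1 b1 v3 b3 -> good v2 b2 v3 b3 -> False.
Proof.
move=> p1 p2 p3 v12 v13 v23 b12 b13 b23 g12 g13 g23.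
have [[v1I b1KI _ _] [v2I b2KI _ _] [v3I b3KI _ _]] := And3 p1 p2 p3.
apply: (good_blue_blue p1 p2 v12 b12 b3KI) => //; rewrite 1?eq_sym //.
- by apply: blue_clique_sub g13; rewrite !subUset !sub1set !inE !eqxx !orbT.
- by apply: blue_clique_sub g23; rewrite !subUset !sub1set !inE !eqxx !orbT.
Qed.

(** The configuration left to the search: the six vertices of [I], the three private neighbours and
    [x], with the blue sets of the last two hypotheses fixed. *)
Lemma six_core v1 b1 v2 b2 v3 b3 x : private v1 b1 -> private v2 b2 -> private v3 b3 ->
  v1 != v2 -> v1 != v3 -> v2 != v3 -> b1 != b2 -> b1 != b3 -> b2 != b3 ->
  ~~ hal g b1 b2 -> ~~ hal g b1 b3 -> ~~ hal g b2 b3 ->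
  x \in K :\: I -> x != b1 -> x != b2 -> x != b3 ->
  good v1 b1 v2 b2 -> blue_clique [set v3; b3; x] -> False.
Proof.
move=> p1 p2 p3 v12 v13 v23 b12 b13 b23 h12 h13 h23 xKI xb1 xb2 xb3 g12 x3.
have [[v1I b1KI vb1 u1] [v2I b2KI vb2 u2] [v3I b3KI vb3 u3]] := And3 p1 p2 p3.
pose Z := I :\: [set v1; v2; v3].
(* The three remaining vertices of [I] are listed with the red neighbours of [v1] first, as the
   symmetry breaking demands. *)
pose s := [seq z <- enum Z | red g v1 z] ++ [seq z <- enum Z | ~~ red g v1 z].
have s_perm : perm_eq s (enum Z) by rewrite perm_filterC.
have : size s = 3.
  rewrite (perm_size s_perm) -cardE cardsD I6 (setIidPr _) ?cards3 //.
  by rewrite !subUset !sub1set v1I v2I.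
have s_uniq : uniq s by rewrite (perm_uniq s_perm) enum_uniq.
have sZ z : z \in s -> z \in Z by rewrite (perm_mem s_perm) mem_enum.
have sE : s = [seq z <- enum Z | red g v1 z] ++ [seq z <- enum Z | ~~ red g v1 z] by [].
have s_sorted a b : a < b -> b < size s -> forall z, red g v1 (nth z s b) -> red g v1 (nth z s a).
  move=> ab bs z; rewrite sE !nth_cat; case: ltnP => [bl _|bl].
    have al := ltn_trans ab bl; rewrite al.
    by have := mem_nth z al; rewrite mem_filter => /andP[].
  have : b - size [seq z <- enum Z | red g v1 z] < size [seq z <- enum Z | ~~ red g v1 z].
    by rewrite ltn_subLR // -size_cat.
  by move=> /(mem_nth z); rewrite mem_filter => /andP[/negbTE->].
case: s s_uniq sZ s_sorted {sE s_perm} => [|z1 [|z2 [|z3 []]]] // s_uniq sZ s_sorted _.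
have [z1Z z2Z z3Z] : [/\ z1 \in Z, z2 \in Z & z3 \in Z] by split; apply: sZ; rewrite !inE eqxx ?orbT.
have nI y z : y \in I -> z \in K :\: I -> y != z.
  by move=> yI; apply: contraTneq => <-; rewrite inE yI.
have in_K z : z \in K :\: I -> z \in K by rewrite inE => /andP[].
have ZI z : z \in Z -> [/\ z \in I, z != v1, z != v2 & z != v3].
  by rewrite !inE !negb_or -!andbA => /and4P[-> -> -> ->].
have [[z1I z11 z12 z13] [z2I z21 z22 z23] [z3I z31 z32 z33]] := And3 (ZI _ z1Z) (ZI _ z2Z) (ZI _ z3Z).
have nb S' y z : blue_clique S' -> y \in S' -> z \in S' -> ~~ red g y z.
  move=> bS' yS zS; apply/negP => r; have [E|ne] := eqVneq y z.
    by rewrite E red_irr in r.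
  by have := bS' _ _ yS zS ne; rewrite (red_ful r) (red_hal r).
apply: (@core_impossible _ g v1 b1 v2 b2 v3 b3 z1 z2 z3 x K) => //.
- move: s_uniq; rewrite /= !inE !negb_or => /andP[/andP[z1z2 z1z3] /andP[z2z3 _]].
  rewrite ?z1z2 ?z1z3 ?z2z3 ?z11 ?z12 ?z13 ?z21 ?z22 ?z23 ?z31 ?z32 ?z33 ?v12 ?v13 ?v23.
  rewrite ?(eq_sym v1 z2) ?(eq_sym z3 z1) ?(eq_sym z3 z2) ?z1z2 ?z1z3 ?z2z3 ?z21.
  rewrite ?(eq_sym b2 b1) ?(eq_sym b3 b1) ?(eq_sym b3 b2) ?b12 ?b13 ?b23.
  rewrite ?(eq_sym b1 x) ?(eq_sym b2 x) ?(eq_sym b3 x) ?xb1 ?xb2 ?xb3.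
  by rewrite ?(eq_sym b2 b1) ?b12 ?(eq_sym b1 b3) ?(eq_sym b2 v3) !nI.
- have in_IK z : z \in I -> z \in K by apply: (subsetP IK).
  move=> y; rewrite !inE.
  move=> /or4P[/eqP->|/eqP->|/eqP->|/or4P[/eqP->|/eqP->|/eqP->|/or4P[/eqP->|/eqP->|/eqP->|/eqP->]]].
  all: try exact: in_IK. all: try exact: in_K.
- have W y : y \in [:: z3; z1; v1; z2; v2; v3; b2; b1; b3] -> y \in I \/ y \in [:: b1; b2; b3].
    rewrite !inE.
    by move=> /or4P[/eqP->|/eqP->|/eqP->|/or4P[/eqP->|/eqP->|/eqP->|/or3P[/eqP->|/eqP->|/eqP->]]];
      [left|left|left|left|left|left|right|right|right]; rewrite ?eqxx ?orbT.
  have IB y z : y \in I -> z \in [:: b1; b2; b3] -> hal g y z ->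
      [set y; z] \in [:: [set v1; b1]; [set v2; b2]; [set v3; b3]].
    move=> yI; rewrite !inE => /or3P[]/eqP-> h.
    - by rewrite (u1 _ yI h) eqxx.
    - by rewrite (u2 _ yI h) eqxx orbT.
    - by rewrite (u3 _ yI h) eqxx !orbT.
  move=> y z /W[yI|yB] /W[zI|zB] h.
  - by case: (unit_hal yI zI h).
  - exact: IB.
  - by rewrite setUC IB // hal_sym.
  - exfalso; move: yB zB h; rewrite !inE => /or3P[]/eqP-> /or3P[]/eqP->;
      by rewrite ?hal_irr ?(negbTE h12) ?(negbTE h13) ?(negbTE h23) // hal_sym
        ?(negbTE h12) ?(negbTE h13) ?(negbTE h23).
- do !(apply/andP; split).
  all: try by apply: (nb _ _ _ g12); rewrite !inE ?eqxx ?orbT.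
  all: try by apply: (nb _ _ _ x3); rewrite !inE ?eqxx ?orbT.
- by apply: (s_sorted 0 1).
- by apply: (s_sorted 1 2).
Qed.

Lemma six_no_extra v1 b1 v2 b2 v3 b3 x : private v1 b1 -> private v2 b2 -> private v3 b3 ->
  v1 != v2 -> v1 != v3 -> v2 != v3 -> b1 != b2 -> b1 != b3 -> b2 != b3 ->
  ~~ hal g b1 b2 -> ~~ hal g b1 b3 -> ~~ hal g b2 b3 ->
  x \in K :\: I -> x != b1 -> x != b2 -> x != b3 -> False.
Proof.
move=> p1 p2 p3 v12 v13 v23 b12 b13 b23 h12 h13 h23 xKI xb1 xb2 xb3.
have A := six_good p1 p2 p3 b12 b13 b23 h12 h13 h23.
have B12 := six_pair p1 p2 b12 h12 xKI xb1 xb2.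
have B13 := six_pair p1 p3 b13 h13 xKI xb1 xb3.
have B23 := six_pair p2 p3 b23 h23 xKI xb2 xb3.
have N12 := good_blue_blue p1 p2 v12 b12 xKI xb1 xb2.
have N13 := good_blue_blue p1 p3 v13 b13 xKI xb1 xb3.
have N23 := good_blue_blue p2 p3 v23 b23 xKI xb2 xb3.
have N := good3 p1 p2 p3 v12 v13 v23 b12 b13 b23.
have C12 := six_core p1 p2 p3 v12 v13 v23 b12 b13 b23 h12 h13 h23 xKI xb1 xb2 xb3.
have C13 : good v1 b1 v3 b3 -> blue_clique [set v2; b2; x] -> False.
  by apply: (six_core p1 p3 p2); rewrite // 1?eq_sym // hal_sym.
have C23 : good v2 b2 v3 b3 -> blue_clique [set v1; b1; x] -> False.
  by apply: (six_core p2 p3 p1); rewrite // 1?eq_sym // hal_sym.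
(* Say pair 12 is good. Then triple 3 is not blue, so pair 13 is good or triple 1 is blue, and pair
   23 is good or triple 2 is blue; the four combinations contradict [N], [C13], [C23] and [N12]. The
   other cases are alike. *)
tauto.
Qed.
End Six.
End Private.

From mathcomp Require Import all_boot all_order all_algebra all_fingroup.
From mathcomp Require Import all_classical all_reals all_analysis.
From mathcomp Require Import fintype finset.
From mathcomp Require Import zify ring lra.
Import Order.TTheory GRing.Theory Num.Theory.
Import numFieldNormedType.Exports.
Local Open Scope ring_scope.

(** * Quadratic forms on the simplex *)

Section Form.
Variables (R : realType) (T : finType) (q : T -> T -> R).
Hypotheses (q_sym : forall i j, q i j = q j i) (q_diag : forall i, q i i = 1).
Hypotheses (q_ge0 : forall i j, 0 <= q i j) (q_le1 : forall i j, q i j <= 1).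
Implicit Types x y d : T -> R.

Definition form x y := \sum_i \sum_j q i j * x i * y j.
Definition deg x i := \sum_j q i j * x j.

Lemma formE x y : form x y = \sum_i x i * deg y i.
Proof.
apply: eq_bigr => i _; rewrite mulr_sumr; apply: eq_bigr => j _.
by rewrite mulrA [x i * _]mulrC.
Qed.

Lemma formC x y : form x y = form y x.
Proof.
rewrite /form exchange_big; apply: eq_bigr => i _; apply: eq_bigr => j _.
by rewrite q_sym; ring.
Qed.

Lemma form_perturb x d t :
  form (fun k => x k + t * d k) (fun k => x k + t * d k) =
  form x x + 2 * t * form d x + t ^+ 2 * form d d.
Proof.
rewrite mulr2n mulrDl mulrDl mul1r {2}[form d x]formC !mulr_sumr -!big_split /=.
apply: eq_bigr => i _; rewrite !mulr_sumr -!big_split /=; apply: eq_bigr => j _; ring.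
Qed.

Definition swap_dir (i j k : T) : R := (k == i)%:R - (k == j)%:R.

Lemma sum_delta (f : T -> R) i : \sum_k (k == i)%:R * f k = f i.
Proof.
rewrite (bigD1 i) //= eqxx mul1r big1 ?addr0 // => k /negbTE->.
by rewrite mul0r.
Qed.

Lemma sum_swap (f : T -> R) i j : \sum_k swap_dir i j k * f k = f i - f j.
Proof.
rewrite -(sum_delta f i) -(sum_delta f j) -sumrB; apply: eq_bigr => k _.
by rewrite -mulrBl.
Qed.

Lemma sum_swap0 i j : \sum_k swap_dir i j k = 0.
Proof.
by rewrite -[RHS](subrr 1) -(sum_swap (fun=> 1) i j); apply: eq_bigr => k _; rewrite mulr1.
Qed.

Lemma form_swap i j x : form (swap_dir i j) x = deg x i - deg x j.
Proof. by rewrite formE sum_swap. Qed.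

Lemma form_swap2 i j : form (swap_dir i j) (swap_dir i j) = 2 - 2 * q i j.
Proof.
rewrite form_swap.
have dE k : deg (swap_dir i j) k = q k i - q k j.
  by rewrite -sum_swap; apply: eq_bigr => l _; rewrite mulrC.
by rewrite !dE !q_diag (q_sym j i); ring.
Qed.

Lemma form_ge0 x : (forall i, 0 <= x i) -> 0 <= form x x.
Proof. by move=> x0; do 2 (apply: sumr_ge0 => ? _); rewrite !mulr_ge0. Qed.

Lemma form_ge_sqr x : (forall i, 0 <= x i) -> \sum_i x i ^+ 2 <= form x x.
Proof.
move=> x0; apply: ler_sum => i _; rewrite (bigD1 i) //= q_diag mul1r -expr2 lerDl.
by apply: sumr_ge0 => j _; rewrite !mulr_ge0.
Qed.

(* Moving weight between two vertices [i], [j] with [q i j = 1] changes the form linearly,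
   so one of the two can be emptied. *)
Lemma reduce_support x : (forall i, 0 <= x i) -> exists y,
  [/\ forall i, 0 <= y i, \sum_i y i = \sum_i x i, form y y <= form x x,
      forall i, x i = 0 -> y i = 0 &
      forall i j, i != j -> q i j = 1 -> y i = 0 \/ y j = 0].
Proof.
have [n] := ubnP #|[set i | x i != 0]|; elim: n x => // n IH x; rewrite ltnS => sx x0.
have [[i [j [ij qij xi xj]]]|no] := pselect (exists i j, [/\ i != j, q i j = 1, x i != 0 & x j != 0]); last first.
  exists x; split=> // i j ij qij; have [|xi] := eqVneq (x i) 0; first by left.
  by have [|xj] := eqVneq (x j) 0; [right|case: no; exists i, j].
wlog dij : i j ij qij xi xj / deg x i <= deg x j.
  move=> W; case: (leP (deg x i) (deg x j)) => [|/ltW]; first exact: W ij qij xi xj.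
  by apply: (W j i); rewrite // 1?eq_sym // q_sym.
pose y k := x k + x j * swap_dir i j k.
have yi : y i = x i + x j by rewrite /y /swap_dir eqxx (negbTE ij) subr0 mulr1.
have yj : y j = 0 by rewrite /y /swap_dir eqxx eq_sym (negbTE ij) sub0r mulrN1 subrr.
have yk k : k != i -> k != j -> y k = x k.
  by move=> ki kj; rewrite /y /swap_dir (negbTE ki) (negbTE kj) subrr mulr0 addr0.
have y0 k : 0 <= y k.
  have [->|ki] := eqVneq k i; first by rewrite yi addr_ge0.
  by have [->|kj] := eqVneq k j; [rewrite yj|rewrite yk].
have yx k : x k = 0 -> y k = 0.
  have [->|ki] := eqVneq k i; first by move/eqP; rewrite (negbTE xi).
  by have [->|kj] := eqVneq k j; [rewrite yj|rewrite yk].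
have sy : (#|[set i | (y i != 0)%R]| < n)%N.
  apply: leq_trans sx; apply: proper_card; apply/properP; split.
    by apply/subsetP => k; rewrite !inE; apply: contra_neq => /yx.
  by exists j; rewrite !inE ?yj ?eqxx.
have [z [z0 zs zf zx zij]] := IH y sy y0; exists z; split=> //.
- rewrite zs big_split /= -mulr_sumr.
  by rewrite sum_swap0 mulr0 addr0.
- apply: (le_trans zf); rewrite /y form_perturb form_swap form_swap2 qij mulr1 subrr mulr0 addr0.
  by have := x0 j; nra.
- by move=> k /yx/zx.
Qed.

(** Homogeneous way of saying that the form is at least 1/e on the simplex over [K]. For 0/1 weights
    with 1 on non-edges, the best [e] is the clique number, by Motzkin and Straus. *)
Definition eff (K : {set T}) (e : R) := forall x, (forall i, 0 <= x i) ->
  (forall i, i \notin K -> x i = 0) -> (\sum_i x i) ^+ 2 <= e * form x x.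

Lemma eff_reduce (K : {set T}) (e : R) : 0 <= e ->
  (forall K' : {set T}, K' \subset K -> {in K' &, forall i j, i != j -> q i j != 1} -> eff K' e) ->
  eff K e.
Proof.
move=> e0 H x x0 xK; have [y [y0 ys yf yx yq]] := reduce_support x0.
rewrite -ys; apply: (le_trans _ (ler_wpM2l e0 yf)).
apply: (H [set i | y i != 0]) => //.
- apply/subsetP => i; rewrite inE; apply: contraNT => /xK/yx->; exact: eqxx.
- move=> i j; rewrite !inE => yi yj ij; apply/eqP => /(yq _ _ ij)[]/eqP.
    by rewrite (negbTE yi).
  by rewrite (negbTE yj).
- by move=> i; rewrite inE negbK => /eqP.
Qed.

Lemma cauchy_card (K : {set T}) x : (forall i, i \notin K -> x i = 0) ->
  (\sum_i x i) ^+ 2 <= #|K|%:R * \sum_i x i ^+ 2.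
Proof.
move=> xK; have restrict (f : T -> R) : (forall i, i \notin K -> f i = 0) -> \sum_i f i = \sum_(i in K) f i.
  by move=> fK; rewrite [RHS]big_mkcond; apply: eq_bigr => i _; case: ifPn => // /fK.
rewrite (restrict x) // (restrict (fun i => x i ^+ 2)); last by move=> i /xK->; rewrite expr0n.
have : 0 <= \sum_(i in K) \sum_(j in K) (x i - x j) ^+ 2.
  by do 2 (apply: sumr_ge0 => ? _); exact: sqr_ge0.
set s1 := \sum_(i in K) x i; set s2 := \sum_(i in K) x i ^+ 2.
have -> : \sum_(i in K) \sum_(j in K) (x i - x j) ^+ 2 = 2 * (#|K|%:R * s2 - s1 ^+ 2).
  transitivity (\sum_(i in K) (#|K|%:R * x i ^+ 2 + s2 - 2 * (x i * s1))).
    apply: eq_bigr => i _.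
    rewrite (eq_bigr (fun j => x i ^+ 2 + x j ^+ 2 - 2 * (x i * x j))); last by move=> j _; ring.
    by rewrite sumrB big_split /= sumr_const -!mulr_sumr -[_ *+ #|K|]mulr_natl.
  by rewrite sumrB big_split /= sumr_const -!mulr_sumr -mulr_suml -[s2 *+ _]mulr_natl -/s1 -/s2; ring.
by rewrite pmulr_rge0 // subr_ge0.
Qed.

Lemma eff_card (K : {set T}) : eff K #|K|%:R.
Proof.
move=> x x0 xK; apply: (le_trans (cauchy_card xK)).
by rewrite ler_wpM2l ?ler0n ?form_ge_sqr.
Qed.

Lemma eff_le (K : {set T}) e e' : e <= e' -> eff K e -> eff K e'.
Proof.
by move=> ee eK x x0 xK; apply: (le_trans (eK x x0 xK)); rewrite ler_wpM2r ?form_ge0.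
Qed.

(** The cross terms are nonnegative, and the rest is Cauchy's inequality in a division-free form, 2
    a b <= e1 fb + e2 fa, so that [e1] or [e2] may vanish. *)
Lemma eff_union (A B : {set T}) e1 e2 : [disjoint A & B] -> 0 <= e1 -> 0 <= e2 ->
  eff A e1 -> eff B e2 -> eff (A :|: B) (e1 + e2).
Proof.
move=> dAB e10 e20 eA eB x x0 xAB.
pose xA i := if i \in A then x i else 0; pose xB i := if i \in A then 0 else x i.
have xAB' i : x i = xA i + xB i by rewrite /xA /xB; case: ifP; rewrite ?addr0 ?add0r.
have xA0 i : 0 <= xA i by rewrite /xA; case: ifP.
have xB0 i : 0 <= xB i by rewrite /xB; case: ifP.
have hA := eA xA xA0; have hB := eB xB xB0.
have {}hA : (\sum_i xA i) ^+ 2 <= e1 * form xA xA by apply: hA => i; rewrite /xA => /negbTE->.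
have {}hB : (\sum_i xB i) ^+ 2 <= e2 * form xB xB.
  apply: hB => i iB; rewrite /xB; case: ifPn => // iA; apply: xAB.
  by rewrite in_setU negb_or iA.
have fAB : form xA xA + form xB xB <= form x x.
  rewrite -big_split; apply: ler_sum => i _; rewrite -big_split; apply: ler_sum => j _ /=.
  rewrite !xAB'; have := mulr_ge0 (mulr_ge0 (q_ge0 i j) (xA0 i)) (xB0 j).
  have := mulr_ge0 (mulr_ge0 (q_ge0 i j) (xB0 i)) (xA0 j); lra.
rewrite (eq_bigr _ (fun i _ => xAB' i)) big_split /=.
have fA0 := form_ge0 xA0; have fB0 := form_ge0 xB0.
have sA0 : 0 <= \sum_i xA i by apply: sumr_ge0.
have sB0 : 0 <= \sum_i xB i by apply: sumr_ge0.
apply: (@le_trans _ _ ((e1 + e2) * (form xA xA + form xB xB))); last by rewrite ler_wpM2l ?addr_ge0.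
move: (\sum_i xA i) (\sum_i xB i) (form xA xA) (form xB xB) hA hB fA0 fB0 sA0 sB0 => a b fa fb *.
suff : 2 * a * b <= e1 * fb + e2 * fa by nra.
have h : (2 * a * b) ^+ 2 <= (e1 * fb + e2 * fa) ^+ 2.
  have : a ^+ 2 * b ^+ 2 <= (e1 * fa) * (e2 * fb) by rewrite ler_pM ?sqr_ge0.
  have : 0 <= (e1 * fb - e2 * fa) ^+ 2 by exact: sqr_ge0.
  nra.
by rewrite -ler_sqr ?nnegrE ?addr_ge0 ?mulr_ge0.
Qed.
End Form.

(** * Minimisers on the simplex and first-order conditions *)

Section Minimizer.
Variables (R : realType) (T : finType) (q : T -> T -> R).
Hypotheses (q_sym : forall i j, q i j = q j i) (q_diag : forall i, q i i = 1).
Hypotheses (q_ge0 : forall i j, 0 <= q i j).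

Let vec (v : 'rV[R]_#|T|) (i : T) := v ord0 (enum_rank i).

Lemma vec_continuous i : continuous (fun v => vec v i).
Proof. exact: coord_continuous. Qed.

Lemma continuous_bigsum (V : topologicalType) (r : seq T) (F : T -> V -> R) :
  (forall i, continuous (F i)) -> continuous (fun v => \sum_(i <- r) F i v).
Proof. by move=> cF; apply: continuous_big => // x; exact: add_continuous. Qed.

Lemma simplex_minimizer (K : {set T}) : K != set0 -> exists x : T -> R,
  [/\ forall i, 0 <= x i, forall i, i \notin K -> x i = 0, \sum_i x i = 1 &
   forall y : T -> R, (forall i, 0 <= y i) -> (forall i, i \notin K -> y i = 0) ->
     \sum_i y i = 1 -> form q x x <= form q y y].
Proof.
move=> /set0Pn[k kK].
pose box := [set v : 'rV[R]_#|T| | forall i, `[0, (enum_val i \in K)%:R]%classic (v ord0 i)]%classic.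
pose simplex := (box `&` ((fun v => \sum_i vec v i) @^-1` [set 1]))%classic.
have boxP v : box v <-> forall i, 0 <= vec v i <= (i \in K)%:R.
  split=> [b i|b i]; first by have := b (enum_rank i); rewrite /= enum_rankK in_itv.
  by have := b (enum_val i); rewrite /vec enum_valK /= in_itv.
have vecK (y : T -> R) i : vec (\row_j y (enum_val j)) i = y i by rewrite /vec mxE enum_rankK.
have simplexP (y : T -> R) : (forall i, 0 <= y i) -> (forall i, i \notin K -> y i = 0) ->
    \sum_i y i = 1 -> simplex (\row_j y (enum_val j)).
  move=> y0 yK y1; split; last by rewrite /= (eq_bigr y).
  apply/boxP => i; rewrite vecK y0 /=; case: (boolP (i \in K)) => [_|/yK->//].
  by rewrite -y1 (bigD1 i) //= lerDl sumr_ge0.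
have csimplex : compact simplex.
  apply: compact_closedI.
    have := @rV_compact R #|T| (fun i => `[0, (enum_val i \in K)%:R]%classic).
    by apply => i; apply: segment_compact.
  apply: preimage_closed; last exact: closed_eq.
  by move=> v _; apply: continuous_bigsum => i; exact: vec_continuous.
have ne : (simplex !=set0)%classic.
  exists (\row_j (enum_val j == k)%:R); apply: (simplexP (fun i => (i == k)%:R)).
  - by move=> i; rewrite ler0n.
  - by move=> i; case: eqP => // ->; rewrite kK.
  - by rewrite (bigD1 k) //= eqxx big1 ?addr0 // => i /negbTE->.
have cf : {within simplex, continuous (fun v => form q (vec v) (vec v))}%classic.
  apply: continuous_subspaceT; apply: continuous_bigsum => i; apply: continuous_bigsum => j v.
  apply: (@continuousM _ _ (fun v => q i j * vec v i) (fun v => vec v j)); last exact: vec_continuous.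
  by apply: (@continuousM _ _ (fun=> q i j) (fun v => vec v i)); [exact: cst_continuous|exact: vec_continuous].
have [v] := EVT_min_rV ne csimplex cf.
rewrite in_setE => -[/boxP b s1] vmin; exists (vec v); split=> //.
- by move=> i; have /andP[] := b i.
- by move=> i /negbTE iK; have := b i; rewrite iK -eq_le => /eqP.
- move=> y y0 yK y1; have := vmin (\row_j y (enum_val j)); rewrite in_setE.
  move=> /(_ (simplexP y y0 yK y1)).
  by rewrite (_ : vec (\row_j y (enum_val j)) = y) //; apply/funext => i; rewrite vecK.
Qed.

(** It suffices to bound the form at a minimiser, where all degrees on the support equal the value
    of the form; scaling then covers every vector. *)
Lemma eff_kkt (K : {set T}) (e : R) : 0 <= e ->
  (forall (K' : {set T}) (x : T -> R), K' \subset K -> (forall i, i \in K' -> 0 < x i) ->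
     (forall i, i \notin K' -> x i = 0) -> \sum_i x i = 1 ->
     (forall i, i \in K' -> deg q x i = form q x x) -> 1 <= e * form q x x) ->
  eff q K e.
Proof.
move=> e0 H y y0 yK; have [s0|sn0] := eqVneq (\sum_i y i) 0.
  by rewrite s0 expr0n mulr_ge0 ?form_ge0.
have K0 : K != set0.
  apply: contra_neq sn0 => K0; rewrite big1 // => i _; apply: yK.
  by rewrite K0 inE.
have [x [x0 xK x1 xmin]] := simplex_minimizer K0.
have ygt0 : 0 < \sum_i y i by rewrite lt_neqAle eq_sym sn0 sumr_ge0.
suff h : 1 <= e * form q x x.
  pose s := (\sum_i y i)^-1.
  have := xmin (fun i => s * y i) (fun i => mulr_ge0 (ltW _) (y0 i)).
  rewrite invr_gt0 => /(_ ygt0) xmin'.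
  have {xmin'} : form q x x <= s ^+ 2 * form q y y.
    have -> : s ^+ 2 * form q y y = form q (fun i => s * y i) (fun i => s * y i).
      rewrite mulr_sumr; apply: eq_bigr => i _; rewrite mulr_sumr; apply: eq_bigr => j _; ring.
    by apply: xmin' => [i /yK->|]; rewrite ?mulr0 // -mulr_sumr mulVf.
  move/(ler_wpM2l e0)/(le_trans h)/(ler_wpM2r (sqr_ge0 (\sum_i y i))); rewrite mul1r.
  have -> : e * (s ^+ 2 * form q y y) * (\sum_i y i) ^+ 2 = e * form q y y * (s * \sum_i y i) ^+ 2 by ring.
  by rewrite mulVf // expr1n mulr1.
have kkt i j : i \in K -> 0 < x j -> deg q x j <= deg q x i.
  move=> iK xj; have [->//|ij] := eqVneq i j.
  have jK : j \in K by apply: contraTT xj => /xK->; rewrite ltxx.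
  have step t : 0 <= t <= x j -> 0 <= 2 * t * (deg q x i - deg q x j) + t ^+ 2 * (2 - 2 * q i j).
    move=> /andP[t0 tj]; have := xmin (fun k => x k + t * swap_dir R i j k).
    rewrite form_perturb // form_swap form_swap2 // -addrA lerDl; apply.
    - move=> k; rewrite /swap_dir; have [->|ki] := eqVneq k i.
        by rewrite (negbTE ij) subr0 mulr1 addr_ge0.
      have [->|kj] := eqVneq k j; last by rewrite subrr mulr0 addr0.
      by rewrite /= sub0r mulrN1 subr_ge0.
    - move=> k kK; rewrite xK // /swap_dir; have [E|_] := eqVneq k i; first by rewrite -E (negbTE kK) in iK.
      have [E|_] := eqVneq k j; first by rewrite -E (negbTE kK) in jK.
      by rewrite subrr mulr0 addr0.
    - by rewrite big_split /= -mulr_sumr sum_swap0 mulr0 addr0.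
  rewrite leNgt; apply/negP => lt; set D := deg q x j - deg q x i.
  have D0 : 0 < D by rewrite subr_gt0.
  (* The first bound keeps the weight of [j] nonnegative. The second keeps the quadratic term, at
     most 2 t^2 <= t D, below the linear loss 2 t D. *)
  pose t := Num.min (x j) (D / 2).
  have t0 : 0 < t by rewrite lt_min xj divr_gt0.
  have tD : t <= D / 2 by rewrite ge_min lexx orbT.
  have := step t; rewrite (ltW t0) ge_min lexx => /(_ isT).
  have -> : deg q x i - deg q x j = - D by rewrite opprB.
  by have := q_ge0 i j; nra.
apply: (H [set i | 0 < x i] x) => //.
- by apply/subsetP => i; rewrite inE => xi; apply: contraTT xi => /xK->; rewrite ltxx.
- by move=> i; rewrite inE.
- by move=> i; rewrite inE lt_neqAle x0 andbT negbK => /eqP.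
move=> i; rewrite inE => xi.
have eqdeg j : 0 < x j -> deg q x j = deg q x i.
  move=> xj; have K' k : 0 < x k -> k \in K by move=> xk; apply: contraTT xk => /xK->; rewrite ltxx.
  by apply/eqP; rewrite eq_le !kkt ?K'.
rewrite formE (eq_bigr (fun j => x j * deg q x i)); first by rewrite -mulr_suml x1 mul1r.
move=> j _; have [->|xj] := eqVneq (x j) 0; first by rewrite !mul0r.
by rewrite eqdeg // lt_neqAle eq_sym xj x0.
Qed.

(** Twice the form dominates the sum of squares plus the form [r] with weight 1 on the diagonal and
    on [h]. With s the total weight, the former is at least s^2 / n by Cauchy; the latter is at
    least s^2 / a, since its support may be taken free of [h]. This gives the harmonic mean of n and
    a. *)
Lemma eff_amhm (K : {set T}) (h : rel T) (n a : nat) : (0 < a)%N -> symmetric h ->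
  (#|K| <= n)%N -> {in K &, forall i j, i != j -> h i j -> 1 / 2 <= q i j} ->
  (forall K' : {set T}, K' \subset K -> {in K' &, forall i j, i != j -> ~~ h i j} -> (#|K'| <= a)%N) ->
  eff q K (2 * n%:R * a%:R / (n%:R + a%:R)).
Proof.
move=> a0 h_sym Kn hq Ha x x0 xK.
pose r i j : R := if i == j then 1 else (h i j)%:R.
have r_sym i j : r i j = r j i by rewrite /r eq_sym h_sym.
have r_ge0 i j : 0 <= r i j by rewrite /r; case: ifP => // _; rewrite ler0n.
have r_diag i : r i i = 1 by rewrite /r eqxx.
have effr : eff r K a%:R.
  apply: eff_reduce => // K' sK' K'h.
  apply: (@eff_le _ _ r r_ge0 _ #|K'|%:R); last exact: eff_card.
  rewrite ler_nat; apply: Ha => // i j iK jK ij.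
  by have := K'h i j iK jK ij; rewrite /r (negbTE ij); case: (h i j); rewrite ?eqxx.
have h1 := effr x x0 xK; have h2 := cauchy_card xK.
have h3 : (\sum_i x i ^+ 2) + form r x x <= 2 * form q x x.
  rewrite -big_split mulr_sumr; apply: ler_sum => i _ /=.
  rewrite [X in _ + X](bigD1 i) //= [X in 2 * X](bigD1 i) //= q_diag r_diag.
  set A := \sum_(j | j != i) r i j * _ * _; set B := \sum_(j | j != i) _; suff : A <= 2 * B by lra.
  rewrite mulr_sumr; apply: ler_sum => j ji; rewrite /r eq_sym (negbTE ji).
  have xx := mulr_ge0 (x0 i) (x0 j).
  have [iK|/xK->] := boolP (i \in K); last by rewrite !(mul0r, mulr0).
  have [jK|/xK->] := boolP (j \in K); last by rewrite !(mul0r, mulr0).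
  rewrite -!mulrA; case hij: (h i j); last by rewrite mul0r !mulr_ge0.
  have hq2 : 1 / 2 <= q i j by apply: hq; rewrite // eq_sym.
  by rewrite mulr1n mul1r mulrA ler_peMl //; lra.
have S2 : 0 <= \sum_i x i ^+ 2 by apply: sumr_ge0 => i _; exact: sqr_ge0.
have Kn' : #|K|%:R <= n%:R :> R by rewrite ler_nat.
have a0' : 0 < a%:R :> R by rewrite ltr0n.
have n0 : 0 <= n%:R :> R by rewrite ler0n.
have S3 : (\sum_i x i) ^+ 2 <= n%:R * \sum_i x i ^+ 2 by apply: (le_trans h2); rewrite ler_wpM2r.
rewrite mulrAC ler_pdivlMr ?ltr_wpDl //.
apply: (@le_trans _ _ (n%:R * a%:R * (\sum_i x i ^+ 2 + form r x x))).
  by move: h1 S3; nra.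
have -> : 2 * n%:R * a%:R * form q x x = n%:R * a%:R * (2 * form q x x) by ring.
by rewrite ler_wpM2l // mulr_ge0 // ltW.
Qed.
End Minimizer.

(** * The Lagrangian of a reduced graph *)

Section Weights.
Variables (R : realType) (T : finType) (g : reduced T).

(* The density missing from a pair; a pair that is neither red, full nor half counts as empty. *)
Definition pair_weight (i j : T) : R :=
  if i == j then 1 else if red g i j || ful g i j then 0 else if hal g i j then 1 / 2 else 1.

Lemma pair_weight_sym i j : pair_weight i j = pair_weight j i.
Proof. by rewrite /pair_weight eq_sym red_sym ful_sym hal_sym. Qed.
Lemma pair_weight_diag i : pair_weight i i = 1. Proof. by rewrite /pair_weight eqxx. Qed.
Lemma pair_weight_ge0 i j : 0 <= pair_weight i j.
Proof. by rewrite /pair_weight; do !case: ifP => // _; lra. Qed.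
Lemma pair_weight_hal i j : hal g i j -> pair_weight i j = 1 / 2.
Proof.
move=> h; rewrite /pair_weight h; have [E|_] := eqVneq i j; first by rewrite E hal_irr in h.
by case: ifP => // /orP[/red_hal|/ful_hal]; rewrite h.
Qed.
Lemma pair_weight_unit i j : red g i j || ful g i j -> pair_weight i j = 0.
Proof.
move=> u; rewrite /pair_weight u; case: eqP => // E; by rewrite E red_irr ful_irr in u.
Qed.

Let r3 := ramsey3 (red_sym g) (@red_triangle _ g).
Let r6 := ramsey6 (red_sym g) (@red_triangle _ g).

Lemma max_unit (K : {set T}) : exists I : {set T}, [/\ I \subset K, unit_clique g I &
  forall J : {set T}, J \subset K -> unit_clique g J -> (#|J| <= #|I|)%N].
Proof.
pose P (I : {set T}) := `[< I \subset K /\ unit_clique g I >].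
have P0 : P set0 by apply/asboolP; split; [exact: sub0set|move=> x y; rewrite inE].
case: (@arg_maxnP _ set0 P (fun I => #|I|) P0) => I /asboolP[IK uI] Imax.
by exists I; split=> // J JK uJ; apply: Imax; apply/asboolP.
Qed.

Lemma complete_nonhal (K : {set T}) : complete g K ->
  {in K &, forall i j, i != j -> ~~ hal g i j} -> unit_clique g K.
Proof.
move=> cK nh i j iK jK ij; have := cK i j iK jK ij.
by rewrite (negbTE (nh i j iK jK ij)) orbF.
Qed.

Lemma eff_complete (K : {set T}) (n a : nat) (e : R) : complete g K -> (0 < a)%N -> (#|K| <= n)%N ->
  2 * n%:R * a%:R <= e * (n%:R + a%:R) ->
  (forall J : {set T}, J \subset K -> unit_clique g J -> (#|J| <= a)%N) -> eff pair_weight K e.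
Proof.
move=> cK a0 Kn ne Ha; have na0 : 0 < n%:R + a%:R :> R by rewrite -natrD ltr0n addn_gt0 a0 orbT.
apply: (@eff_le _ _ pair_weight pair_weight_ge0 K (2 * n%:R * a%:R / (n%:R + a%:R))); first by rewrite ler_pdivrMr.
apply: (@eff_amhm _ _ _ pair_weight_diag pair_weight_ge0 K (hal g)) => //.
- exact: hal_sym.
- by move=> i j _ _ _ /pair_weight_hal->.
- move=> K' K'K nh; apply: Ha => //; apply: complete_nonhal nh; exact: complete_sub cK.
Qed.

Lemma doubled_card (K : {set T}) : complete g K -> doubled g K -> (#|K| <= 19)%N.
Proof.
move=> cK dK; rewrite leqNgt; apply/negP => n20.
have [S [SK S6 bS]] := ramsey_blue r6 cK n20.
have /card_gt0P[x xS] : (0 < #|S|)%N by rewrite S6.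
have := blue_unit_bound bS (_ : [set x] \subset S); rewrite sub1set => /(_ xS).
rewrite S6 cards1; case/(_ _ _)/negP => //.
  by move=> y /set1P->; apply: dK; exact: subsetP xS.
by move=> y z /set1P-> /set1P->; rewrite eqxx.
Qed.

Section Critical.
Variables (K : {set T}) (x : T -> R).
Hypotheses (cK : complete g K) (dK : doubled g K) (no8 : forall J : {set T}, J \subset K ->
  unit_clique g J -> (#|J| <= 7)%N).
Hypotheses (x0 : forall i, i \in K -> 0 < x i) (xK : forall i, i \notin K -> x i = 0).
Hypotheses (x1 : \sum_i x i = 1) (kkt : forall i, i \in K -> deg pair_weight x i = form pair_weight x x).
Let Q := form pair_weight x x.

Lemma x_ge0 i : 0 <= x i.
Proof. by have [/x0/ltW|/xK->] := boolP (i \in K). Qed.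

Lemma critical_eff e : e <= 159 / 20 -> eff pair_weight K e -> 1 <= 159 / 20 * Q.
Proof.
move=> e9 /(_ x x_ge0 xK); rewrite x1 expr1n => h; apply: (le_trans h).
by rewrite ler_wpM2r ?form_ge0 //; [exact: pair_weight_ge0|exact: x_ge0].
Qed.

Variable I : {set T}.
Hypotheses (IK : I \subset K) (uI : unit_clique g I).
Hypothesis Imax : forall J : {set T}, J \subset K -> unit_clique g J -> (#|J| <= #|I|)%N.

Let hnbr u := [set v in I | hal g v u].
Let D1 := [set b in K :\: I | #|hnbr b| == 1%N].

Lemma hnbr_gt0 u : u \in K :\: I -> (0 < #|hnbr u|)%N.
Proof.
rewrite inE => /andP[uI' uK]; rewrite lt0n cards_eq0; apply/negP => /eqP h0.
have : (#|u |: I| <= #|I|)%N.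
  apply: Imax; first by rewrite subUset sub1set uK.
  apply: complete_nonhal; first by apply: complete_sub cK; rewrite subUset sub1set uK.
  have nu v : v \in I -> ~~ hal g v u.
    by move=> vI; apply/negP => h; have := in_set0 v; rewrite -h0 inE vI h.
  move=> i j; rewrite !in_setU1 => /orP[/eqP->|iI] /orP[/eqP->|jI] ij.
  - by rewrite hal_irr.
  - by rewrite hal_sym nu.
  - exact: nu.
  - by apply/negP => /(unit_hal uI iI jI).
by rewrite cardsU1 uI' ltnn.
Qed.

Lemma D1_private b : b \in D1 -> exists v, private g K I v b.
Proof.
rewrite inE => /andP[bKI /cards1P[v h]].
have vP w : (w \in I) && hal g w b = (w == v) by have := in_set1 w v; rewrite -h inE.
have /andP[vI vb] : (v \in I) && hal g v b by rewrite vP.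
exists v; split=> // w wI wb; apply/eqP; by rewrite -vP wI.
Qed.

(** Exchanging [v] for both [b1] and [b2] would enlarge the largest unit clique [I]. *)
Lemma private_inj v b1 b2 : private g K I v b1 -> private g K I v b2 -> b1 != b2 ->
  ~~ hal g b1 b2 -> False.
Proof.
move=> [vI b1KI vb1 u1] [_ b2KI vb2 u2] b12 h12.
move: (b1KI) (b2KI); rewrite !inE => /andP[b1I b1K] /andP[b2I b2K].
have JK : [set b1; b2] :|: (I :\ v) \subset K.
  by rewrite !subUset !sub1set b1K b2K (subset_trans (subsetDl _ _) IK).
have : (#|[set b1; b2] :|: (I :\ v)| <= #|I|)%N.
  apply: Imax => //; apply: complete_nonhal (complete_sub JK cK) _.
  have nb b w : private g K I v b -> w \in I :\ v -> ~~ hal g w b.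
    move=> [_ _ _ u]; rewrite !inE => /andP[wv wI]; apply/negP => /(u w wI) E.
    by rewrite E eqxx in wv.
  have P b : b \in [set b1; b2] -> private g K I v b.
    by rewrite !inE => /orP[]/eqP->; split.
  move=> i j; rewrite in_setU => /orP[iB|iI]; rewrite in_setU => /orP[jB|jI] ij.
  - by move: iB jB ij; rewrite !inE => /orP[]/eqP-> /orP[]/eqP->; rewrite ?eqxx // hal_sym.
  - by rewrite hal_sym; apply: nb (P _ iB) jI.
  - by apply: nb (P _ jB) iI.
  - by move: iI jI; rewrite !inE => /andP[_ iI] /andP[_ jI]; apply/negP => /(unit_hal uI iI jI).
rewrite cardsU cards2 b12 (_ : _ :&: _ = set0) ?cards0 ?subn0; last first.
  apply/setP => i; rewrite !inE; apply/negP => /andP[/orP[]/eqP-> /andP[_]]; by apply/negP.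
by rewrite (cardsD1 v I) vI leq_add2r.
Qed.

(** The first-order conditions are summed over [I]. A vertex is counted with its total weight
    towards [I], which is at least 1 in [I] or with two half neighbours there; by maximality every
    other vertex has one half neighbour and counts at least 1/2. *)
Lemma weight_sum : 1 - (\sum_(u in D1) x u) / 2 <= #|I|%:R * Q.
Proof.
have -> : #|I|%:R * Q = \sum_u x u * \sum_(v in I) pair_weight v u.
  transitivity (\sum_(v in I) deg pair_weight x v).
    by rewrite mulr_natl -sumr_const; apply: eq_bigr => v vI; rewrite kkt // (subsetP IK).
  rewrite exchange_big /=; apply: eq_bigr => u _; rewrite mulr_sumr; apply: eq_bigr => v _.
  by rewrite mulrC.
have -> : 1 - (\sum_(u in D1) x u) / 2 = \sum_u x u - (\sum_(u in D1) x u) / 2 by rewrite x1.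
rewrite [X in _ - X / 2]big_mkcond mulr_suml -sumrB; apply: ler_sum => u _.
have [uK|/xK->] := boolP (u \in K); last by rewrite mul0r if_same mul0r subr0.
suff : 1 - (u \in D1)%:R / 2 <= \sum_(v in I) pair_weight v u.
  move/(ler_wpM2l (x_ge0 u)); apply: le_trans; case: ifP => _; rewrite ?mulr1n ?mulr0n; lra.
have [uI'|uI'] := boolP (u \in I).
  have -> : u \in D1 = false by rewrite !inE uI'.
  rewrite mul0r subr0 (bigD1 u) //= pair_weight_diag lerDl sumr_ge0 // => v _; exact: pair_weight_ge0.
have uKI : u \in K :\: I by rewrite inE uI'.
have h : #|hnbr u|%:R / 2 <= \sum_(v in I) pair_weight v u.
  rewrite mulr_natl -sumr_const big_mkcond [leRHS]big_mkcond; apply: ler_sum => v _.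
  rewrite inE; case: ifP => [/andP[-> /pair_weight_hal->]|_]; first by rewrite div1r.
  by case: ifP => // _; exact: pair_weight_ge0.
apply: le_trans h; rewrite inE uKI /=; have := hnbr_gt0 uKI.
case: (#|hnbr u|) => [//|[|m]] _ /=; first by lra.
by rewrite mul0r subr0 ler_pdivlMr // mul1r ler_nat.
Qed.

(** Restricting to [D1] can only lower degrees, so the restricted form is at most s [Q]; comparison
    with s^2 <= e times this form cancels one factor s, the weight of [D1]. *)
Lemma D1_weight (n b : nat) (e : R) : (0 < b)%N -> (#|D1| <= n)%N -> 0 <= e ->
  2 * n%:R * b%:R <= e * (n%:R + b%:R) ->
  (forall J : {set T}, J \subset D1 -> unit_clique g J -> (#|J| <= b)%N) ->
  \sum_(u in D1) x u <= e * Q.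
Proof.
move=> b0 Dn e0 ne Hb; pose y u := if u \in D1 then x u else 0.
have D1K : D1 \subset K by apply/subsetP => u; rewrite !inE => /andP[/andP[]].
have y0 u : 0 <= y u by rewrite /y; case: ifP => // _; exact: x_ge0.
have yD u : u \notin D1 -> y u = 0 by rewrite /y => /negbTE->.
have := eff_complete (complete_sub D1K cK) b0 Dn ne Hb y0 yD.
have <- : \sum_(u in D1) x u = \sum_u y u by rewrite big_mkcond.
set s := \sum_(u in D1) x u => h.
have s0 : 0 <= s by apply: sumr_ge0 => u _; exact: x_ge0.
have fy : form pair_weight y y <= s * Q.
  rewrite formE /s [X in _ <= X * _]big_mkcond mulr_suml; apply: ler_sum => u _.
  rewrite /y; case: ifP => uD; last by rewrite !mul0r.
  rewrite ler_wpM2l ?x_ge0 // /Q -(kkt (subsetP D1K _ uD)) /deg; apply: ler_sum => v _.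
  by rewrite ler_wpM2l ?pair_weight_ge0 //; case: ifP => // _; exact: x_ge0.
have [->|sn0] := eqVneq s 0; first by rewrite mulr_ge0 ?form_ge0 //; [exact: pair_weight_ge0|exact: x_ge0].
have sp : 0 < s by rewrite lt_neqAle eq_sym sn0.
rewrite -(ler_pM2l sp) -expr2; apply: (le_trans h); by rewrite mulrCA ler_wpM2l.
Qed.

Lemma card_outside : #|K :\: I| = (#|K| - #|I|)%N.
Proof. by rewrite cardsD (setIidPr IK). Qed.

Lemma exists_extra (B : {set T}) : (#|B| < #|K :\: I|)%N -> exists2 y, y \in K :\: I & y \notin B.
Proof.
move=> BK; apply/subsetPn; apply/negP => /subset_leq_card; by rewrite leqNgt BK.
Qed.

(** Members of a unit clique in [D1] have distinct partners by [private_inj], and ten vertices in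
    [K] leave one more vertex outside [I]. This is the situation excluded by [seven_no_extra] and
    [six_no_extra]. *)
Lemma D1_unit_bound (J : {set T}) : (10 <= #|K|)%N -> (6 <= #|I|)%N -> J \subset D1 ->
  unit_clique g J -> (#|J| <= 8 - #|I|)%N.
Proof.
move=> K10 I6 /subsetP JD uJ; have I7 := no8 IK uI.
have nh : {in J &, forall b b', ~~ hal g b b'} by move=> b b' bJ b'J; apply/negP => /(unit_hal uJ bJ b'J).
have vinj b b' v v' : b \in J -> b' \in J -> b != b' -> private g K I v b -> private g K I v' b' -> v != v'.
  move=> bJ b'J bb' p p'; apply/eqP => E; rewrite -E in p'; exact: (private_inj p p' bb' (nh b b' bJ b'J)).
have [a7|a6] : #|I| = 7 \/ #|I| = 6 by lia.
- rewrite a7 leqNgt; apply/negP => /sub_card_eq[J' /subsetP J'J c2]; have /cards2P[b1 [b2 [b12 EJ]]] : #|J'| == 2 by rewrite c2.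
  have [b1J b2J] : b1 \in J /\ b2 \in J by split; apply: J'J; rewrite EJ !inE eqxx ?orbT.
  have [[v1 p1] [v2 p2]] := conj (D1_private (JD _ b1J)) (D1_private (JD _ b2J)).
  have [|x' x'KI] := @exists_extra [set b1; b2]; first by rewrite cards2 b12 card_outside a7; move: K10; clear; lia.
  rewrite !inE negb_or => /andP[xb1 xb2].
  exact: (seven_no_extra cK dK IK uI a7 p1 p2 (vinj _ _ _ _ b1J b2J b12 p1 p2) x'KI xb1 xb2).
- rewrite a6 leqNgt; apply/negP => /sub_card_eq[J' /subsetP J'J c3].
  have [b1 b1J'] : exists b1, b1 \in J' by apply/card_gt0P; rewrite c3.
  have : #|J' :\ b1| == 2 by rewrite -(eqn_add2l 1) -{1}[1%N]/(nat_of_bool true) -b1J' -cardsD1 c3.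
  move=> /cards2P[b2 [b3 [b23 EJ]]].
  have : (b2 \in J' :\ b1) && (b3 \in J' :\ b1) by rewrite EJ !inE !eqxx orbT.
  rewrite !inE => /andP[/andP[b21 b2J'] /andP[b31 b3J']].
  have [b1J b2J b3J] := And3 (J'J _ b1J') (J'J _ b2J') (J'J _ b3J').
  rewrite eq_sym in b21; rewrite eq_sym in b31.
  have [[v1 p1] [v2 p2] [v3 p3]] := And3 (D1_private (JD _ b1J)) (D1_private (JD _ b2J)) (D1_private (JD _ b3J)).
  have [|x' x'KI] := @exists_extra [set b1; b2; b3]; first by rewrite cards3 // card_outside a6; move: K10; clear; lia.
  rewrite !inE !negb_or -andbA => /and3P[xb1 xb2 xb3].
  apply: (six_no_extra cK dK IK uI a6 p1 p2 p3 _ _ _ b21 b31 b23 _ _ _ x'KI xb1 xb2 xb3);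
    by [apply: vinj p1 p2 | apply: vinj p1 p3 | apply: vinj p2 p3 | exact: nh].
Qed.

(** The four cases allow the constants 190/24, 126/16, 7 + 12/13 and 6 + 26/15. The largest is
    103/13, and 159/20 is a convenient number between it and 8. *)
Lemma critical_bound : 1 <= 159 / 20 * Q.
Proof.
have K19 := doubled_card cK dK; have I7 := no8 IK uI.
have amhm n a : (0 < a)%N -> (#|K| <= n)%N -> (#|I| <= a)%N ->
    2 * n%:R * a%:R <= 159 / 20 * (n%:R + a%:R) :> R -> 1 <= 159 / 20 * Q.
  move=> a0 Kn Ia ea; apply: (critical_eff (lexx _)); apply: eff_complete ea _ => // J JK uJ.
  exact: leq_trans (Imax JK uJ) Ia.
have [I5|I6] := leqP #|I| 5; first by apply: (amhm 19 5)%N => //; lra.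
have [K9|K10] := leqP #|K| 9; first by apply: (amhm 9 7)%N => //; lra.
have Q0 : 0 <= Q by apply: form_ge0; [exact: pair_weight_ge0|exact: x_ge0].
have D1n : (#|D1| <= #|K| - #|I|)%N.
  by rewrite -card_outside subset_leq_card //; apply/subsetP => u; rewrite inE => /andP[].
have ub J JD uJ := @D1_unit_bound J K10 I6 JD uJ; have ws := weight_sum.
have [a7|a6] : #|I| = 7 \/ #|I| = 6 by lia.
- rewrite a7 in D1n ub ws.
  have /(_ ub) D1w := @D1_weight 12 1 (24 / 13) isT (leq_trans D1n (leq_sub2r 7 K19)) ltac:(lra) ltac:(lra).
  by lra.
- rewrite a6 in D1n ub ws.
  have /(_ ub) D1w := @D1_weight 13 2 (52 / 15) isT (leq_trans D1n (leq_sub2r 6 K19)) ltac:(lra) ltac:(lra).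
  by lra.
Qed.
End Critical.

Lemma eff_doubled (K : {set T}) : complete g K -> doubled g K ->
  (forall J : {set T}, J \subset K -> unit_clique g J -> (#|J| <= 7)%N) -> eff pair_weight K (159 / 20).
Proof.
move=> cK dK no8; apply: eff_kkt; [exact: pair_weight_sym|exact: pair_weight_diag|exact: pair_weight_ge0|lra|].
move=> K' x K'K x0 xK x1 kkt; have [I [IK uI Imax]] := max_unit K'.
apply: (@critical_bound K' x) IK uI Imax => //.
- exact: complete_sub cK.
- exact: doubled_sub dK.
- by move=> J JK'; apply: no8; apply: subset_trans K'K.
Qed.
End Weights.

(** * Complete sets with non-doubled clusters, and the minimum 1/8 *)

Section Mixed.
Variables (R : realType) (T : finType) (g : reduced T).
Let wq := @pair_weight R T g.
Let r2 := ramseyS (red_sym g) (@red_triangle _ g) (ramsey1 (red g)).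
Let r3 := ramsey3 (red_sym g) (@red_triangle _ g).
Let r4 := ramsey4 (red_sym g) (@red_triangle _ g).
Let r5 := ramsey5 (red_sym g) (@red_triangle _ g).

Section Parts.
Variables (A M : {set T}).
Hypotheses (cAM : complete g (A :|: M)) (dis : [disjoint A & M]).
Hypotheses (nA : {in A, forall x, ~~ dbl g x}) (dM : doubled g M).

(** Red pairs occur only between doubled clusters, so the whole of [A] extends [S] to a blue
    clique. *)
Lemma mixed_bound (S D : {set T}) : S \subset M -> blue_clique g S -> D \subset S -> unit_clique g D ->
  (#|A| + #|S| + #|D| <= 6)%N.
Proof.
move=> SM bS DS uD; have AS : [disjoint A & S] by apply: disjointWr dis.
have bAS : blue_clique g (A :|: S).
  move=> x y xAS yAS xy.
  have sub z : z \in A :|: S -> z \in A :|: M.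
    by rewrite !in_setU => /orP[->//|/(subsetP SM)->]; rewrite orbT.
  have := cAM (sub x xAS) (sub y yAS) xy.
  move: xAS yAS; rewrite !in_setU => /orP[xA _|xS /orP[yA|yS]].
  - have -> : red g x y = false by apply/negbTE; apply: contra (nA xA); exact: red_dbl.
    by [].
  - have -> : red g x y = false by apply/negbTE; apply: contra (nA yA); rewrite red_sym; exact: red_dbl.
    by [].
  - by move=> _; apply: bS.
have := blue_unit_bound bAS (subset_trans DS (subsetUr _ _)) (doubled_sub (subset_trans DS SM) dM) uD.
by rewrite cardsU (disjoint_setI0 AS) cards0 subn0.
Qed.

Let cM : complete g M := complete_sub (subsetUr _ _) cAM.

Lemma mixed_blue (S : {set T}) : S \subset M -> blue_clique g S -> (0 < #|S|)%N -> (#|A| + #|S| <= 5)%N.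
Proof.
move=> SM bS /card_gt0P[x xS].
have := @mixed_bound S [set x] SM bS; rewrite sub1set cards1 => /(_ xS) h.
by rewrite -ltnS -addn1; apply: h => y z /set1P-> /set1P->; rewrite eqxx.
Qed.

Lemma mixed_card N m : ramsey (red g) N m -> (0 < m)%N -> (5 < #|A| + m)%N -> (#|M| < N)%N.
Proof.
move=> rN m0 Am; rewrite ltnNge; apply/negP => MN.
have [S [SM Sm bS]] := ramsey_blue rN cM MN.
by have := mixed_blue SM bS; rewrite Sm => /(_ m0); rewrite leqNgt Am.
Qed.

Lemma mixed_unit_card N m (J : {set T}) : ramsey (red g) N m -> (6 < #|A| + m + m)%N ->
  J \subset M -> unit_clique g J -> (#|J| < N)%N.
Proof.
move=> rN Am JM uJ; rewrite ltnNge; apply/negP => JN.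
have [S [SJ Sm bS]] := ramsey_blue rN (unit_clique_complete uJ) JN.
have := mixed_bound (subset_trans SJ JM) bS (subxx _) (unit_clique_sub SJ uJ).
by rewrite Sm leqNgt Am.
Qed.

Lemma mixed_hal (S : {set T}) : S \subset M -> blue_clique g S -> (4 < #|A| + #|S|)%N ->
  {in S &, forall x y, x != y -> hal g x y}.
Proof.
move=> SM bS AS x y xS yS xy; have /orP[f|//] := bS x y xS yS xy.
have sxy : [set x; y] \subset S by rewrite subUset !sub1set xS yS.
have uxy : unit_clique g [set x; y].
  by move=> u v; rewrite !inE => /orP[]/eqP-> /orP[]/eqP->; rewrite ?eqxx // ?[ful g y x]ful_sym f orbT.
by have := mixed_bound SM bS sxy uxy; rewrite cards2 xy addn2 !ltnS leqNgt AS.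
Qed.

Lemma unit_meet_hal (I S : {set T}) : unit_clique g I -> {in S &, forall x y, x != y -> hal g x y} ->
  (#|S :&: I| <= 1)%N.
Proof.
move=> uI hS; rewrite leqNgt; apply/negP => /card_gt1P[x [y [+ + xy]]].
rewrite !inE => /andP[xS xI] /andP[yS yI]; have h := hS x y xS yS xy; by have := unit_hal uI xI yI h.
Qed.

(** A unit clique of five with one more vertex contains a blue triple by r(3,3) = 6. Its pairs are
    all half, so it meets the clique at most once, and it has at most one vertex outside. *)
Lemma mixed_unit4 : #|A| = 2 -> (6 <= #|M|)%N -> forall J : {set T}, J \subset M -> unit_clique g J -> (#|J| <= 4)%N.
Proof.
move=> A2 M6 J' J'M uJ'; rewrite leqNgt; apply/negP => /sub_card_eq[J JJ' J5].
have JM := subset_trans JJ' J'M; have uJ := unit_clique_sub JJ' uJ'.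
have [u uM uJ0] : exists2 u, u \in M & u \notin J.
  by apply/subsetPn; apply/negP => /subset_leq_card; rewrite J5 leqNgt M6.
have cuJ : complete g (u |: J) by apply: complete_sub cM; rewrite subUset sub1set uM.
have [|S [Su S3 bS]] := ramsey_blue r3 cuJ; first by rewrite cardsU1 uJ0 J5.
have SM : S \subset M by apply: subset_trans Su _; rewrite subUset sub1set uM.
have hS := mixed_hal SM bS; rewrite A2 S3 in hS.
have := unit_meet_hal uJ (hS isT).
have : (#|S :\: J| <= 1)%N by rewrite -(cards1 u) subset_leq_card // subDset setUC.
by rewrite cardsD S3; case: #|_| => [|[|]].
Qed.

(** Let [J] be a unit clique of five. Any four vertices outside it make nine with [J], so three of
    the four are pairwise half. If one outside pair is not half, all outside vertices apart from
    that pair are pairwise half. Five such vertices exist, and with [A] they contradict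
    [mixed_blue]. *)
Lemma mixed_unit4' : #|A| = 1%N -> (12 <= #|M|)%N ->
  forall J : {set T}, J \subset M -> unit_clique g J -> (#|J| <= 4)%N.
Proof.
move=> A1 M12 J' J'M uJ'; rewrite leqNgt; apply/negP => /sub_card_eq[J JJ' J5].
have JM := subset_trans JJ' J'M; have uJ := unit_clique_sub JJ' uJ'.
pose U := M :\: J; have U7 : (7 <= #|U|)%N by rewrite cardsD (setIidPr JM) J5; move: M12; clear; lia.
have UM : U \subset M := subsetDl _ _.
have no5 (S : {set T}) : S \subset M -> (5 <= #|S|)%N -> {in S &, forall x y, x != y -> hal g x y} -> False.
  move=> SM S5 hS; have bS : blue_clique g S by move=> x y xS yS xy; rewrite hS ?orbT.
  have S0 : (0 < #|S|)%N by exact: leq_trans S5.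
  by have := mixed_blue SM bS S0; rewrite A1 add1n ltnNge S5.
have hal4 (X : {set T}) : X \subset U -> #|X| = 4 -> exists S : {set T}, [/\ S \subset X, (3 <= #|S|)%N &
    {in S &, forall x y, x != y -> hal g x y}].
  move=> XU X4; have XJM : J :|: X \subset M by rewrite subUset JM (subset_trans XU).
  have JX : J :&: X = set0.
    by apply/setP => x; rewrite !inE; apply/negP => /andP[xJ /(subsetP XU)]; rewrite inE xJ.
  have [|S [SJX S4 bS]] := ramsey_blue r4 (complete_sub XJM cM).
    by rewrite cardsU J5 X4 JX cards0.
  have hS := mixed_hal (subset_trans SJX XJM) bS; rewrite A1 S4 in hS.
  exists (S :\: J); split; first by rewrite subDset.
    by have := unit_meet_hal uJ (hS isT); rewrite cardsD S4; case: #|_| => [|[|]].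
  by move=> x y; rewrite !inE => /andP[_ xS] /andP[_ yS]; apply: (hS isT).
have [hU|] := pselect {in U &, forall x y, x != y -> hal g x y}.
  by apply: (no5 U) => //; apply: leq_trans U7.
apply; move=> u1 u2 u1U u2U u12; apply: contraT => nh; exfalso.
apply: (no5 (U :\: [set u1; u2])).
- exact: subset_trans (subsetDl _ _) UM.
- rewrite cardsD; have : (#|U :&: [set u1; u2]| <= 2)%N.
    by rewrite (leq_trans (subset_leq_card (subsetIr _ _))) // cards2; case: (u1 != u2).
  by move: U7; clear; lia.
move=> u3 u4; rewrite !inE !negb_or => /andP[/andP[u31 u32] u3U] /andP[/andP[u41 u42] u4U] u34.
pose X := [set u1; u2] :|: [set u3; u4].
have X4 : #|X| = 4.
  rewrite cardsU !cards2 u12 u34 (_ : _ :&: _ = set0) ?cards0 //.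
  apply/setP => x; rewrite !inE; apply/negP => /andP[/orP[]/eqP-> /orP[]/eqP E].
  - by rewrite E eqxx in u31.
  - by rewrite E eqxx in u41.
  - by rewrite E eqxx in u32.
  - by rewrite E eqxx in u42.
have XU : X \subset U by rewrite !subUset !sub1set u1U u2U !inE u3U u4U.
have [S [SX S3 hS]] := hal4 X XU X4.
have S12 : (#|S :&: [set u1; u2]| <= 1)%N.
  rewrite leqNgt; apply/negP => /card_gt1P[x [y [+ + xy]]]; rewrite !inE.
  move=> /andP[xS x12] /andP[yS y12]; have := hS x y xS yS xy.
  by move: x12 y12 xy => /orP[]/eqP-> /orP[]/eqP->; rewrite ?eqxx // ?[hal g u2 u1]hal_sym (negbTE nh).
have S34 : [set u3; u4] = S :&: [set u3; u4].
  apply/esym/eqP; rewrite eqEcard subsetIr cards2 u34 /=.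
  have SE : S = (S :&: [set u1; u2]) :|: (S :&: [set u3; u4]) by rewrite -setIUr; apply/esym/setIidPl.
  have := (leq_card_setU (S :&: [set u1; u2]) (S :&: [set u3; u4])).1.
  by rewrite -SE; move: S3 S12; clear; lia.
have : (u3 \in [set u3; u4]) && (u4 \in [set u3; u4]) by rewrite !inE !eqxx orbT.
by rewrite S34 !inE => /andP[/andP[u3S _] /andP[u4S _]]; apply: hS.
Qed.

(** The size of [A] limits both [M] and its unit cliques through the Ramsey numbers. The worst case
    is one vertex in [A], eleven in [M] and unit cliques of five: 1 + 55/8 < 159/20. *)
Lemma eff_mixed : A != set0 -> eff wq (A :|: M) (159 / 20).
Proof.
rewrite -card_gt0 => A1; have A6 : (#|A| <= 6)%N.
  have b0 : blue_clique g set0 by move=> x y; rewrite inE.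
  have u0 : unit_clique g set0 by move=> x y; rewrite inE.
  by have := mixed_bound (sub0set M) b0 (sub0set set0) u0; rewrite cards0 !addn0.
suff [e e0 [eM Ae]] : exists2 e : R, 0 <= e & eff wq M e /\ #|A|%:R + e <= 159 / 20.
  apply: (@eff_le _ _ wq (@pair_weight_ge0 _ _ g) _ (#|A|%:R + e)) => //.
  by apply: eff_union => //; [exact: pair_weight_ge0|apply: eff_card; [exact: pair_weight_diag|exact: pair_weight_ge0]].
have eM n e : (#|M| <= n)%N -> n%:R <= e -> eff wq M e.
  move=> Mn ne; apply: (@eff_le _ _ wq (@pair_weight_ge0 _ _ g) _ #|M|%:R).
    by apply: le_trans ne; rewrite ler_nat.
  by apply: eff_card; [exact: pair_weight_diag|exact: pair_weight_ge0].
have [A1'|A2] := leqP #|A| 1.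
  have {A1 A1'}A1 : #|A| = 1%N by apply/eqP; rewrite eqn_leq A1 A1'.
  exists (55 / 8); first by lra.
  split; last by rewrite A1; lra.
  have M13 : (#|M| <= 13)%N by rewrite -ltnS; apply: (mixed_card r5); rewrite ?A1.
  have [M11|M12] := leqP #|M| 11.
    apply: (@eff_complete _ _ _ M 11 5) => //; first by lra.
    by move=> J JM uJ; rewrite -ltnS; apply: (mixed_unit_card r3) uJ; rewrite ?A1.
  apply: (@eff_complete _ _ _ M 13 4) => //; first by lra.
  exact: mixed_unit4'.
have [A2'|A3] := leqP #|A| 2.
  have {A1 A2 A2'}A2 : #|A| = 2 by apply/eqP; rewrite eqn_leq A2 A2'.
  exists (11 / 2); first by lra.
  split; last by rewrite A2; lra.
  have M8 : (#|M| <= 8)%N by rewrite -ltnS; apply: (mixed_card r4); rewrite ?A2.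
  have [M5|M6] := leqP #|M| 5; first by apply: (eM 5)%N => //; lra.
  apply: (@eff_complete _ _ _ M 8 4) => //; first by lra.
  exact: mixed_unit4.
have [A3'|A4] := leqP #|A| 3.
  have {A1 A2 A3 A3'}A3 : #|A| = 3 by apply/eqP; rewrite eqn_leq A3 A3'.
  exists 3; first by lra.
  split; last by rewrite A3; lra.
  have M5 : (#|M| <= 5)%N by rewrite -ltnS; apply: (mixed_card r3); rewrite ?A3.
  apply: (@eff_complete _ _ _ M 5 2) => //; first by lra.
  by move=> J JM uJ; rewrite -ltnS; apply: (mixed_unit_card r2) uJ; rewrite ?A3.
have [A4'|A5] := leqP #|A| 4.
  have {A1 A2 A3 A4 A4'}A4 : #|A| = 4 by apply/eqP; rewrite eqn_leq A4 A4'.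
  exists 2; first by lra.
  split; last by rewrite A4; lra.
  have M2 : (#|M| <= 2)%N by rewrite -ltnS; apply: (mixed_card r2); rewrite ?A4.
  by apply: (eM 2)%N.
exists 0 => //; split; last first.
  have : (#|A|%:R <= 6 :> R) by rewrite (ler_nat R _ 6).
  by lra.
have M0 : (#|M| <= 0)%N.
  by rewrite -ltnS; apply: (mixed_card (ramsey1 _)); rewrite // addn1 ltnS.
by apply: (eM 0)%N.
Qed.
End Parts.

Lemma eff_complete_unit7 (K : {set T}) : complete g K ->
  (forall J : {set T}, J \subset K -> doubled g J -> unit_clique g J -> (#|J| <= 7)%N) ->
  eff wq K (159 / 20).
Proof.
move=> cK no8; pose A := [set x in K | ~~ dbl g x]; pose M := [set x in K | dbl g x].
have EK : A :|: M = K by apply/setP => x; rewrite !inE -andb_orr orNb andbT.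
have dM : doubled g M by move=> x; rewrite inE => /andP[].
have [A0|A0] := eqVneq A set0.
  have MK : M = K by rewrite -EK A0 set0U.
  rewrite MK in dM; apply: eff_doubled => // J JK uJ; apply: no8 => //; exact: doubled_sub dM.
rewrite -EK; apply: eff_mixed => //; first by rewrite EK.
- by rewrite -setI_eq0; apply/eqP/setP => x; rewrite !inE; case: (dbl g x); rewrite ?andbF.
- by move=> x; rewrite inE => /andP[].
Qed.

Lemma pair_weight_complete (K : {set T}) : {in K &, forall i j, i != j -> wq i j != 1} -> complete g K.
Proof.
move=> h i j iK jK ij; have := h i j iK jK ij; rewrite /wq /pair_weight (negbTE ij).
by case: (red g i j) => //; case: (ful g i j) => //=; case: (hal g i j) => //; rewrite eqxx.
Qed.

Lemma eff_unit7 (P : {set T}) :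
  (forall J : {set T}, J \subset P -> doubled g J -> unit_clique g J -> (#|J| <= 7)%N) ->
  eff wq P (159 / 20).
Proof.
move=> no8; apply: eff_reduce => [|||K KP /pair_weight_complete cK]; [exact: pair_weight_sym|exact: pair_weight_diag|by lra|].
apply: eff_complete_unit7 => // J JK; apply: no8; exact: subset_trans KP.
Qed.

(** A complete support containing eight doubled clusters of mutual weight 0 is that 8-set, since a
    ninth vertex contradicts [unit_star9]; any other complete support has the better constant
    159/20. *)
Lemma eff8 : eff wq setT 8.
Proof.
apply: eff_reduce => [|||K _ /pair_weight_complete cK]; [exact: pair_weight_sym|exact: pair_weight_diag|by lra|].
have [[J [JK dJ uJ J8]]|no8] := pselect (exists J : {set T}, [/\ J \subset K, doubled g J, unit_clique g J & #|J| = 8]).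
  suff -> : K = J.
    have -> : 8 = #|J|%:R :> R by rewrite J8.
    by apply: eff_card; [exact: pair_weight_diag|exact: pair_weight_ge0].
  apply/eqP; rewrite eq_sym eqEsubset JK; apply/subsetP => u uK; apply: contraT => uJ'; exfalso.
  have uJK : u |: J \subset K by rewrite subUset sub1set uK.
  have E : (u |: J) :\ u = J by rewrite setU1K.
  apply: (@unit_star9 _ g (u |: J) u); rewrite ?E //; first exact: complete_sub cK.
  by rewrite cardsU1 uJ' J8.
apply: (@eff_le _ _ wq (@pair_weight_ge0 _ _ g) _ (159 / 20)); first by lra.
apply: eff_complete_unit7 => // J JK dJ uJ; rewrite leqNgt; apply/negP => J8.
have := unit_clique_le8 dJ uJ; rewrite leq_eqVlt ltnNge J8 orbF => /eqP J8'.
by apply: no8; exists J.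
Qed.
End Mixed.

(** * Structure of nearly extremal reduced graphs *)

Lemma missing_sum_arith (F : realFieldType) (n xi eta k0 a b c : F) :
  0 <= eta -> 0 <= k0 -> 0 < xi -> xi <= 1 -> k0 + 2 * eta <= xi ^+ 2 ->
  a <= b - (1 - 2 * eta) * c -> b <= (1 / 8 + k0) * n ^+ 2 -> (1 - 32 * xi) * n ^+ 2 / 8 <= c ->
  a <= (k0 + eta / 4 + 4 * xi) * n ^+ 2.
Proof.
move=> e0 k00 x0 x1 ek h hb hc; have xx : xi ^+ 2 <= 1 by rewrite expr_le1 // ltW.
have eta1 : 0 <= 1 - 2 * eta by lra.
have hc' := ler_wpM2l eta1 hc.
have exn : 0 <= eta * xi * n ^+ 2 by rewrite mulr_ge0 ?sqr_ge0 // mulr_ge0 // ltW.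
by move: h hb hc' exn; clear; lra.
Qed.

Lemma bad_sum_arith (F : realFieldType) (n zeta xi eta k0 sL sD p2 : F) :
  0 < n -> 0 < zeta -> zeta <= 1 / 100 -> 0 < xi -> xi <= zeta / 500 -> 0 <= eta -> 0 <= k0 ->
  k0 + 2 * eta <= xi ^+ 2 -> sL <= (1 / 8 + zeta) * n * p2 -> p2 <= (1 / 8 + xi ^+ 2) * n ^+ 2 ->
  sD <= (k0 + eta / 4 + 4 * xi) * n ^+ 2 ->
  (1 + 2 * eta) * sL + 2 * (n * sD) + 2 * (n * sD) <=
  (1 / 64 + 2 * zeta + 2 * eta + 4 * k0) * n ^+ 3.
Proof.
move=> n0 z0 z1 xi0 zx e0 k00 ek hL hp hD.
have x1 : xi <= 1 / 1000 by lra.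
have n3 : 0 < n ^+ 3 by rewrite exprn_gt0.
have xx : xi ^+ 2 <= xi by rewrite expr2 ger_pMl //; lra.
have L : sL <= (1 / 8 + zeta) * (1 / 8 + xi) * n ^+ 3.
  apply: (le_trans hL).
  have -> : (1 / 8 + zeta) * (1 / 8 + xi) * n ^+ 3 = (1 / 8 + zeta) * n * ((1 / 8 + xi) * n ^+ 2) by ring.
  rewrite ler_wpM2l ?(le_trans hp) // ?ler_wpM2r ?sqr_ge0 ?lerD2l //.
  by rewrite mulr_ge0 ?(ltW n0) //; lra.
have Dn : n * sD <= (k0 + eta / 4 + 4 * xi) * n ^+ 3.
  have -> : (k0 + eta / 4 + 4 * xi) * n ^+ 3 = n * ((k0 + eta / 4 + 4 * xi) * n ^+ 2) by ring.
  by rewrite ler_wpM2l // ltW.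
have L' : (1 + 2 * eta) * sL <= (1 / 64 + zeta + eta) * n ^+ 3.
  apply: (@le_trans _ _ ((1 + 2 * eta) * ((1 / 8 + zeta) * (1 / 8 + xi) * n ^+ 3))).
    by rewrite ler_wpM2l //; lra.
  rewrite mulrA ler_wpM2r ?(ltW n3) //.
  have zz : zeta * xi <= zeta * (1 / 1000) by rewrite ler_wpM2l // ltW.
  have A : (1 / 8 + zeta) * (1 / 8 + xi) <= 1 / 64 + zeta / 2 by move: zz zx z0; clear; lra.
  have A2 : (1 / 8 + zeta) * (1 / 8 + xi) <= 1 / 16 by move: zz zx z0 z1; clear; lra.
  move: A A2; move: (_ * _) => u A A2; have : eta * u <= eta * (1 / 16) by rewrite ler_wpM2l.
  by move: A e0 z0; clear; lra.
have fin : (1 / 64 + zeta + eta) + 4 * (k0 + eta / 4 + 4 * xi) <= 1 / 64 + 2 * zeta + 2 * eta + 4 * k0.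
  by move: zx z0 e0; clear; lra.
have := ler_wpM2r (ltW n3) fin; move: Dn L'; move: (n * _) (n ^+ 3) ((1 + _) * _); clear => d e f; lra.
Qed.

Section Stability.
Variables (R : realType) (T : finType) (g : reduced T).
Let wq := @pair_weight R T g.
Let k : R := #|T|%:R.
Let pair_weight_ge0 : forall i j, 0 <= wq i j := @pair_weight_ge0 R T g.

Definition one_on (A : {set T}) (i : T) : R := (i \in A)%:R.

Lemma sum_one_on (A : {set T}) : \sum_i one_on A i = #|A|%:R.
Proof. by rewrite -natr_sum -sum1_card [in RHS]big_mkcond; congr _%:R; apply: eq_bigr => i _; case: (i \in A). Qed.

Lemma eff_one_on (A P : {set T}) e : A \subset P -> eff wq P e -> #|A|%:R ^+ 2 <= e * form wq (one_on A) (one_on A).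
Proof.
move=> AP eP; rewrite -sum_one_on; apply: eP => [i|i iP]; first exact: ler0n.
by rewrite /one_on; case: (boolP (i \in A)) => // /(subsetP AP); rewrite (negbTE iP).
Qed.

Lemma form_one_on_le (A B : {set T}) : A \subset B ->
  form wq (one_on A) (one_on A) <= form wq (one_on B) (one_on B).
Proof.
move=> /subsetP AB; apply: ler_sum => i _; apply: ler_sum => j _.
have h C : 0 <= one_on C i /\ 0 <= one_on C j by rewrite !ler0n.
rewrite -!mulrA ler_wpM2l ?pair_weight_ge0 // ler_pM ?(h A).1 ?(h A).2 // /one_on ler_nat.
  by case: (boolP (i \in A)) => // /AB->.
by case: (boolP (j \in A)) => // /AB->.
Qed.

Lemma formT : form wq (one_on setT) (one_on setT) = \sum_i \sum_j wq i j.
Proof. by apply: eq_bigr => i _; apply: eq_bigr => j _; rewrite /one_on !inE !mulr1. Qed.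

Lemma total_ge : k ^+ 2 / 8 <= \sum_i \sum_j wq i j.
Proof.
have := eff_one_on (subxx setT) (@eff8 R T g); rewrite cardsT formT -/k => h.
by rewrite ler_pdivrMr // mulrC.
Qed.

(* Lowering the weights of the vertices of [B] by [s] cannot push the form below 1/8. *)
Lemma few_large_degrees (xi : R) (B : {set T}) : 0 < xi -> 0 < k ->
  \sum_i \sum_j wq i j <= (1 / 8 + xi ^+ 2) * k ^+ 2 ->
  {in B, forall i, (1 / 8 + xi) * k < \sum_j wq i j} -> #|B|%:R <= xi * k.
Proof.
move=> xi0 k0 tot hB; rewrite leNgt; apply/negP => hlt.
have b0 : 0 < #|B|%:R :> R by apply: lt_trans hlt; rewrite mulr_gt0.
pose s : R := xi * k / #|B|%:R.
have sb : s * #|B|%:R = xi * k by rewrite /s mulfVK // gt_eqF.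
have s0 : 0 < s by rewrite divr_gt0 // mulr_gt0.
have s1 : s <= 1 by rewrite ler_pdivrMr // mul1r ltW.
have Bk : #|B|%:R <= k by rewrite ler_nat max_card.
pose x i := one_on setT i + (- s) * one_on B i.
have x0 i : 0 <= x i by rewrite /x /one_on inE; case: (i \in B) => /=; rewrite ?mulr1n ?mulr0n ?mulr1 ?mulr0; lra.
have xT i : i \notin [set: T] -> x i = 0 by rewrite inE.
have := @eff8 R T g x x0 xT.
rewrite big_split /= -mulr_sumr !sum_one_on cardsT -/k mulNr sb.
rewrite form_perturb; last by move=> i j; exact: pair_weight_sym.
rewrite -/wq formT.
have degB : \sum_(i in B) \sum_j wq i j = form wq (one_on B) (one_on setT).
  rewrite formE big_mkcond; apply: eq_bigr => i _; rewrite /one_on /deg.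
  case: (i \in B); rewrite ?mul0r // mul1r; apply: eq_bigr => j _; by rewrite inE mulr1.
have : #|B|%:R * ((1 / 8 + xi) * k) <= form wq (one_on B) (one_on setT).
  by rewrite -degB mulr_natl -sumr_const; apply: ler_sum => i /hB/ltW.
have : form wq (one_on B) (one_on B) <= #|B|%:R ^+ 2.
  rewrite -sum_one_on expr2 big_distrlr /=; apply: ler_sum => i _; apply: ler_sum => j _.
  rewrite -mulrA ler_piMl ?mulr_ge0 ?ler0n //.
  rewrite /wq /pair_weight; do !case: ifP => // _; lra.
move: (form wq (one_on B) (one_on setT)) (form wq (one_on B) (one_on B)) => F1 F2 hF2 hF1.
move: tot; set W := \sum_i _ => tot.
have h1 : s * (#|B|%:R * ((1 / 8 + xi) * k)) <= s * F1 by rewrite ler_wpM2l // ltW.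
have h2 : s ^+ 2 * F2 <= s ^+ 2 * #|B|%:R ^+ 2 by rewrite ler_wpM2l ?sqr_ge0.
rewrite [s * (_ * _)]mulrA sb in h1; rewrite -exprMn sb in h2.
rewrite sqrrN; have kk : 0 < xi ^+ 2 * k ^+ 2 by rewrite mulr_gt0 // exprn_gt0.
nra.
Qed.

(** Vertices of large degree are few and are discarded first. If the others contained no such 8-set,
    the constant 159/20 would hold for them, but 159/20 * (1/8 + 1/2000) < 998/1000. *)
Lemma exists_unit8 (xi : R) : 0 < xi -> xi <= 1 / 1000 -> 0 < k ->
  \sum_i \sum_j wq i j <= (1 / 8 + xi ^+ 2) * k ^+ 2 ->
  exists K : {set T}, [/\ doubled g K, unit_clique g K, #|K| = 8 &
    {in K, forall v, \sum_j wq v j <= (1 / 8 + xi) * k}].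
Proof.
move=> xi0 xi1 k0 tot; pose B := [set i | (1 / 8 + xi) * k < \sum_j wq i j].
have hB : #|B|%:R <= xi * k by apply: few_large_degrees => // i; rewrite inE.
have [no8|] := pselect (forall J : {set T}, J \subset ~: B -> doubled g J -> unit_clique g J -> (#|J| <= 7)%N).
  have := eff_one_on (subxx (~: B)) (@eff_unit7 R T g _ no8).
  have BC : #|~: B|%:R = k - #|B|%:R :> R by rewrite /k -(cardsC B) natrD addrAC subrr add0r.
  have := form_one_on_le (subsetT (~: B)); rewrite formT BC.
  move: tot hB; move: (\sum_i _) (form _ _ _) (#|B|%:R : R) => W F b tot hB FW.
  have : ((1 - xi) * k) ^+ 2 <= (k - b) ^+ 2 by rewrite ler_sqr ?nnegrE ?mulr_ge0 //; nra.
  have : 998 / 1000 * k ^+ 2 <= ((1 - xi) * k) ^+ 2 by rewrite exprMn ler_wpM2r ?sqr_ge0 //; nra.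
  have kk : 0 < k ^+ 2 by rewrite exprn_gt0.
  have x2 : xi ^+ 2 <= 1 / 2000.
    have : xi * xi <= 1 / 1000 * xi by rewrite ler_wpM2r // ltW.
    by rewrite -expr2; lra.
  have : (1 / 8 + xi ^+ 2) * k ^+ 2 <= (1 / 8 + 1 / 2000) * k ^+ 2 by rewrite ler_wpM2r ?(ltW kk) //; lra.
  lra.
move=> /existsNP[J /not_implyP[JB /not_implyP[dJ /not_implyP[uJ /negP]]]]; rewrite -ltnNge => J8.
exists J; split=> //; first by apply/eqP; rewrite eqn_leq J8 (unit_clique_le8 dJ uJ).
by move=> v /(subsetP JB); rewrite !inE -leNgt.
Qed.

Section Classes.
Variables (K : {set T}) (xi : R).
Hypotheses (dK : doubled g K) (uK : unit_clique g K) (K8 : #|K| = 8).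
Hypothesis (degK : {in K, forall v, \sum_j wq v j <= (1 / 8 + xi) * k}).

Let s u := \sum_(v in K) wq v u.
(** Weights are 0 or at least 1/2, so a weight 1 at [v] and a sum below 3/2 leave weight 0 to the
    other vertices of [K]. *)
Let P v := [set u | (s u < 3 / 2) && (wq v u == 1)].

Lemma pair_weight_values i j : wq i j = 0 \/ 1 / 2 <= wq i j <= 1.
Proof. by rewrite /wq /pair_weight; do !case: ifP => _; (try by left); right; apply/andP; split; lra. Qed.

(** Otherwise [u] and [K] would form a complete set of nine, which [unit_star9] excludes. *)
Lemma some_wq1 u : exists2 v, v \in K & wq v u = 1.
Proof.
have [/exists_inP[v vK /eqP v1]|/exists_inPn no] := boolP [exists v in K, wq v u == 1]; first by exists v.
have uK' : u \notin K by apply/negP => /no; rewrite /wq pair_weight_diag eqxx.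
have cu : complete g (u |: K).
  apply: (@pair_weight_complete R) => i j; rewrite !in_setU1 => /orP[/eqP->|iK] /orP[/eqP->|jK] ij.
  - by rewrite eqxx in ij.
  - by rewrite pair_weight_sym; apply: no.
  - exact: no.
  - by rewrite pair_weight_unit ?uK // eq_sym oner_eq0.
exfalso; have E : (u |: K) :\ u = K by rewrite setU1K.
by apply: (@unit_star9 _ g (u |: K) u); rewrite ?E // cardsU1 uK' K8.
Qed.

Lemma s_ge1 u : 1 <= s u.
Proof.
have [v vK v1] := some_wq1 u; rewrite /s (bigD1 v) //= v1 lerDl.
by apply: sumr_ge0 => i _; exact: pair_weight_ge0.
Qed.

Lemma class_zero v u v' : v \in K -> u \in P v -> v' \in K -> v' != v -> wq v' u = 0.
Proof.
rewrite inE => vK /andP[su /eqP v1] v'K v'v.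
have [//|/andP[h _]] := pair_weight_values v' u; exfalso; move: su; rewrite ltNge => /negP; apply.
rewrite /s (bigD1 v) //= v1 (bigD1 v') /= ?v'K //.
suff : 0 <= \sum_(i | (i \in K) && (i != v) && (i != v')) wq i u by lra.
by apply: sumr_ge0 => i _; exact: pair_weight_ge0.
Qed.

Lemma class_disjoint v v' u : v \in K -> v' \in K -> u \in P v -> u \in P v' -> v = v'.
Proof.
move=> vK v'K uv uv'; apply/eqP; apply: contraT => ne.
have := class_zero v'K uv' vK ne; move: uv; rewrite inE => /andP[_ /eqP->] /eqP.
by rewrite oner_eq0.
Qed.

Lemma class_unit v u v' : v \in K -> u \in P v -> v' \in K :\ v -> u != v' /\ red g u v' || ful g u v'.
Proof.
move=> vK uP; rewrite !inE => /andP[v'v v'K]; have w0 := class_zero vK uP v'K v'v.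
have uv' : u != v'.
  by apply/eqP => E; move: w0; rewrite E /wq pair_weight_diag => /eqP; rewrite oner_eq0.
split=> //; move: w0; rewrite /wq /pair_weight eq_sym (negbTE uv') (red_sym g v') (ful_sym g v').
by case: ifP => // _; case: ifP => _ h; exfalso; lra.
Qed.

(** Since [u] is red or full to [K :\ v], it is doubled and may replace [v] in the 8-set. If the
    pair [u], [u'] had weight below 1, then [u'] would be a ninth vertex of a complete set. *)
Lemma class_empty v u u' : v \in K -> u \in P v -> u' \in P v -> wq u u' = 1.
Proof.
move=> vK uP u'P; have [->|uu'] := eqVneq u u'; first by rewrite /wq pair_weight_diag.
apply/eqP; apply: contraT => w1; exfalso.
have K7 : #|K :\ v| = 7 by move: K8; rewrite (cardsD1 v) vK => -[].
have dK' : doubled g (K :\ v) := doubled_sub (subsetDl _ _) dK.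
have uK7 : unit_clique g (K :\ v) := unit_clique_sub (subsetDl _ _) uK.
have nK w : w \in P v -> w \notin K :\ v.
  by move=> wP; apply/negP => wK; have [] := class_unit vK wP wK; rewrite eqxx.
have du : dbl g u.
  apply: (@doubled_neighbour _ g (K :\ v)); rewrite ?K7 // => v' v'K.
  exact: class_unit vK uP v'K.
have uKv : unit_clique g (u |: (K :\ v)).
  move=> i j; rewrite in_setU1 => /orP[/eqP->|iK]; rewrite in_setU1 => /orP[/eqP->|jK] ij.
  - by rewrite eqxx in ij.
  - by have [] := class_unit vK uP jK.
  - by rewrite red_sym ful_sym; have [] := class_unit vK uP iK.
  - exact: uK7.
have E : (u' |: (u |: (K :\ v))) :\ u' = u |: (K :\ v).
  by rewrite setU1K // in_setU1 negb_or eq_sym uu' nK.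
apply: (@unit_star9 _ g (u' |: (u |: (K :\ v))) u'); rewrite ?E //.
- apply: (@pair_weight_complete R) => i j; rewrite in_setU1 => /orP[/eqP->|iU]; rewrite in_setU1 => /orP[/eqP->|jU] ij.
  + by rewrite eqxx in ij.
  + move: jU; rewrite in_setU1 => /orP[/eqP->|jK]; first by rewrite pair_weight_sym.
    by rewrite pair_weight_unit ?(class_unit vK u'P jK).2 // eq_sym oner_eq0.
  + move: iU; rewrite in_setU1 => /orP[/eqP->//|iK].
    by rewrite pair_weight_sym pair_weight_unit ?(class_unit vK u'P iK).2 // eq_sym oner_eq0.
  + by rewrite pair_weight_unit ?uKv // eq_sym oner_eq0.
- by rewrite !cardsU1 K7 in_setU1 negb_or eq_sym uu' !nK.
- by move=> w; rewrite in_setU1 => /orP[/eqP->//|]; exact: dK'.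
Qed.

(** The degrees of [K] sum to at most (1 + 8 xi) k, while every vertex receives at least 1, and at
    least 3/2 if it lies in no class; so at most 16 xi k vertices are uncovered. *)
Lemma class_cover : k * (1 - 16 * xi) <= \sum_(v in K) #|P v|%:R.
Proof.
have : \sum_u s u <= 8 * ((1 / 8 + xi) * k).
  have -> : 8 * ((1 / 8 + xi) * k) = #|K|%:R * ((1 / 8 + xi) * k) by rewrite K8.
  rewrite exchange_big /= mulr_natl -sumr_const; apply: ler_sum => v vK; exact: degK.
have : \sum_u (3 / 2 - (1 / 2) * \sum_(v in K) one_on (P v) u) <= \sum_u s u.
  apply: ler_sum => u _; have [su|su] := ltP (s u) (3 / 2); last first.
    apply: le_trans su; rewrite lerBlDr lerDl; apply: mulr_ge0; first by lra.
    by apply: sumr_ge0 => v _; exact: ler0n.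
  apply: le_trans (s_ge1 u); have [v vK v1] := some_wq1 u.
  rewrite (bigD1 v) //= {1}/one_on inE su /= v1 eqxx.
  suff : 0 <= \sum_(i in K | i != v) one_on (P i) u by rewrite mulr1n; lra.
  by apply: sumr_ge0 => i _; exact: ler0n.
rewrite sumrB sumr_const -mulr_sumr exchange_big /=.
rewrite (eq_bigr (fun v => #|P v|%:R)); last by move=> v _; rewrite sum_one_on.
rewrite -mulr_natl -/k; lra.
Qed.
End Classes.

Lemma sum_sym_le8 (K : {set T}) (f : T -> R) : #|K| = 8 ->
  (\sum_(v in K) f v) ^+ 2 <= 8 * \sum_(v in K) f v ^+ 2.
Proof.
move=> K8; pose x v := if v \in K then f v else 0.
have := @cauchy_card R T K x; rewrite K8.
rewrite [\sum_i x i](_ : _ = \sum_(v in K) f v); last by rewrite [RHS]big_mkcond.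
rewrite [\sum_i x i ^+ 2](_ : _ = \sum_(v in K) f v ^+ 2); last first.
  by rewrite [RHS]big_mkcond; apply: eq_bigr => v _; rewrite /x; case: ifP; rewrite ?expr0n.
by apply => v /negbTE vK; rewrite /x vK.
Qed.

Section Bad.
Variables (D : T -> T -> R) (Bad : T -> T -> T -> R) (zeta eta k0 : R).
(** The squared deviation of a class size from k/8 comes out at most (4 xi + xi^2) k^2 <= 5 xi k^2,
    that is (zeta k)^2. *)
Let xi : R := zeta ^+ 2 / 5.
Hypotheses (kpos : 0 < k) (zeta0 : 0 < zeta) (zeta1 : zeta <= 1 / 100).
Hypotheses (eta0 : 0 <= eta) (k00 : 0 <= k0) (etak : k0 + 2 * eta <= xi ^+ 2).
Hypotheses (D0 : forall i j, 0 <= D i j) (Dw : forall i j, wq i j <= D i j + 2 * eta).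
Hypothesis Dsum : \sum_i \sum_j D i j <= (1 / 8 + k0) * k ^+ 2.
Hypotheses (Bad1 : forall i j l, Bad i j l <= 2 * D i j) (Bad2 : forall i j l, Bad i j l <= 2 * D j l).
Hypothesis Bad3 : forall i j l, Bad i j l <= 2 - D i l.

Let tot : \sum_i \sum_j wq i j <= (1 / 8 + xi ^+ 2) * k ^+ 2.
Proof.
apply: (@le_trans _ _ (\sum_i \sum_j (D i j + 2 * eta))).
  by apply: ler_sum => i _; apply: ler_sum => j _; exact: Dw.
rewrite (eq_bigr (fun i => \sum_j D i j + k * (2 * eta))); last first.
  by move=> i _; rewrite big_split sumr_const /= -[X in _ + X]mulr_natl.
rewrite big_split sumr_const /= -[X in _ + X]mulr_natl -/k.
apply: (@le_trans _ _ ((1 / 8 + k0) * k ^+ 2 + k * (k * (2 * eta)))); first by rewrite lerD2r.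
have : (k0 + 2 * eta) * k ^+ 2 <= xi ^+ 2 * k ^+ 2 by rewrite ler_wpM2r ?sqr_ge0.
nra.
Qed.

(** Essentially only triples inside one class count: about 8 (k/8)^3 = k^3/64 of them. The pairs
    inside classes already carry almost the whole missing weight k^2/8, so little is left for the
    others. *)
Lemma gamma_bad : \sum_i \sum_j \sum_l Bad i j l <= (1 / 64 + 2 * zeta + 2 * eta + 4 * k0) * k ^+ 3.
Proof.
have [[z0 z1 e0] [k0' ek ks]] := (And3 zeta0 zeta1 eta0, And3 k00 etak kpos).
have z2 : zeta ^+ 2 <= zeta / 100 by rewrite expr2 mulrC; have := ler_wpM2l (ltW zeta0) zeta1; lra.
have xi0 : 0 < xi by rewrite divr_gt0 // exprn_gt0.
have xi5 : zeta ^+ 2 = 5 * xi by rewrite /xi; field.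
rewrite xi5 in z2; have xi1 : xi <= 1 / 1000.
  move: zeta1 z2; clearbody xi; lra.
have zx : xi <= zeta / 500 by move: z2; clearbody xi; lra.
have x1 : xi <= 1 by move: xi1; clearbody xi; lra.
have [K [dK uK K8 degK]] := exists_unit8 xi0 xi1 kpos tot.
pose s u := \sum_(v in K) wq v u; pose P v := [set u | (s u < 3 / 2) && (wq v u == 1)].
pose p v : R := #|P v|%:R.
pose sm i j := \sum_(v in K) one_on (P v) i * one_on (P v) j.
have one0 v i : 0 <= one_on (P v) i by exact: ler0n.
have sm0 i j : 0 <= sm i j by apply: sumr_ge0 => v _; rewrite mulr_ge0.
have dis v v' u := @class_disjoint K v v' u.
have p_cover : k * (1 - 16 * xi) <= \sum_(v in K) p v by exact: class_cover.
have p_le : \sum_(v in K) p v <= k.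
  rewrite /p (eq_bigr (fun v => \sum_u one_on (P v) u)); last by move=> v _; rewrite sum_one_on.
  rewrite exchange_big /= /k -sum1_card natr_sum; apply: ler_sum => u _.
  have [/exists_inP[v vK uv]|/exists_inPn no] := boolP [exists v in K, u \in P v].
    rewrite (bigD1 v) //= big1 ?addr0; first by rewrite /one_on uv.
    move=> v' /andP[v'K v'v]; rewrite /one_on; case: (boolP (u \in P v')) => // uv'.
    by rewrite (dis v v' u) ?eqxx in v'v.
  by rewrite big1 // => v /no uv; rewrite /one_on (negbTE uv).
have sm_sum : \sum_i \sum_j sm i j = \sum_(v in K) p v ^+ 2.
  under eq_bigr do rewrite exchange_big /=.
  rewrite exchange_big /=; apply: eq_bigr => v _; rewrite expr2 /p -sum_one_on big_distrlr.
  by apply: eq_bigr => i _; apply: eq_bigr.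
have smE i j : (exists v, [/\ v \in K, i \in P v, j \in P v & sm i j = 1]) \/ sm i j = 0.
  have [/exists_inP[v vK /andP[iv jv]]|/exists_inPn no] := boolP [exists v in K, (i \in P v) && (j \in P v)].
    left; exists v; split=> //; rewrite /sm (bigD1 v) //= big1 ?addr0; first by rewrite /one_on iv jv mulr1.
    move=> v' /andP[v'K v'v]; rewrite /one_on; case: (boolP (i \in P v')) => [iv'|]; last by rewrite mul0r.
    by rewrite (dis v v' i) ?eqxx in v'v.
  right; rewrite /sm big1 // => v /no; rewrite /one_on negb_and.
  by case: (i \in P v) => /= [/negbTE->|_]; rewrite ?mulr0 ?mul0r.
have sm_wq i j : sm i j <= wq i j.
  have [[v [vK iv jv ->]]|->] := smE i j; last exact: pair_weight_ge0.
  by rewrite (class_empty dK uK K8 vK iv jv).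
have p2_le : \sum_(v in K) p v ^+ 2 <= (1 / 8 + xi ^+ 2) * k ^+ 2.
  by rewrite -sm_sum; apply: le_trans tot; apply: ler_sum => i _; apply: ler_sum => j _.
have p2_ge : (1 - 32 * xi) * k ^+ 2 / 8 <= \sum_(v in K) p v ^+ 2.
  have := sum_sym_le8 p K8; have : (k * (1 - 16 * xi)) ^+ 2 <= (\sum_(v in K) p v) ^+ 2.
    by rewrite ler_sqr ?nnegrE ?mulr_ge0 ?(ltW kpos) ?sumr_ge0 //; lra.
  have : 0 <= (16 * xi) ^+ 2 * k ^+ 2 by rewrite mulr_ge0 ?sqr_ge0.
  by move: (\sum_(v in K) p v ^+ 2) ((\sum_(v in K) p v) ^+ 2) => a b; lra.
have p_max v : v \in K -> p v <= (1 / 8 + zeta) * k.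
  move=> vK; have : (p v - k / 8) ^+ 2 <= (zeta * k) ^+ 2.
    have : (p v - k / 8) ^+ 2 <= \sum_(w in K) (p w - k / 8) ^+ 2.
      by rewrite (bigD1 v) //= lerDl sumr_ge0 // => w _; exact: sqr_ge0.
    have -> : \sum_(w in K) (p w - k / 8) ^+ 2 = \sum_(w in K) p w ^+ 2 - k / 4 * \sum_(w in K) p w + k ^+ 2 / 8.
      have -> : k ^+ 2 / 8 = \sum_(w in K) (k / 8) ^+ 2.
        by rewrite sumr_const K8 -mulr_natl; field.
      by rewrite mulr_sumr -sumrB -big_split; apply: eq_bigr => w _ /=; field.
    have : k / 4 * (k * (1 - 16 * xi)) <= k / 4 * \sum_(w in K) p w.
      by rewrite ler_wpM2l // divr_ge0 // ltW.
    have xx : xi ^+ 2 * k ^+ 2 <= xi * k ^+ 2.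
      by rewrite ler_wpM2r ?sqr_ge0 // expr2 ler_piMl // ltW.
    rewrite exprMn xi5.
    lra.
  have [h|/ltW] := leP 0 (p v - k / 8); last by have := mulr_gt0 zeta0 kpos; lra.
  rewrite ler_sqr ?nnegrE ?mulr_ge0 ?(ltW zeta0) ?(ltW kpos) //; lra.
have sm_col j : \sum_i sm i j <= (1 / 8 + zeta) * k.
  have [[v [vK jv _ _]]|s0] := smE j j.
    rewrite (eq_bigr (fun i => one_on (P v) i)) ?sum_one_on; first exact: p_max.
    move=> i _; rewrite /sm (bigD1 v) //= big1 ?addr0; first by rewrite /one_on jv mulr1.
    move=> v' /andP[v'K v'v]; rewrite /one_on; case: (boolP (j \in P v')) => [jv'|]; last by rewrite mulr0.
    by rewrite (dis v v' j) ?eqxx in v'v.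
  rewrite big1; first by rewrite mulr_ge0 ?(ltW kpos) //; lra.
  move=> i _; have [[v [vK iv jv _]]|//] := smE i j; move: s0; rewrite /sm (bigD1 v) //= /one_on jv.
  have : 0 <= \sum_(w in K | w != v) one_on (P w) j * one_on (P w) j.
    by apply: sumr_ge0 => w _; rewrite mulr_ge0.
  by rewrite /one_on mulr1n; lra.
(* If all three lie in one class, the pair i l has weight 1 and [Bad3] gives 1 + 2 eta. Otherwise i
   j or j l is not inside a class, and [Bad1] or [Bad2] charges the triple to it. *)
have bound i j l : Bad i j l <= (1 + 2 * eta) * (sm i j * sm j l) + 2 * (D i j * (1 - sm i j)) + 2 * (D j l * (1 - sm j l)).
  have [[v [vK iv jv s1]]|s1] := smE i j; last first.
    rewrite s1 mul0r mulr0 add0r subr0 mulr1; apply: (le_trans (Bad1 i j l)); rewrite lerDl.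
    have [[v [_ _ _ ->]]|->] := smE j l; rewrite ?subrr ?mulr0 //.
    by rewrite subr0 mulr1 mulr_ge0.
  have [[v' [v'K jv' lv' s2]]|s2] := smE j l; last first.
    by rewrite s1 s2 !mulr0 subrr add0r mulr0 mulr0 add0r subr0 mulr1.
  have E : v = v' by apply: dis jv jv'.
  rewrite s1 s2 subrr !mulr1 !mulr0 !addr0; apply: (le_trans (Bad3 i j l)).
  rewrite -E in lv'; have := class_empty dK uK K8 vK iv lv'.
  by have := Dw i l; lra.
have sumL : \sum_i \sum_j \sum_l sm i j * sm j l <= (1 / 8 + zeta) * k * \sum_(v in K) p v ^+ 2.
  rewrite exchange_big -sm_sum mulr_sumr /=; apply: ler_sum => j _.
  under eq_bigr do rewrite -mulr_sumr.
  rewrite -mulr_suml ler_wpM2r ?sm_col //; by apply: sumr_ge0.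
have sumD : \sum_i \sum_j D i j * (1 - sm i j) <= (k0 + eta / 4 + 4 * xi) * k ^+ 2.
  have h : \sum_i \sum_j D i j * (1 - sm i j) <= \sum_i \sum_j D i j - (1 - 2 * eta) * \sum_i \sum_j sm i j.
    rewrite mulr_sumr -sumrB; apply: ler_sum => i _; rewrite mulr_sumr -sumrB; apply: ler_sum => j _.
    have [[v [vK iv jv s1]]|->] := smE i j; last by rewrite subr0 !mulr0 mulr1 subr0.
    have := class_empty dK uK K8 vK iv jv; have := Dw i j; rewrite s1; lra.
  by move: p2_ge; rewrite -sm_sum => low; exact: (missing_sum_arith e0 k0' xi0 x1 ek h Dsum low).
apply: (@le_trans _ _ ((1 + 2 * eta) * (\sum_i \sum_j \sum_l sm i j * sm j l)
    + 2 * (k * \sum_i \sum_j D i j * (1 - sm i j)) + 2 * (k * \sum_j \sum_l D j l * (1 - sm j l)))).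
  apply: (@le_trans _ _ (\sum_i \sum_j \sum_l ((1 + 2 * eta) * (sm i j * sm j l)
     + 2 * (D i j * (1 - sm i j)) + 2 * (D j l * (1 - sm j l))))).
    by do 3 (apply: ler_sum => ? _); exact: bound.
  have E1 : k * (\sum_i \sum_j D i j * (1 - sm i j)) = \sum_i \sum_j \sum_(l : T) D i j * (1 - sm i j).
    rewrite mulr_sumr; apply: eq_bigr => i _; rewrite mulr_sumr; apply: eq_bigr => j _.
    by rewrite sumr_const mulr_natl.
  have E2 : k * (\sum_j \sum_l D j l * (1 - sm j l)) = \sum_(i : T) \sum_j \sum_l D j l * (1 - sm j l).
    by rewrite sumr_const mulr_natl.
  rewrite {1}E1 E2 !mulr_sumr -!big_split; apply: ler_sum => i _ /=.
  rewrite !mulr_sumr -!big_split; apply: ler_sum => j _ /=.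
  by rewrite !mulr_sumr -!big_split.
exact: (bad_sum_arith ks z0 z1 xi0 zx e0 k0' ek sumL p2_le sumD).
Qed.
End Bad.
End Stability.

(** * Cylinder regularity *)

Section Average.
Variables (R : realType) (V : finType) (k : nat).
Implicit Types (W : {ffun 'I_k -> {set V}}) (F : {ffun 'I_k -> V} -> R).

Definition box W : {set {ffun 'I_k -> V}} := [set x : {ffun 'I_k -> V} | [forall i, x i \in W i]].

Lemma boxP W (x : {ffun 'I_k -> V}) : reflect (forall i, x i \in W i) (x \in box W).
Proof. by rewrite inE; apply: forallP. Qed.

Lemma card_box W : #|box W| = (\prod_i #|W i|)%N.
Proof.
have -> : #|box W| = #|family (fun i => mem (W i))|.
  by apply: eq_card => x; rewrite inE; apply/forallP/familyP => h i; apply: h.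
by rewrite card_family foldrE big_map big_enum.
Qed.

Lemma box_gt0 W : (forall i, W i != set0) -> (0 < #|box W|)%N.
Proof. by move=> W0; rewrite card_box prodn_gt0 // => i; rewrite card_gt0. Qed.

Definition avg W F : R := (\sum_(x in box W) F x) / #|box W|%:R.

Lemma avg_const W a : (0 < #|box W|)%N -> avg W (fun=> a) = a.
Proof.
move=> b0; rewrite /avg sumr_const -(mulr_natr a) mulfK //.
by rewrite pnatr_eq0 -lt0n.
Qed.

Lemma avgD W F G : avg W (fun x => F x + G x) = avg W F + avg W G.
Proof. by rewrite /avg big_split mulrDl. Qed.

Lemma avgZ W a F : avg W (fun x => a * F x) = a * avg W F.
Proof. by rewrite /avg -mulr_sumr mulrA. Qed.

Lemma avg_sum (I : finType) (P : pred I) W (G : I -> {ffun 'I_k -> V} -> R) :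
  avg W (fun x => \sum_(i | P i) G i x) = \sum_(i | P i) avg W (G i).
Proof. by rewrite /avg exchange_big mulr_suml. Qed.

Lemma ler_avg W F G : (forall x, F x <= G x) -> avg W F <= avg W G.
Proof.
move=> FG; rewrite /avg ler_wpM2r ?invr_ge0 ?ler0n //; apply: ler_sum => x _; exact: FG.
Qed.

Lemma avg_bounds W F a b : (0 < #|box W|)%N -> (forall x, a <= F x <= b) -> a <= avg W F <= b.
Proof.
move=> b0 Fab; apply/andP; split.
  by rewrite -{1}(avg_const a b0); apply: ler_avg => x; have /andP[] := Fab x.
by rewrite -[leRHS](avg_const b b0); apply: ler_avg => x; have /andP[] := Fab x.
Qed.

Definition fixed W (I : {set 'I_k}) (y : 'I_k -> V) : {ffun 'I_k -> {set V}} :=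
  [ffun l => if l \in I then [set y l] else W l].

Lemma card_fixed W (I : {set 'I_k}) y : #|box (fixed W I y)| = (\prod_(l | l \notin I) #|W l|)%N.
Proof.
rewrite card_box (bigID (fun l => l \in I)) /= big1 ?mul1n; last first.
  by move=> l lI; rewrite ffunE lI cards1.
by apply: eq_bigr => l /negbTE lI; rewrite ffunE lI.
Qed.

Lemma avg_pair W i j (g : V -> V -> R) : (forall l, W l != set0) -> i != j ->
  avg W (fun x => g (x i) (x j)) = (\sum_(u in W i) \sum_(v in W j) g u v) / (#|W i|%:R * #|W j|%:R).
Proof.
move=> W0 ij; pose I := [set i; j].
pose C := (\prod_(l | l \notin I) #|W l|)%N.
have iI : i \in I by rewrite !inE eqxx.
have jI : j \in I by rewrite !inE eqxx orbT.
have bC : #|box W| = (#|W i| * #|W j| * C)%N.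
  rewrite card_box (bigID (fun l => l \in I)) /=; congr (_ * _)%N.
  rewrite (bigD1 i) //= (bigD1 j) /=; last by rewrite jI eq_sym.
  by rewrite big1 ?muln1 // => l; rewrite !inE => /andP[/andP[/orP[]/eqP->]]; rewrite eqxx ?andbF.
have sE : \sum_(x in box W) g (x i) (x j) = (\sum_(u in W i) \sum_(v in W j) g u v) * C%:R.
  rewrite pair_big_dep /= (partition_big (fun x : {ffun 'I_k -> V} => (x i, x j))
    (fun p => (p.1 \in W i) && (p.2 \in W j))) /=; last by move=> x /boxP h; rewrite !h.
  rewrite mulr_suml; apply: eq_bigr => -[u v] /= /andP[uW vW].
  rewrite (eq_bigr (fun=> g u v)); last by move=> x /andP[_ /eqP[-> ->]].
  rewrite sumr_const mulr_natr; congr (_ *+ _).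
  rewrite /C -(card_fixed W I (fun l => if l == i then u else v)); apply: eq_card => x.
  apply/andP/boxP => [[/boxP xW /eqP[xi xj]] l|h].
    rewrite ffunE !inE; case: eqP => [->|li] /=; first by rewrite inE xi.
    by case: eqP => [->|lj]; rewrite ?inE ?xj.
  have hi := h i; have hj := h j; rewrite ffunE iI eqxx inE in hi.
  rewrite ffunE jI eq_sym (negbTE ij) inE in hj; split; last by rewrite (eqP hi) (eqP hj).
  apply/boxP => l; have := h l; rewrite ffunE !inE.
  case: eqP => [->|_] /=; first by rewrite inE => /eqP->.
  by case: eqP => [->|_] /=; rewrite ?inE => // /eqP->.
have C0 : C%:R != 0 :> R.
  by rewrite pnatr_eq0 -lt0n prodn_cond_gt0 // => l _; rewrite card_gt0.
by rewrite /avg sE bC !natrM invfM mulrACA mulfV // mulr1.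
Qed.

Lemma avg_triple i j l (g : V -> V -> V -> R) : i != j -> i != l -> j != l -> (0 < #|V|)%N ->
  avg [ffun=> [set: V]] (fun x => g (x i) (x j) (x l)) = (\sum_u \sum_v \sum_w g u v w) / #|V|%:R ^+ 3.
Proof.
move=> ij il jl V0; pose I := [set i; j; l]; pose W : {ffun 'I_k -> {set V}} := [ffun=> [set: V]].
pose C := (\prod_(m | m \notin I) #|W m|)%N.
have [iI jI lI] : [/\ i \in I, j \in I & l \in I] by rewrite !inE !eqxx !orbT.
have WV m : #|W m| = #|V| by rewrite ffunE cardsT.
have bC : #|box W| = (#|V| * #|V| * #|V| * C)%N.
  rewrite card_box (bigID (fun m => m \in I)) /=; congr (_ * _)%N.
  rewrite (bigD1 i) //= (bigD1 j) /=; last by rewrite jI eq_sym.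
  rewrite (bigD1 l) /=; last by rewrite lI eq_sym il eq_sym.
  rewrite !WV big1 ?muln1 ?mulnA // => m; rewrite !inE.
  by move=> /andP[/andP[/andP[/orP[/orP[]|]/eqP->]]]; rewrite eqxx ?andbF.
have sE : \sum_(x in box W) g (x i) (x j) (x l) = (\sum_u \sum_v \sum_w g u v w) * C%:R.
  under [in RHS]eq_bigr do rewrite pair_big /=.
  rewrite pair_big /= (partition_big (fun x : {ffun 'I_k -> V} => (x i, (x j, x l))) xpredT) //=.
  rewrite mulr_suml; apply: eq_bigr => -[u [v w]] _ /=.
  rewrite (eq_bigr (fun=> g u v w)); last by move=> x /andP[_ /eqP[-> -> ->]].
  rewrite sumr_const mulr_natr; congr (_ *+ _).
  rewrite /C -(card_fixed W I (fun m => if m == i then u else if m == j then v else w)); apply: eq_card => x.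
  apply/andP/boxP => [[_ /eqP[xi xj xl]] m|h].
    rewrite ffunE !inE; case: eqP => [->|_] /=; first by rewrite inE xi.
    case: eqP => [->|_] /=; first by rewrite inE xj.
    by case: eqP => [->|_] /=; rewrite ?ffunE ?inE ?xl.
  have [hi hj hl] := And3 (h i) (h j) (h l).
  rewrite ffunE iI eqxx inE in hi; rewrite ffunE jI eq_sym (negbTE ij) eqxx inE in hj.
  rewrite ffunE lI eq_sym (negbTE il) eq_sym (negbTE jl) inE in hl.
  split; last by rewrite (eqP hi) (eqP hj) (eqP hl).
  by apply/boxP => m; rewrite ffunE inE.
have C0 : C%:R != 0 :> R.
  by rewrite pnatr_eq0 -lt0n prodn_cond_gt0 // => m _; rewrite WV.
by rewrite /avg sE bC !natrM invfM mulrACA mulfV // mulr1 !exprS expr0 mulr1 mulrA.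
Qed.

End Average.

Section Density.
Variables (R : realType) (V : finType) (E : rel V).

Definition dens (X Y : {set V}) : R :=
  (\sum_(u in X) \sum_(v in Y) (E u v)%:R) / (#|X|%:R * #|Y|%:R).

End Density.

Lemma sum_indicator (R : realType) (V : finType) (X W : {set V}) : X \subset W ->
  \sum_(u in W) (u \in X)%:R = #|X|%:R :> R.
Proof.
move=> XW; rewrite -natr_sum; congr _%:R; rewrite -sum1_card [RHS](big_mkcond (fun u => u \in X)).
rewrite [LHS]big_mkcond; apply: eq_bigr => u _; case: (boolP (u \in X)) => [uX|_]; last by case: (_ \in _).
by rewrite (subsetP XW).
Qed.

Section Potential.
Variables (R : realType) (V : finType) (k : nat) (C : finType) (E : C -> rel V).
Variables (F : {ffun 'I_k -> V} -> R) (B eps tau : R).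
Hypotheses (FB : forall x, - B <= F x <= B) (eps0 : 0 < eps) (tau0 : 0 < tau) (B0 : 0 < B).
Implicit Types (W : {ffun 'I_k -> {set V}}).

Let P := (C * ('I_k * 'I_k))%type.
Let G (p : P) (x : {ffun 'I_k -> V}) : R := (E p.1 (x p.2.1) (x p.2.2))%:R.

(** The mean square density enters with a minus sign, so refining lowers the potential on average.
    [P] also contains equal indices; convexity holds for these terms too. *)
Definition potential W : R := avg W F - tau * \sum_p (avg W (G p)) ^+ 2.
Let M : R := B + tau * #|{: P}|%:R.

Lemma index_density W c i j : (forall l, W l != set0) -> i != j ->
  avg W (G (c, (i, j))) = dens R (E c) (W i) (W j).
Proof. by move=> W0 ij; rewrite (avg_pair (fun u v => (E c u v)%:R) W0 ij). Qed.

Lemma avg_square_bounds W p : (0 < #|box W|)%N -> 0 <= (avg W (G p)) ^+ 2 <= 1.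
Proof.
move=> b0; rewrite sqr_ge0 /=; have /andP[h0 h1] : 0 <= avg W (G p) <= 1.
  by apply: avg_bounds => // x; rewrite ler0n lern1 leq_b1.
by rewrite expr_le1.
Qed.

Lemma potential_bounds W : (0 < #|box W|)%N -> - M <= potential W <= B.
Proof.
move=> b0; have /andP[a0 a1] := avg_bounds b0 FB.
have s0 : 0 <= \sum_p (avg W (G p)) ^+ 2.
  by apply: sumr_ge0 => p _; rewrite sqr_ge0.
have s1 : \sum_p (avg W (G p)) ^+ 2 <= #|{: P}|%:R.
  rewrite -sum1_card natr_sum; apply: ler_sum => p _.
  by have /andP[_] := avg_square_bounds p b0.
have t0 := mulr_ge0 (ltW tau0) s0; have t1 := ler_wpM2l (ltW tau0) s1.
by rewrite /potential /M; apply/andP; split; lra.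
Qed.

(** One-sided regularity: an embedding only needs that large subsets do not lose density. *)
Definition lower_regular W := forall c i j (X Y : {set V}), i != j -> X \subset W i -> Y \subset W j ->
  eps * #|W i|%:R <= #|X|%:R -> eps * #|W j|%:R <= #|Y|%:R ->
  dens R (E c) (W i) (W j) - eps <= dens R (E c) X Y.

Section Cells.
Variables (W : {ffun 'I_k -> {set V}}) (i j : 'I_k) (X Y : {set V}).
Hypotheses (W0 : forall l, W l != set0) (ij : i != j) (XW : X \subset W i) (YW : Y \subset W j).

Definition cell (b : bool * bool) : {ffun 'I_k -> {set V}} :=
  [ffun l => if l == i then (if b.1 then X else W i :\: X)
             else if l == j then (if b.2 then Y else W j :\: Y) else W l].

Lemma cell_sub b l : cell b l \subset W l.
Proof.
rewrite ffunE; case: eqP => [->|_]; first by case: b.1; rewrite ?subsetDl.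
by case: eqP => [->|_] //; case: b.2; rewrite ?subsetDl.
Qed.

Lemma box_cell b x : (x \in box (cell b)) = (x \in box W) && ((x i \in X, x j \in Y) == b).
Proof.
case: b => b1 b2; apply/boxP/andP => [h|[/boxP xW /eqP[xi xj]] l].
  split; first by apply/boxP => l; apply: (subsetP (cell_sub (b1, b2) l)).
  have hi := h i; have hj := h j; rewrite !ffunE eqxx /= in hi hj.
  rewrite eq_sym (negbTE ij) in hj.
  apply/eqP; congr (_, _).
    by case: b1 hi {h hj} => [->|/setDP[_ /negbTE->]].
  by rewrite eqxx in hj; case: b2 hj {h hi} => [->|/setDP[_ /negbTE->]].
rewrite ffunE; case: eqP => [->|_] /=; first by rewrite -xi; case: ifP => // xX; rewrite inE xX xW.
by case: eqP => [->|_] //; rewrite -xj; case: ifP => // xX; rewrite inE xX xW.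
Qed.

Let p b : R := #|box (cell b)|%:R / #|box W|%:R.
Let bW : (0 < #|box W|)%N := box_gt0 W0.
Let bWR : 0 < #|box W|%:R :> R. Proof. by rewrite ltr0n. Qed.

Lemma avg_cells H : avg W H = \sum_b p b * avg (cell b) H.
Proof.
rewrite /avg (partition_big (fun x : {ffun 'I_k -> V} => (x i \in X, x j \in Y)) xpredT) //=.
rewrite mulr_suml; apply: eq_bigr => b _.
have -> : \sum_(x in box W | (x i \in X, x j \in Y) == b) H x = \sum_(x in box (cell b)) H x.
  by apply: eq_bigl => x; rewrite box_cell.
rewrite /p; have [/cards0_eq->|b0] := eqVneq #|box (cell b)| 0%N.
  by rewrite big_set0 cards0 !mul0r.
have b0R : #|box (cell b)|%:R != 0 :> R by rewrite pnatr_eq0.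
by rewrite mulrAC mulrC [in RHS]mulrCA mulfV ?mulr1 // mulrC.
Qed.

Lemma sum_p : \sum_b p b = 1.
Proof.
have := avg_cells (fun=> 1); rewrite avg_const // => ->; apply: eq_bigr => b _.
rewrite /p; have [/cards0_eq->|b0] := eqVneq #|box (cell b)| 0%N; first by rewrite cards0 !mul0r.
by rewrite avg_const ?mulr1 // lt0n.
Qed.

Lemma p_ge0 b : 0 <= p b. Proof. by rewrite divr_ge0 ?ler0n. Qed.

Lemma p_cell : p (true, true) = (#|X|%:R * #|Y|%:R) / (#|W i|%:R * #|W j|%:R).
Proof.
have <- : avg W (fun x => (x i \in X)%:R * (x j \in Y)%:R) = p (true, true).
  rewrite /avg /p; congr (_ / _); rewrite -sum1_card natr_sum.
  rewrite [LHS]big_mkcond [RHS]big_mkcond; apply: eq_bigr => x _; rewrite box_cell xpair_eqE !eqb_id.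
  by case: (x \in box W) => //; case: (x i \in X); case: (x j \in Y); rewrite ?mulr0 ?mul0r ?mulr1.
rewrite (avg_pair (fun u v => (u \in X)%:R * (v \in Y)%:R) W0 ij); congr (_ / _).
under eq_bigr do rewrite -mulr_sumr.
by rewrite -mulr_suml !sum_indicator.
Qed.

Lemma jensen_cells b0 H :
  (avg W H) ^+ 2 + p b0 * (avg (cell b0) H - avg W H) ^+ 2 <= \sum_b p b * (avg (cell b) H) ^+ 2.
Proof.
set m := avg W H.
have -> : \sum_b p b * (avg (cell b) H) ^+ 2 = m ^+ 2 + \sum_b p b * (avg (cell b) H - m) ^+ 2.
  have -> : \sum_b p b * (avg (cell b) H - m) ^+ 2 =
    \sum_b (p b * (avg (cell b) H) ^+ 2) - (2 * m) * \sum_b (p b * avg (cell b) H) + m ^+ 2 * \sum_b p b.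
    rewrite !mulr_sumr -sumrB -big_split; apply: eq_bigr => b _ /=; ring.
  by rewrite sum_p -avg_cells -/m; ring.
rewrite lerD2l (bigD1 b0) //= lerDl; apply: sumr_ge0 => b _.
by rewrite mulr_ge0 ?sqr_ge0 ?p_ge0.
Qed.

Lemma jensen_cells0 H : (avg W H) ^+ 2 <= \sum_b p b * (avg (cell b) H) ^+ 2.
Proof.
apply: le_trans (jensen_cells (true, true) H).
by rewrite lerDl mulr_ge0 ?sqr_ge0 ?p_ge0.
Qed.

(** The irregular cell has relative size at least eps^2 and a density deficit above eps, so the
    variance of this density among the cells is at least eps^4. The other squares cannot fall on
    average, and the average of [F] is linear. *)
Lemma potential_cells c : eps * #|W i|%:R <= #|X|%:R -> eps * #|W j|%:R <= #|Y|%:R ->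
  dens R (E c) X Y < dens R (E c) (W i) (W j) - eps ->
  \sum_b p b * potential (cell b) <= potential W - tau * eps ^+ 4.
Proof.
move=> eX eY dXY.
have Wi0 l : 0 < #|W l|%:R :> R by rewrite ltr0n card_gt0.
have X0 : 0 < #|X|%:R :> R by apply: lt_le_trans eX; rewrite mulr_gt0.
have Y0 : 0 < #|Y|%:R :> R by apply: lt_le_trans eY; rewrite mulr_gt0.
have p0 : eps ^+ 2 <= p (true, true).
  rewrite p_cell ler_pdivlMr ?mulr_gt0 //.
  have -> : eps ^+ 2 * (#|W i|%:R * #|W j|%:R) = (eps * #|W i|%:R) * (eps * #|W j|%:R) by ring.
  by rewrite ler_pM ?mulr_ge0 ?ler0n // ltW.
have cell0 l : cell (true, true) l != set0.
  rewrite ffunE /=; have [_|_] := eqVneq l i; first by rewrite -card_gt0 -(@ltr0n R).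
  by have [_|_] := eqVneq l j; rewrite // -card_gt0 -(@ltr0n R).
pose q : P := (c, (i, j)).
have dq : eps <= avg W (G q) - avg (cell (true, true)) (G q).
  rewrite !index_density // !ffunE eqxx /= eq_sym (negbTE ij) eqxx.
  by move: dXY; lra.
have gain : \sum_r (avg W (G r)) ^+ 2 + eps ^+ 4 <= \sum_r \sum_b p b * (avg (cell b) (G r)) ^+ 2.
  rewrite [leLHS](_ : _ = ((avg W (G q)) ^+ 2 + eps ^+ 4) + \sum_(r | r != q) (avg W (G r)) ^+ 2).
    rewrite [leRHS](bigD1 q) //=; apply: lerD; last by apply: ler_sum => r _; apply: jensen_cells0.
    apply: le_trans (jensen_cells (true, true) _); rewrite lerD2l.
    have -> : eps ^+ 4 = eps ^+ 2 * eps ^+ 2 by ring.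
    apply: ler_pM; rewrite ?sqr_ge0 // -(sqrrN (_ - _)) opprB.
    by rewrite !expr2; apply: ler_pM; rewrite ?(ltW eps0).
  by rewrite (bigD1 q) //=; ring.
rewrite /potential.
have -> : \sum_b p b * (avg (cell b) F - tau * \sum_r (avg (cell b) (G r)) ^+ 2) =
  avg W F - tau * \sum_r \sum_b p b * (avg (cell b) (G r)) ^+ 2.
  rewrite exchange_big avg_cells mulr_sumr -sumrB; apply: eq_bigr => b _.
  by rewrite mulrBr -[in RHS]mulr_sumr (mulrCA tau).
have := ler_wpM2l (ltW tau0) gain; lra.
Qed.

(** The average gain might sit in tiny cells. A cell of relative size below [s] accounts for at most
    2 s M, so the four together for at most 8 s M, which is half of the guaranteed th; hence some
    larger cell gains as well. *)
Lemma good_cell c (s : R) : eps * #|W i|%:R <= #|X|%:R -> eps * #|W j|%:R <= #|Y|%:R ->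
  dens R (E c) X Y < dens R (E c) (W i) (W j) - eps -> 0 < s -> s * (16 * M) <= tau * eps ^+ 4 / 2 ->
  exists b, s <= p b /\ potential (cell b) <= potential W - tau * eps ^+ 4 / 2.
Proof.
move=> eX eY dXY s0 sM; set th := tau * eps ^+ 4 / 2 in sM *.
have cells := potential_cells eX eY dXY.
have th0 : 0 < th by rewrite divr_gt0 ?mulr_gt0 ?exprn_gt0.
have M0 : 0 < M by rewrite /M ltr_pwDl // mulr_ge0 ?ler0n // ltW.
have BM : B <= M by rewrite /M lerDl mulr_ge0 ?ler0n // ltW.
have /andP[W1 W2] := potential_bounds bW.
apply/not_existsP => no.
have low b : - (s * (2 * M)) <= p b * (potential (cell b) - potential W + th).
  have pb := p_ge0 b.
  have [pz|pz] := eqVneq (p b) 0.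
    by rewrite pz mul0r oppr_le0 !mulr_ge0 // ltW.
  have bc : (0 < #|box (cell b)|)%N.
    by rewrite lt0n; apply: contraNneq pz => z; rewrite /p z mul0r.
  have /andP[C1 C2] := potential_bounds bc.
  have [sp|sp] := leP s (p b).
    have nb : potential W - th < potential (cell b) by rewrite ltNge; apply/negP => h; apply: (no b).
    apply: (@le_trans _ _ 0); first by rewrite oppr_le0 !mulr_ge0 // ltW.
    by apply: mulr_ge0 => //; move: nb; lra.
  have h1 : - (2 * M) <= potential (cell b) - potential W + th by move: C1 W2 BM th0; lra.
  apply: le_trans (ler_wpM2l pb h1); rewrite mulrN lerN2 ler_wpM2r //; last exact: ltW.
  by rewrite mulr_ge0 // ltW.
have tot : \sum_(b : bool * bool) - (s * (2 * M)) <= \sum_b p b * (potential (cell b) - potential W + th).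
  by apply: ler_sum => b _; apply: low.
have e1 : \sum_b p b * (potential (cell b) - potential W + th) =
  (\sum_b p b * potential (cell b)) + (th - potential W) * \sum_b p b.
  by rewrite mulr_sumr -big_split; apply: eq_bigr => b _ /=; ring.
have e2 : \sum_(b : bool * bool) - (s * (2 * M)) = - (8 * (s * M)).
  by rewrite sumr_const card_prod card_bool (_ : (2 * 2)%N = 4%N) //; ring.
have sM0 : 0 < s * M by rewrite mulr_gt0.
move: tot cells sM; rewrite e1 e2 sum_p mulr1 (mulrCA s 16).
have -> : tau * eps ^+ 4 = 2 * th by rewrite /th; field.
by lra.
Qed.

Lemma cell_large b l (s : R) : 0 < s -> s <= p b -> s * #|W l|%:R <= #|cell b l|%:R.
Proof.
move=> s0 sp; apply: le_trans (ler_wpM2r _ sp) _; first exact: ler0n.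
rewrite /p mulrAC ler_pdivrMr // -!natrM ler_nat !card_box.
rewrite (bigD1 l) //= [X in (_ <= _ * X)%N](bigD1 l) //= -mulnA leq_mul2l mulnC leq_mul2l.
by apply/orP; right; apply/orP; right; apply: leq_prod => m _; apply: subset_leq_card (cell_sub _ _).
Qed.

End Cells.

Lemma regularize_steps (s : R) : 0 < s <= 1 -> s * (16 * M) <= tau * eps ^+ 4 / 2 ->
  forall n W, (forall l, W l != set0) -> potential W <= - M + n%:R * (tau * eps ^+ 4 / 2) ->
  exists W', [/\ forall l, W' l != set0, forall l, s ^+ n * #|W l|%:R <= #|W' l|%:R,
    potential W' <= potential W & lower_regular W'].
Proof.
move=> /andP[s0 s1] sM; set th := tau * eps ^+ 4 / 2 in sM *.
have th0 : 0 < th by rewrite divr_gt0 ?mulr_gt0 ?exprn_gt0.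
elim=> [|n IH] W W0 pW; have [regW|] := pselect (lower_regular W).
- by exists W; split => // l; rewrite expr0 mul1r.
- move=> /existsNP[c] /existsNP[i] /existsNP[j] /existsNP[X] /existsNP[Y].
  move=> /not_implyP[ij] /not_implyP[XW] /not_implyP[YW] /not_implyP[eX] /not_implyP[eY] /negP.
  rewrite -ltNge => dXY; have [b [pb Pb]] := good_cell W0 ij XW YW eX eY dXY s0 sM.
  have bc : (0 < #|box (cell W i j X Y b)|)%N.
    rewrite lt0n; apply/eqP => z; move: pb; rewrite z mul0r => h; have := lt_le_trans s0 h.
    by rewrite ltxx.
  have /andP[C1 _] := potential_bounds bc.
  by exfalso; move: pW Pb C1 th0; rewrite mul0r -/th; lra.
- exists W; split => // l; rewrite ler_piMl ?ler0n // exprn_ile1 //; exact: ltW.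
move=> /existsNP[c] /existsNP[i] /existsNP[j] /existsNP[X] /existsNP[Y].
move=> /not_implyP[ij] /not_implyP[XW] /not_implyP[YW] /not_implyP[eX] /not_implyP[eY] /negP.
rewrite -ltNge => dXY; have [b [pb Pb]] := good_cell W0 ij XW YW eX eY dXY s0 sM.
have cl l := cell_large W0 XW YW l s0 pb.
have c0 l : cell W i j X Y b l != set0.
  rewrite -card_gt0 -(@ltr0n R); apply: lt_le_trans (cl l); rewrite mulr_gt0 // ltr0n card_gt0; exact: W0.
have [|W' [W'0 W's W'p W'r]] := IH _ c0.
  by move: Pb pW; rewrite -/th -natr1 mulrDl mul1r; lra.
exists W'; split => // [l|].
  apply: le_trans (W's l); rewrite exprSr -mulrA ler_wpM2l //; by rewrite exprn_ge0 // ltW.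
by apply: le_trans W'p _; move: Pb th0; rewrite -/th; lra.
Qed.

End Potential.

(** Each step passes to a single cell, so every set keeps a fixed fraction, and the potential drops
    by th within a range of length M + B; hence the number of steps. As tau N <= gam, removing the
    index terms at the end costs at most [gam]. *)
Theorem cylinder_regularity (R : realType) (k : nat) (C : finType) (eps gam B : R) :
  0 < eps -> 0 < gam -> 0 < B -> exists2 s : R, 0 < s &
  forall (V : finType) (E : C -> rel V) (F : {ffun 'I_k -> V} -> R), (0 < #|V|)%N ->
  (forall x, - B <= F x <= B) -> exists W : {ffun 'I_k -> {set V}},
  [/\ forall i, s * #|V|%:R <= #|W i|%:R, avg W F <= avg [ffun=> [set: V]] F + gam &
      lower_regular E eps W].
Proof.
move=> eps0 gam0 B0; pose N : R := #|{: C * ('I_k * 'I_k)}|%:R.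
have N0 : 0 <= N by rewrite ler0n.
pose tau := gam / (N + 1).
have tau0 : 0 < tau by rewrite divr_gt0 // ltr_wpDl.
have tN : tau * N <= gam.
  by rewrite /tau mulrAC ler_pdivrMr ?ltr_wpDl // ler_wpM2l ?lerDl // ltW.
pose M := B + tau * N; pose th := tau * eps ^+ 4 / 2.
have M0 : 0 < M by rewrite /M ltr_pwDl // mulr_ge0 // ltW.
have th0 : 0 < th by rewrite divr_gt0 // mulr_gt0 // exprn_gt0.
pose s := Num.min 1 (th / (16 * M)).
have s0 : 0 < s by rewrite lt_min ltr01 divr_gt0 // mulr_gt0.
have s1 : s <= 1 by rewrite ge_min lexx.
have sM : s * (16 * M) <= th by rewrite -ler_pdivlMr ?mulr_gt0 // ge_min lexx orbT.
pose n := (Num.truncn ((M + B) / th)).+1.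
have nth : M + B <= n%:R * th.
  by rewrite -ler_pdivrMr //; apply: ltW; apply: truncnS_gt.
exists (s ^+ n); first by rewrite exprn_gt0.
move=> V E F V0 FB; set U := [ffun=> [set: V]].
have U0 l : U l != set0 by rewrite ffunE -card_gt0 cardsT.
have bU := box_gt0 U0.
have s01 : 0 < s <= 1 by rewrite s0 s1.
have /andP[_ pU2] := potential_bounds E FB tau0 bU.
have pU : potential E F tau U <= - M + n%:R * th by move: pU2 nth; lra.
have [W [W0 Ws Wp Wr]] := regularize_steps FB eps0 tau0 B0 s01 sM U0 pU.
exists W; split => // [i|]; first by have := Ws i; rewrite ffunE cardsT.
move: Wp; rewrite /potential => Wp.
have q0 : 0 <= \sum_(p : C * ('I_k * 'I_k)) avg U (fun x => (E p.1 (x p.2.1) (x p.2.2))%:R : R) ^+ 2.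
  by apply: sumr_ge0 => p _; rewrite sqr_ge0.
have q1 : \sum_(p : C * ('I_k * 'I_k)) avg W (fun x => (E p.1 (x p.2.1) (x p.2.2))%:R : R) ^+ 2 <= N.
  rewrite /N -sum1_card natr_sum; apply: ler_sum => p _.
  by have /andP[_] := avg_square_bounds R E p (box_gt0 W0).
have t0 := mulr_ge0 (ltW tau0) q0; have t1 := ler_wpM2l (ltW tau0) q1.
by move: Wp t0 t1 tN; lra.
Qed.

(** * Embedding cliques in regular tuples *)

Definition clique (V : finType) (E : rel V) (Q : {set V}) := {in Q &, forall x y, x != y -> E x y}.

Section Embedding.
Variables (R : realType) (V : finType) (E : rel V).
Hypotheses (Esym : symmetric E) (Eirr : irreflexive E).

Definition nbr (u : V) (Y : {set V}) : {set V} := [set v in Y | E u v].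

Lemma sum_nbr u (Y : {set V}) : \sum_(v in Y) (E u v)%:R = #|nbr u Y|%:R :> R.
Proof.
rewrite -natr_sum -sum1_card; congr _%:R; rewrite [LHS]big_mkcond [RHS]big_mkcond.
by apply: eq_bigr => v _; rewrite inE; case: (v \in Y); case: (E u v).
Qed.

Lemma few_low_degree (X Y : {set V}) (m c b : R) : 0 < b -> b <= c ->
  (forall X' : {set V}, X' \subset X -> m <= #|X'|%:R -> c <= dens R E X' Y) ->
  #|[set u in X | #|nbr u Y|%:R < (c - b / 2) * #|Y|%:R]|%:R < m.
Proof.
move=> b0 bc h; set B := [set u in X | _]; rewrite ltNge; apply/negP => mB.
have BX : B \subset X by apply/subsetP => u; rewrite inE => /andP[].
have := h B BX mB; rewrite /dens.
have c0 : 0 < c by apply: lt_le_trans bc.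
have [->|B0] := eqVneq #|B| 0%N; first by rewrite mul0r invr0 mulr0 leNgt c0.
have [->|Y0] := eqVneq #|Y| 0%N; first by rewrite mulr0 invr0 mulr0 leNgt c0.
have BY : 0 < #|B|%:R * #|Y|%:R :> R by rewrite mulr_gt0 // ltr0n lt0n.
rewrite ler_pdivlMr //.
have : \sum_(u in B) \sum_(v in Y) (E u v)%:R <= \sum_(u in B) (c - b / 2) * #|Y|%:R :> R.
  by apply: ler_sum => u; rewrite sum_nbr inE => /andP[_ /ltW].
rewrite sumr_const -[X in _ <= X -> _]mulr_natl; set s := \sum_(u in B) _; move=> h1 h2.
have := le_trans h2 h1; move: BY b0; set x : R := #|B|%:R; set y : R := #|Y|%:R; move=> xy b0.
have -> : x * ((c - b / 2) * y) = c * (x * y) - (b / 2) * (x * y) by field.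
by have := mulr_gt0 b0 xy; lra.
Qed.

Variables (k : nat) (U : 'I_k -> {set V}) (S0 D0 : {set 'I_k}) (lam b : R).
Hypotheses (lam0 : 0 <= lam) (b0 : 0 < b) (b2 : b <= 2).
Hypothesis U0 : forall i, U i != set0.

Let big i (X : {set V}) := X \subset U i /\ lam * #|U i|%:R <= #|X|%:R.

Hypothesis edge_dens : forall i j X Y, i \in S0 -> j \in S0 -> i != j -> big i X -> big j Y ->
  b <= dens R E X Y.
Hypothesis ful_dens : forall i j X Y, i \in D0 -> j \in D0 -> i != j -> big i X -> big j Y ->
  1 / 2 + b <= dens R E X Y.
Hypothesis dbl_edge : forall i X, i \in D0 -> big i X -> exists u v, [/\ u \in X, v \in X & E u v].

Lemma large_good i (X : {set V}) (T : {set 'I_k}) (Bad : 'I_k -> {set V}) r :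
  r * #|U i|%:R <= #|X|%:R -> (forall j, j \in T -> #|Bad j|%:R <= lam * #|U i|%:R) ->
  (r - k%:R * lam) * #|U i|%:R <= #|X :\: \bigcup_(j in T) Bad j|%:R.
Proof.
move=> rX hB; set B := \bigcup_(j in T) Bad j.
have BU : #|B|%:R <= k%:R * lam * #|U i|%:R.
  apply: (@le_trans _ _ (\sum_(j in T) #|Bad j|%:R)).
    rewrite -natr_sum ler_nat /B; elim/big_ind2: _ => [|A n A' n' h h'|//]; first by rewrite cards0.
    by apply: leq_trans (leq_add h h'); rewrite cardsU leq_subr.
  apply: le_trans (ler_sum _ hB) _; rewrite sumr_const -[leLHS]mulr_natl -mulrA ler_wpM2r ?ler_nat //.
    by rewrite mulr_ge0.
  by rewrite -[leqRHS]card_ord max_card.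
have : #|X|%:R <= #|X :\: B|%:R + #|B|%:R :> R.
  rewrite -natrD ler_nat -(cardsID B X) addnC leq_add2l subset_leq_card //; exact: subsetIr.
by move: rX BU; rewrite mulrBl; lra.
Qed.

(** Clusters outside [D] come first and receive one vertex, which needs only positive density. Once
    S = D all remaining densities exceed 1/2, so the two ends of an edge in one cluster have many
    common neighbours in the others. [r] is the fraction of each set still available; a step
    multiplies it by b / 2. *)
Lemma embed n : forall (S D : {set 'I_k}) (X : 'I_k -> {set V}) r, #|S| = n -> D \subset S ->
  S \subset S0 -> D \subset D0 ->
  (forall i, i \in S -> X i \subset U i) -> (forall i, i \in S -> r * #|U i|%:R <= #|X i|%:R) ->
  (k%:R + 1) * lam < r * (b / 2) ^+ n ->
  exists Q : {set V}, [/\ clique E Q, #|Q| = (#|S| + #|D|)%N & Q \subset \bigcup_(i in S) X i].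
Proof.
have bp := b0; have bp2 := b2; have lp := lam0; have hb0 : 0 < b / 2 by lra.
have hb1 : b / 2 <= 1 by lra.
elim: n => [|n IH] S D X r cS DS SS DD XU Xr rl.
  have S0' := cards0_eq cS; exists set0; rewrite sub0set S0'; split => //.
    by move=> x y; rewrite inE.
  by move: DS; rewrite S0' subset0 => /eqP->; rewrite !cards0.
have bn : 0 < (b / 2) ^+ n by rewrite exprn_gt0.
have bn1 : (b / 2) ^+ n <= 1 by rewrite exprn_ile1 // ltW.
have kl : 0 <= (k%:R + 1) * lam by rewrite mulr_ge0 // addr_ge0.
have r0 : 0 < r.
  by rewrite -(pmulr_lgt0 _ (exprn_gt0 n.+1 hb0)); apply: le_lt_trans rl.
have rl1 : (k%:R + 1) * lam < r * (b / 2) * (b / 2) ^+ n by rewrite -mulrA -exprS.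
have rl2 : (k%:R + 1) * lam < r * (b / 2).
  by apply: lt_le_trans rl1 _; rewrite ler_piMr // mulr_ge0 // ltW.
have rl3 : (k%:R + 1) * lam < r by apply: lt_le_trans rl2 _; rewrite ler_piMr // ltW.
have k0 : 0 <= k%:R * lam by rewrite mulr_ge0.
have rlam : lam <= r by move: rl3 k0; rewrite mulrDl mul1r; lra.
have Ui i : 0 < #|U i|%:R :> R by rewrite ltr0n card_gt0.
have bigX i : i \in S -> big i (X i).
  by move=> iS; split; [exact: XU|apply: le_trans (Xr i iS); rewrite ler_wpM2r].
have bigsub i (A : {set V}) : i \in S -> A \subset X i -> lam * #|U i|%:R <= #|A|%:R -> big i A.
  by move=> iS AX hA; split => //; apply: subset_trans (XU i iS).
have [SD|] := boolP (S \subset D).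
  have SDe : S = D by apply/eqP; rewrite eqEsubset SD.
  have /card_gt0P[i iS] : (0 < #|S|)%N by rewrite cS.
  have iD : i \in D by rewrite -SDe.
  pose Bad j := [set u in X i | #|nbr u (X j)|%:R < (1 / 2 + b - b / 2) * #|X j|%:R].
  have hB j : j \in S :\ i -> #|Bad j|%:R <= lam * #|U i|%:R.
    rewrite !inE => /andP[ji jS]; apply/ltW/few_low_degree => //; first by lra.
    move=> X' X'X hX'; apply: (@ful_dens i j); rewrite 1?eq_sym ?(subsetP DD) -?SDe //; last exact: bigX.
    exact: bigsub.
  have := large_good (Xr i iS) hB; set A := X i :\: _ => hA.
  have AX : A \subset X i by apply: subsetDl.
  have bA : big i A.
    apply: bigsub => //; apply: le_trans hA; rewrite ler_wpM2r //.
    by move: rl3; rewrite mulrDl mul1r; lra.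
  have [u [v [uA vA uv]]] := dbl_edge (subsetP DD _ iD) bA.
  pose X' j := nbr v (nbr u (X j)).
  have X'X j : X' j \subset X j by apply/subsetP => w; rewrite !inE => /andP[/andP[]].
  have X'r j : j \in S :\ i -> r * (b / 2) * #|U j|%:R <= #|X' j|%:R.
    move=> jSi; have [ji jS] : j != i /\ j \in S by apply/andP; rewrite !inE in jSi.
    have deg w : w \in A -> (1 / 2 + b / 2) * #|X j|%:R <= #|nbr w (X j)|%:R.
      rewrite inE => /andP[wB wX]; rewrite leNgt; apply: contra wB => low.
      apply/bigcupP; exists j => //; rewrite inE wX /=; apply: lt_le_trans low _.
      by rewrite ler_wpM2r //; lra.
    have hu := deg u uA; have hv := deg v vA.
    have cap : #|nbr u (X j)|%:R + #|nbr v (X j)|%:R <= #|X j|%:R + #|X' j|%:R :> R.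
      rewrite -!natrD ler_nat -cardsUI leq_add // subset_leq_card //.
        by apply/subsetP => w; rewrite !inE => /orP[]/andP[].
      by apply/subsetP => w; rewrite !inE => /andP[/andP[-> ->] /andP[_ ->]].
    have hX := ler_wpM2l (ltW hb0) (Xr j jS).
    move: hu hv cap hX; set x : R := #|X j|%:R; set y : R := #|U j|%:R.
    have x0 : 0 <= b * x by rewrite mulr_ge0 ?ler0n // ltW.
    rewrite !mulrDl => hu hv cap hX.
    have e : r * (b / 2) * y = b / 2 * (r * y) by ring.
    by rewrite e; move: hu hv cap hX x0; lra.
  have [|||||||Q [cQ nQ sQ]] := IH (S :\ i) (D :\ i) X' (r * (b / 2)).
  - by move: cS; rewrite (cardsD1 i S) iS => -[].
  - exact: setSD.
  - by apply: subset_trans SS; apply: subsetDl.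
  - by apply: subset_trans DD; apply: subsetDl.
  - by move=> j; rewrite !inE => /andP[_ jS]; apply: subset_trans (XU j jS).
  - exact: X'r.
  - by [].
  have Qu w : w \in Q -> E u w /\ E v w.
    by move=> /(subsetP sQ)/bigcupP[j _]; rewrite !inE => /andP[/andP[_ ->] ->].
  have uQ : u \notin Q by apply/negP => /Qu[]; rewrite Eirr.
  have vQ : v \notin Q by apply/negP => /Qu[_]; rewrite Eirr.
  have neq : u != v by apply/eqP => e; rewrite e Eirr in uv.
  exists (u |: (v |: Q)); split.
  - move=> x y; rewrite !inE => /or3P[/eqP->|/eqP->|xQ] /or3P[/eqP->|/eqP->|yQ]; rewrite ?eqxx // => xy.
    + by have [] := Qu _ yQ.
    + by rewrite Esym.
    + by have [] := Qu _ yQ.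
    + by rewrite Esym; have [] := Qu _ xQ.
    + by rewrite Esym; have [] := Qu _ xQ.
    + exact: cQ.
  - rewrite !cardsU1 !inE negb_or neq uQ vQ nQ (cardsD1 i S) (cardsD1 i D) iS iD /=.
    by move: #|S :\ i| #|D :\ i| => a c; rewrite !add1n addSn addnS.
  - apply/subsetP => w; rewrite !inE => /or3P[/eqP->|/eqP->|/(subsetP sQ)/bigcupP[j]].
    + by apply/bigcupP; exists i => //; apply: (subsetP AX).
    + by apply/bigcupP; exists i => //; apply: (subsetP AX).
    + rewrite inE => /andP[_ jS] /(subsetP (X'X j)) wX; by apply/bigcupP; exists j.
move=> /subsetPn[i iS iD].
pose Bad j := [set u in X i | #|nbr u (X j)|%:R < (b - b / 2) * #|X j|%:R].
have hB j : j \in S :\ i -> #|Bad j|%:R <= lam * #|U i|%:R.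
  rewrite !inE => /andP[ji jS]; apply/ltW/few_low_degree => //.
  move=> X' X'X hX'; apply: (@edge_dens i j); rewrite 1?eq_sym ?(subsetP SS) //; last exact: bigX.
  exact: bigsub.
have := large_good (Xr i iS) hB; set A := X i :\: _ => hA.
have AX : A \subset X i by apply: subsetDl.
have /card_gt0P[u uA] : (0 < #|A|)%N.
  rewrite -(@ltr0n R); apply: lt_le_trans hA; rewrite mulr_gt0 //.
  by move: rl3; rewrite mulrDl mul1r; lra.
pose X' j := nbr u (X j).
have X'X j : X' j \subset X j by apply/subsetP => w; rewrite !inE => /andP[].
have X'r j : j \in S :\ i -> r * (b / 2) * #|U j|%:R <= #|X' j|%:R.
  move=> jSi; have [ji jS] : j != i /\ j \in S by apply/andP; rewrite !inE in jSi.
  have deg : (b / 2) * #|X j|%:R <= #|X' j|%:R.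
    move: uA; rewrite inE => /andP[wB wX]; rewrite leNgt; apply: contra wB => low.
    apply/bigcupP; exists j => //; rewrite inE wX /=; apply: lt_le_trans low _.
    by rewrite ler_wpM2r //; lra.
  apply: le_trans deg; have -> : r * (b / 2) * #|U j|%:R = b / 2 * (r * #|U j|%:R) by ring.
  by rewrite ler_wpM2l // ?Xr // ltW.
have [|||||||Q [cQ nQ sQ]] := IH (S :\ i) D X' (r * (b / 2)).
- by move: cS; rewrite (cardsD1 i S) iS => -[].
- apply/subsetP => j jD; rewrite !inE (subsetP DS) // andbT; apply: contraNneq iD => <- //.
- by apply: subset_trans SS; apply: subsetDl.
- by [].
- by move=> j; rewrite !inE => /andP[_ jS]; apply: subset_trans (XU j jS).
- exact: X'r.
- by [].
have Qu w : w \in Q -> E u w.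
  by move=> /(subsetP sQ)/bigcupP[j _]; rewrite !inE => /andP[_ ->].
have uQ : u \notin Q by apply/negP => /Qu; rewrite Eirr.
exists (u |: Q); split.
- move=> x y; rewrite !inE => /orP[/eqP->|xQ] /orP[/eqP->|yQ]; rewrite ?eqxx // => xy.
  + exact: Qu.
  + by rewrite Esym Qu.
  + exact: cQ.
- by rewrite cardsU1 uQ nQ (cardsD1 i S) iS addnA.
- apply/subsetP => w; rewrite !inE => /orP[/eqP->|/(subsetP sQ)/bigcupP[j]].
  + by apply/bigcupP; exists i => //; apply: (subsetP AX).
  + rewrite inE => /andP[_ jS] /(subsetP (X'X j)) wX; by apply/bigcupP; exists j.
Qed.

Lemma embed_clique : D0 \subset S0 -> (k%:R + 1) * lam < (b / 2) ^+ k ->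
  exists Q : {set V}, clique E Q /\ #|Q| = (#|S0| + #|D0|)%N.
Proof.
move=> DS kl; have bp := b0; have bp2 := b2; have lp := lam0; have [//|//|//|//|||Q [cQ nQ _]] := @embed #|S0| S0 D0 U 1 erefl.
- by move=> i _; rewrite mul1r.
- rewrite mul1r; apply: lt_le_trans kl _; rewrite ler_wiXn2l //; first by lra.
  + lra.
  + by rewrite -[leqRHS]card_ord max_card.
- by exists Q.
Qed.

End Embedding.

Lemma dens_sym (R : realType) (V : finType) (E : rel V) (X Y : {set V}) : symmetric E ->
  dens R E X Y = dens R E Y X.
Proof.
move=> Es; rewrite /dens exchange_big mulrC [in RHS]mulrC; congr (_^-1 * _); first by rewrite mulrC.
by apply: eq_bigr => u _; apply: eq_bigr => v _; rewrite Es.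
Qed.

(** * The reduced graph of a lower-regular tuple *)

Section ReducedGraph.
Variables (R : realType) (V : finType) (E : bool -> rel V) (k : nat) (W : {ffun 'I_k -> {set V}}).
Variables (lam eta m : R).
Hypotheses (Esym : forall c, symmetric (E c)) (Eirr : forall c, irreflexive (E c)).
Hypothesis no_red : forall Q : {set V}, clique (E true) Q -> (#|Q| <= 2)%N.
Hypothesis no_blue : forall Q : {set V}, clique (E false) Q -> (#|Q| <= 6)%N.
Hypothesis indep_small : forall I : {set V}, {in I &, forall u v, ~~ E true u v && ~~ E false u v} ->
  #|I|%:R < m.
Hypotheses (eta0 : 0 < eta) (eta1 : eta <= 1) (lam0 : 0 < lam) (lam_eta : lam ^+ 2 <= eta / 2).
Hypothesis lam_k : (k%:R + 1) * lam < (eta / 2 / 2) ^+ k.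
Hypotheses (W0 : forall i, W i != set0) (Wm : forall i, m <= lam ^+ 2 * #|W i|%:R).
Hypothesis reg : lower_regular E (lam ^+ 2) W.

Definition red_free_in (W' X : {set V}) :=
  [&& X \subset W', lam * #|W'|%:R <= #|X|%:R & [forall u in X, forall v in X, ~~ E true u v]].

(** A large red-free subset, once chosen as core, has a blue edge in each of its large subsets
    because independent sets are small. If there is none, every large subset of the cluster has a
    red edge, and the core is the whole cluster. *)
Definition cl_dbl i := [exists X : {set V}, red_free_in (W i) X].
Definition cl_core i : {set V} := odflt (W i) [pick X : {set V} | red_free_in (W i) X].

Lemma cl_core_sub i : cl_core i \subset W i.
Proof. by rewrite /cl_core; case: pickP => [X /and3P[]|_] //=. Qed.

Lemma lam_k1 : (0 < k)%N -> lam <= 1.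
Proof.
move=> k0; have h : (eta / 2 / 2) ^+ k <= 1.
  rewrite exprn_ile1 //; move: eta0 eta1; lra.
have : lam <= (k%:R + 1) * lam by rewrite ler_peMl ?lerDr ?ler0n // ltW.
by move: lam_k h; lra.
Qed.

Lemma cl_core_large i : lam * #|W i|%:R <= #|cl_core i|%:R.
Proof.
rewrite /cl_core; case: pickP => [X /and3P[]|_] //=.
by rewrite ler_piMl ?ler0n // lam_k1 //; case: (i) => j; case: (k).
Qed.

Lemma cl_core_red_free i : cl_dbl i -> {in cl_core i &, forall u v, ~~ E true u v}.
Proof.
move=> /existsP[Y hY] u v; rewrite /cl_core; case: pickP => [X /and3P[_ _ h]|/(_ Y)]; last by rewrite hY.
by move=> /= uX vX; move/forall_inP/(_ u uX)/forall_inP: h; apply.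
Qed.

Lemma cl_core0 i : cl_core i != set0.
Proof.
rewrite -card_gt0 -(@ltr0n R); apply: lt_le_trans (cl_core_large i).
by rewrite mulr_gt0 // ltr0n card_gt0.
Qed.

(** A fraction of the core is a fraction of a fraction of the cluster, which explains the regularity
    parameter [lam ^+ 2]. *)
Lemma cl_big i (X : {set V}) : X \subset cl_core i -> lam * #|cl_core i|%:R <= #|X|%:R ->
  X \subset W i /\ lam ^+ 2 * #|W i|%:R <= #|X|%:R.
Proof.
move=> XU h; split; first exact: subset_trans XU (cl_core_sub i).
by apply: le_trans h; rewrite expr2 -mulrA ler_wpM2l ?cl_core_large // ltW.
Qed.

Lemma cl_dens c i j (X Y : {set V}) t : i != j -> t <= dens R (E c) (W i) (W j) ->
  X \subset cl_core i -> lam * #|cl_core i|%:R <= #|X|%:R ->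
  Y \subset cl_core j -> lam * #|cl_core j|%:R <= #|Y|%:R -> t - eta / 2 <= dens R (E c) X Y.
Proof.
move=> ij h X1 X2 Y1 Y2; have [X3 X4] := cl_big X1 X2; have [Y3 Y4] := cl_big Y1 Y2.
have := reg c ij X3 Y3 X4 Y4; move: h lam_eta; lra.
Qed.

Definition cl_red i j := (i != j) && (eta <= dens R (E true) (W i) (W j)).
Definition cl_ful i j := [&& i != j, ~~ cl_red i j & 1 / 2 + eta <= dens R (E false) (W i) (W j)].
Definition cl_hal i j := [&& i != j, ~~ cl_red i j, ~~ cl_ful i j & eta <= dens R (E false) (W i) (W j)].

Lemma cl_red_sym : symmetric cl_red.
Proof. by move=> i j; rewrite /cl_red eq_sym (dens_sym R _ _ (Esym true)). Qed.
Lemma cl_ful_sym : symmetric cl_ful.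
Proof. by move=> i j; rewrite /cl_ful eq_sym cl_red_sym (dens_sym R _ _ (Esym false)). Qed.
Lemma cl_hal_sym : symmetric cl_hal.
Proof. by move=> i j; rewrite /cl_hal eq_sym cl_red_sym cl_ful_sym (dens_sym R _ _ (Esym false)). Qed.
Lemma cl_red_irr : irreflexive cl_red. Proof. by move=> i; rewrite /cl_red eqxx. Qed.
Lemma cl_ful_irr : irreflexive cl_ful. Proof. by move=> i; rewrite /cl_ful eqxx. Qed.
Lemma cl_hal_irr : irreflexive cl_hal. Proof. by move=> i; rewrite /cl_hal eqxx. Qed.
Lemma cl_red_ful i j : cl_red i j -> cl_ful i j = false.
Proof. by rewrite /cl_ful => ->; rewrite andbF. Qed.
Lemma cl_red_hal i j : cl_red i j -> cl_hal i j = false.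
Proof. by rewrite /cl_hal => ->; rewrite andbF. Qed.
Lemma cl_ful_hal i j : cl_ful i j -> cl_hal i j = false.
Proof. by rewrite /cl_hal => ->; rewrite !andbF. Qed.

Let b0 : 0 < eta / 2. Proof. by rewrite divr_gt0. Qed.
Let b2 : eta / 2 <= 2. Proof. by move: eta1; lra. Qed.
Let lam00 := ltW lam0.

Lemma cl_red_triangle i j l : cl_red i j -> cl_red j l -> cl_red i l -> False.
Proof.
move=> rij rjl ril; pose S := [set i; j; l].
have dns a b : a \in S -> b \in S -> a != b -> cl_red a b.
  rewrite !inE => /orP[/orP[]|]/eqP-> /orP[/orP[]|]/eqP-> // ; rewrite ?eqxx // cl_red_sym //.
have [|||||Q [cQ nQ]] := @embed_clique R V (E true) (Esym true) (Eirr true) k cl_core S set0 lam (eta / 2) lam00 b0 b2 cl_core0.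
- move=> a b X Y aS bS ab [X1 X2] [Y1 Y2].
  have /andP[_ d] := dns a b aS bS ab; have := cl_dens ab d X1 X2 Y1 Y2; lra.
- by move=> a b X Y; rewrite inE.
- by move=> a X; rewrite inE.
- exact: sub0set.
- exact: lam_k.
have := no_red cQ; rewrite nQ cards0 addn0 /S.
have ij : i != j by case/andP: rij.
have jl : j != l by case/andP: rjl.
have il : i != l by case/andP: ril.
by rewrite cards3.
Qed.

(** In a non-doubled cluster large sets contain red edges, so the red embedding can put two vertices
    into [i] and one into [j]: a red triangle. *)
Lemma cl_red_dbl i j : cl_red i j -> cl_dbl i.
Proof.
move=> rij; apply: contraT => nd.
have ij : i != j by case/andP: rij.
have coreE : cl_core i = W i.
  by rewrite /cl_core; case: pickP => // X hX; case/negP: nd; apply/existsP; exists X.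
have dns a b : a \in [set i; j] -> b \in [set i; j] -> a != b -> cl_red a b.
  by rewrite !inE => /orP[]/eqP-> /orP[]/eqP-> //; rewrite ?eqxx // cl_red_sym.
have [|||||Q [cQ nQ]] := @embed_clique R V (E true) (Esym true) (Eirr true) k cl_core [set i; j] [set i] lam (eta / 2) lam00 b0 b2 cl_core0.
- move=> a b X Y aS bS ab [X1 X2] [Y1 Y2].
  have /andP[_ d] := dns a b aS bS ab; have := cl_dens ab d X1 X2 Y1 Y2; lra.
- by move=> a b X Y; rewrite !inE => /eqP-> /eqP->; rewrite eqxx.
- move=> a X; rewrite inE => /eqP-> []; rewrite coreE => XW hX.
  have : ~~ red_free_in (W i) X by apply: contra nd => h; apply/existsP; exists X.
  rewrite /red_free_in XW hX /= => /forall_inPn[u uX /forall_inPn[v vX /negPn uv]].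
  by exists u, v.
- by apply/subsetP => a; rewrite !inE => ->.
- exact: lam_k.
by have := no_red cQ; rewrite nQ cards1 cards2 ij.
Qed.

Lemma cl_blue_bound (S D : {set 'I_k}) : {in S &, forall x y, x != y -> cl_ful x y || cl_hal x y} ->
  D \subset S -> {in D, forall x, cl_dbl x} -> {in D &, forall x y, x != y -> cl_ful x y} ->
  (#|S| + #|D| <= 6)%N.
Proof.
move=> bS DS dD fD.
have [|||||Q [cQ nQ]] := @embed_clique R V (E false) (Esym false) (Eirr false) k cl_core S D lam (eta / 2) lam00 b0 b2 cl_core0.
- move=> a b X Y aS bS' ab [X1 X2] [Y1 Y2].
  have d : eta <= dens R (E false) (W a) (W b).
    have := bS a b aS bS' ab => /orP[/and3P[_ _]|/and4P[_ _ _ //]]; lra.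
  have := cl_dens ab d X1 X2 Y1 Y2; lra.
- move=> a b X Y aD bD ab [X1 X2] [Y1 Y2].
  have /and3P[_ _ d] := fD a b aD bD ab.
  have := cl_dens ab d X1 X2 Y1 Y2; lra.
- move=> a X aD [X1 X2]; have [X3 X4] := cl_big X1 X2.
  apply: contrapT => no.
  have : #|X|%:R < m.
    apply: indep_small => u v uX vX.
    rewrite (cl_core_red_free (dD _ aD)) ?(subsetP X1) //=; apply/negP => uv; apply: no.
    by exists u, v.
  by apply/negP; rewrite -leNgt; apply: le_trans X4.
- by [].
- exact: lam_k.
by rewrite -nQ; apply: no_blue.
Qed.

Definition cluster_graph : reduced 'I_k :=
  Reduced cl_red_sym cl_ful_sym cl_hal_sym cl_red_irr cl_ful_irr cl_hal_irr
    cl_red_ful cl_red_hal cl_ful_hal cl_red_triangle cl_red_dbl cl_blue_bound.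

(** A pair of weight 1/2 has red density below eta and blue density below 1/2 + eta; in a pair of
    weight 1 both are below eta. Hence the error 2 eta. *)
Lemma cluster_wq i j : i != j ->
  0 <= 1 - dens R (E true) (W i) (W j) - dens R (E false) (W i) (W j) ->
  pair_weight R cluster_graph i j <=
  1 - dens R (E true) (W i) (W j) - dens R (E false) (W i) (W j) + 2 * eta.
Proof.
move=> ij; rewrite /pair_weight (negbTE ij) /= /cl_hal /cl_ful /cl_red ij /=.
set r := dens _ _ _ _; set b := dens _ _ _ _; move: eta0.
by case: (leP eta r) => h1 /=; case: (leP (1 / 2 + eta) b) => h2 //=; try (case: (leP eta b) => h3 //=); lra.
Qed.

End ReducedGraph.

(** * Missing edges and paths *)

Section Functional.
Variables (R : realType) (V : finType) (E : bool -> rel V) (k : nat) (kap : R).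
Hypotheses (Esym : forall c, symmetric (E c)) (Eirr : forall c, irreflexive (E c)).
Hypothesis Eexcl : forall u v, E true u v -> ~~ E false u v.
Hypotheses (V0 : (0 < #|V|)%N) (k0 : (0 < k)%N) (kap0 : 0 < kap).

Definition nonedge u v : R := (~~ (E true u v || E false u v))%:R.
Definition bad3 u v w : R := nonedge u v * nonedge v w * (2 - nonedge u w).

Lemma nonedge01 u v : 0 <= nonedge u v <= 1.
Proof. by rewrite ler0n lern1 leq_b1. Qed.

Lemma bad3_bounds u v w : [/\ 0 <= bad3 u v w, bad3 u v w <= 2 * nonedge u v,
  bad3 u v w <= 2 * nonedge v w & bad3 u v w <= 2 - nonedge u w].
Proof.
rewrite /bad3 /nonedge.
case: (_ || _); case: (_ || _); case: (_ || _); rewrite /= ?mul0r ?mul1r ?mulr0 ?mulr1 ?subr0; split; lra.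
Qed.

Let K : R := k%:R.
Let K0 : 0 < K. Proof. by rewrite ltr0n. Qed.
Let dist (i j l : 'I_k) : R := ([&& i != j, i != l & j != l])%:R.

(** Only distinct indices occur, since only then are the coordinates independent. [cl_nonedge]
    restores the diagonal with value 1, at a cost of 1 / k. *)
Definition functional (x : {ffun 'I_k -> V}) : R :=
  K ^- 2 * (\sum_i \sum_j (i != j)%:R * nonedge (x i) (x j)) +
  - (kap * K ^- 3) * (\sum_i \sum_j \sum_l dist i j l * bad3 (x i) (x j) (x l)).

Lemma sum2_le (f : 'I_k -> 'I_k -> R) c : (forall i j, f i j <= c) -> \sum_i \sum_j f i j <= c * K ^+ 2.
Proof.
move=> fc; apply: (@le_trans _ _ (\sum_(i < k) \sum_(j < k) c)).
  by apply: ler_sum => i _; apply: ler_sum.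
by rewrite !sumr_const card_ord -!mulrnA -mulr_natr natrM -expr2.
Qed.

Lemma sum3_le (f : 'I_k -> 'I_k -> 'I_k -> R) c : (forall i j l, f i j l <= c) ->
  \sum_i \sum_j \sum_l f i j l <= c * K ^+ 3.
Proof.
move=> fc; rewrite exprSr mulrA.
have h i j : \sum_l f i j l <= c * K.
  apply: (@le_trans _ _ (\sum_(l < k) c)); first by apply: ler_sum.
  by rewrite sumr_const card_ord -mulr_natr.
by have := sum2_le h; rewrite -!mulrA (mulrC K).
Qed.

Lemma dist_bad_bounds i j l u v w : 0 <= dist i j l * bad3 u v w <= 2.
Proof.
have [h0 h1 _ _] := bad3_bounds u v w; have /andP[n0 n1] := nonedge01 u v.
by rewrite /dist; case: [&& _, _ & _]; rewrite ?mul1r ?mul0r; apply/andP; split; lra.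
Qed.

Lemma functional_bounds x : - (2 * kap) <= functional x <= 1.
Proof.
rewrite /functional; set P := (X in K ^- 2 * X); set Q := (X in - (kap * K ^- 3) * X).
have P0 : 0 <= P by apply: sumr_ge0 => i _; apply: sumr_ge0 => j _; rewrite mulr_ge0.
have P1 : P <= 1 * K ^+ 2.
  apply: sum2_le => i j; have /andP[n0 n1] := nonedge01 (x i) (x j).
  by case: (i != j); rewrite ?mul1r ?mul0r.
have Q0 : 0 <= Q.
  apply: sumr_ge0 => i _; apply: sumr_ge0 => j _; apply: sumr_ge0 => l _.
  by have /andP[] := dist_bad_bounds i j l (x i) (x j) (x l).
have Q1 : Q <= 2 * K ^+ 3.
  by apply: sum3_le => i j l; have /andP[] := dist_bad_bounds i j l (x i) (x j) (x l).
have e1 : 0 <= K ^- 2 * P <= 1.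
  by rewrite mulr_ge0 ?invr_ge0 ?exprn_ge0 ?(ltW K0) //= mulrC ler_pdivrMr ?exprn_gt0.
have e2 : 0 <= K ^- 3 * Q <= 2.
  by rewrite mulr_ge0 ?invr_ge0 ?exprn_ge0 ?(ltW K0) //= mulrC ler_pdivrMr ?exprn_gt0.
move/andP: e1 => [e10 e11]; move/andP: e2 => [e20 e21].
have f0 := mulr_ge0 (ltW kap0) e20; have f1 := ler_wpM2l (ltW kap0) e21.
by rewrite mulNr -mulrA; apply/andP; split; lra.
Qed.

Lemma avg_functional W : avg W functional =
  K ^- 2 * (\sum_i \sum_j (i != j)%:R * avg W (fun x => nonedge (x i) (x j))) +
  - (kap * K ^- 3) * (\sum_i \sum_j \sum_l dist i j l * avg W (fun x => bad3 (x i) (x j) (x l))).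
Proof.
rewrite /functional avgD !avgZ !avg_sum; congr (_ * _ + _ * _).
  by apply: eq_bigr => i _; rewrite avg_sum; apply: eq_bigr => j _; rewrite avgZ.
apply: eq_bigr => i _; rewrite avg_sum; apply: eq_bigr => j _; rewrite avg_sum.
by apply: eq_bigr => l _; rewrite avgZ.
Qed.

Definition nonedge_density : R := (\sum_u \sum_v nonedge u v) / #|V|%:R ^+ 2.
Definition bad_density : R := (\sum_u \sum_v \sum_w bad3 u v w) / #|V|%:R ^+ 3.

Let VR : 0 < #|V|%:R :> R. Proof. by rewrite ltr0n. Qed.

Lemma nonedge_density_ge0 : 0 <= nonedge_density.
Proof.
rewrite divr_ge0 ?exprn_ge0 //; apply: sumr_ge0 => u _; apply: sumr_ge0 => v _; exact: ler0n.
Qed.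

Lemma bad_density_bounds : 0 <= bad_density <= 2.
Proof.
apply/andP; split.
  rewrite divr_ge0 ?exprn_ge0 //; apply: sumr_ge0 => u _; apply: sumr_ge0 => v _.
  by apply: sumr_ge0 => w _; have [] := bad3_bounds u v w.
rewrite ler_pdivrMr ?exprn_gt0 //.
have -> : 2 * #|V|%:R ^+ 3 = \sum_(u : V) \sum_(v : V) \sum_(w : V) 2 :> R.
  rewrite !sumr_const -!mulrnA -[RHS]mulr_natr !natrM; ring.
apply: ler_sum => u _; apply: ler_sum => v _; apply: ler_sum => w _.
have [_ h _ _] := bad3_bounds u v w; have /andP[_ n1] := nonedge01 u v; lra.
Qed.

Lemma avg_functional_full : avg [ffun=> [set: V]] functional <=
  nonedge_density - kap * (1 - 3 / K) * bad_density.
Proof.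
rewrite avg_functional.
have e1 (i j : 'I_k) : (i != j)%:R * avg [ffun=> [set: V]] (fun x => nonedge (x i) (x j)) <= nonedge_density.
  have [_|ij] := eqVneq i j; rewrite ?mul0r ?mul1r; first exact: nonedge_density_ge0.
  rewrite avg_pair // => [|l]; last by rewrite ffunE -card_gt0 cardsT.
  rewrite !ffunE cardsT -expr2 /nonedge_density le_eqVlt; apply/orP; left; apply/eqP; congr (_ / _).
  rewrite [LHS]big_mkcond; apply: eq_bigr => u _; rewrite inE big_mkcond.
  by apply: eq_bigr => v _; rewrite inE.
have e2 i j l : dist i j l * avg [ffun=> [set: V]] (fun x => bad3 (x i) (x j) (x l)) =
    dist i j l * bad_density.
  rewrite /dist; case: (boolP [&& _, _ & _]) => [/and3P[ij il jl]|_]; last by rewrite !mul0r.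
  by rewrite !mul1r (avg_triple (fun u v w => bad3 u v w)).
have h1 := sum2_le e1.
have -> : \sum_i \sum_j \sum_l dist i j l * avg [ffun=> [set: V]] (fun x => bad3 (x i) (x j) (x l)) =
    (\sum_i \sum_j \sum_l dist i j l) * bad_density.
  rewrite mulr_suml; apply: eq_bigr => i _; rewrite mulr_suml; apply: eq_bigr => j _.
  by rewrite mulr_suml; apply: eq_bigr => l _.
have h2 : K ^+ 3 - 3 * K ^+ 2 <= \sum_i \sum_j \sum_l dist i j l.
  have -> : K ^+ 3 - 3 * K ^+ 2 =
      \sum_(i < k) \sum_(j < k) \sum_(l < k) (1 - (i == j)%:R - (i == l)%:R - (j == l)%:R).
    have one (i : 'I_k) : \sum_(j < k) (i == j)%:R = 1 :> R.
      rewrite (bigD1 i) //= eqxx big1 ?addr0 // => j; by rewrite eq_sym => /negbTE->.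
    have cst (c : R) : \sum_(j < k) c = K * c by rewrite sumr_const card_ord [RHS]mulr_natl.
    have s1 (i j : 'I_k) : \sum_(l < k) (1 - (i == j)%:R - (i == l)%:R - (j == l)%:R) =
        (K - 2) - K * (i == j)%:R :> R.
      by rewrite !sumrB !cst !one; ring.
    have s2 (i : 'I_k) : \sum_(j < k) ((K - 2) - K * (i == j)%:R) = K * (K - 2) - K :> R.
      by rewrite sumrB cst -mulr_sumr one mulr1.
    under eq_bigr => i _ do rewrite (eq_bigr _ (fun j _ => s1 i j)) s2.
    by rewrite cst; ring.
  apply: ler_sum => i _; apply: ler_sum => j _; apply: ler_sum => l _; rewrite /dist.
  by case: (i == j); case: (i == l); case: (j == l); rewrite /=; lra.
have /andP[b0 _] := bad_density_bounds.
apply: lerD; first by rewrite mulrC ler_pdivrMr ?exprn_gt0.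
rewrite mulNr lerN2 -(mulrA kap (1 - _)) -(mulrA kap (K ^- 3)) ler_wpM2l ?(ltW kap0) //.
rewrite [leRHS]mulrA ler_wpM2r // [leRHS]mulrC ler_pdivlMr ?exprn_gt0 //.
by move: h2; have -> : (1 - 3 / K) * K ^+ 3 = K ^+ 3 - 3 * K ^+ 2 by field; rewrite gt_eqF.
Qed.

Variables (W : {ffun 'I_k -> {set V}}).
Hypothesis W0 : forall i, W i != set0.

Definition cl_nonedge i j : R := if i == j then 1 else avg W (fun x => nonedge (x i) (x j)).
Definition cl_bad i j l : R := dist i j l * avg W (fun x => bad3 (x i) (x j) (x l)).

Let bW : (0 < #|box W|)%N := box_gt0 W0.

Lemma avg_nonedge01 i j : 0 <= avg W (fun x => nonedge (x i) (x j)) <= 1.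
Proof. by apply: avg_bounds => // x; apply: nonedge01. Qed.

Lemma cl_nonedge01 i j : 0 <= cl_nonedge i j <= 1.
Proof. by rewrite /cl_nonedge; case: eqP => _; [rewrite ler01 lexx|exact: avg_nonedge01]. Qed.

Lemma cl_nonedge_dens i j : i != j ->
  cl_nonedge i j = 1 - dens R (E true) (W i) (W j) - dens R (E false) (W i) (W j).
Proof.
move=> ij; rewrite /cl_nonedge (negbTE ij) /dens.
rewrite -(avg_pair (fun u v => (E true u v)%:R) W0 ij) -(avg_pair (fun u v => (E false u v)%:R) W0 ij).
have e (f h : _ -> R) : 1 - avg W f - avg W h = avg W (fun x => 1 + -1 * f x + -1 * h x).
  by rewrite !avgD !avgZ avg_const // !mulN1r.
rewrite e; congr avg; apply/funext => x.
have := Eexcl (u := x i) (v := x j).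
rewrite /nonedge; case: (E true _ _); case: (E false _ _) => //= h; rewrite ?mulr0 ?mulr1 ?addr0 ?subrr //.
by have := h isT.
Qed.

Lemma cl_bad_bounds i j l : [/\ cl_bad i j l <= 2 * cl_nonedge i j,
  cl_bad i j l <= 2 * cl_nonedge j l & cl_bad i j l <= 2 - cl_nonedge i l].
Proof.
rewrite /cl_bad /dist; case: (boolP [&& _, _ & _]) => [/and3P[ij il jl]|_]; last first.
  rewrite mul0r; have /andP[a0 a1] := cl_nonedge01 i j; have /andP[b0 b1] := cl_nonedge01 j l.
  have /andP[c0 c1] := cl_nonedge01 i l; split; lra.
rewrite mul1r /cl_nonedge (negbTE ij) (negbTE il) (negbTE jl); split.
- by rewrite -avgZ; apply: ler_avg => x; have [] := bad3_bounds (x i) (x j) (x l).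
- by rewrite -avgZ; apply: ler_avg => x; have [] := bad3_bounds (x i) (x j) (x l).
have -> (f : _ -> R) : 2 - avg W f = avg W (fun x => 2 + -1 * f x).
  by rewrite avgD avgZ avg_const // mulN1r.
by apply: ler_avg => x; rewrite mulN1r; have [] := bad3_bounds (x i) (x j) (x l).
Qed.

Lemma avg_functional_clusters : avg W functional =
  K ^- 2 * (\sum_i \sum_j cl_nonedge i j) - K^-1 - kap * (K ^- 3 * \sum_i \sum_j \sum_l cl_bad i j l).
Proof.
rewrite avg_functional /cl_bad.
have -> : \sum_i \sum_j cl_nonedge i j =
    K + \sum_i \sum_j (i != j)%:R * avg W (fun x => nonedge (x i) (x j)).
  have -> : K = \sum_(i < k) 1 by rewrite sumr_const card_ord.
  rewrite -big_split; apply: eq_bigr => i _ /=.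
  rewrite (bigD1 i) //= [in RHS](bigD1 i) //= /cl_nonedge eqxx mul0r add0r; congr (_ + _).
  by apply: eq_bigr => j; rewrite eq_sym => ij; rewrite (negbTE ij) mul1r.
set P := \sum_i _; set Q := \sum_i _; field; by rewrite gt_eqF.
Qed.

End Functional.

(** * Average non-degree and path density of the whole graph *)

Record ramsey_graph (V : finType) (E : bool -> rel V) : Prop := RamseyGraph {
  rg_sym : forall c, symmetric (E c);
  rg_irr : forall c, irreflexive (E c);
  rg_excl : forall u v, E true u v -> ~~ E false u v;
  rg_red : forall Q : {set V}, clique (E true) Q -> (#|Q| <= 2)%N;
  rg_blue : forall Q : {set V}, clique (E false) Q -> (#|Q| <= 6)%N }.

Definition indep_lt (R : realType) (V : finType) (E : bool -> rel V) (m : R) :=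
  forall I : {set V}, {in I &, forall u v, ~~ E true u v && ~~ E false u v} -> #|I|%:R < m.

Lemma nonedge_bound_arith (R : realFieldType) (s2 s3 nu be ik kap mu : R) :
  1 / 8 - 2 * mu <= s2 -> s3 <= 2 -> 0 <= be -> ik <= mu -> mu <= 1 / 3 -> 0 < kap ->
  s2 - ik - kap * s3 <= nu - kap * (1 - 3 * ik) * be + mu -> s2 <= nu + 2 * kap + 2 * mu.
Proof.
move=> h1 h2 h3 h4 h5 k0 h.
have a1 : kap * s3 <= kap * 2 by rewrite ler_wpM2l // ltW.
have a2 : 0 <= kap * (1 - 3 * ik) * be by rewrite !mulr_ge0 //; [exact: ltW|lra].
lra.
Qed.

Lemma bad_bound_arith (R : realFieldType) (s2 s3 nu be ik kap mu eps zeta : R) :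
  1 / 8 - 2 * mu <= s2 -> 0 <= be -> be <= 2 -> ik <= mu -> 0 < kap -> 0 < mu ->
  mu = kap * (eps / 100) -> nu <= 1 / 8 + mu -> kap <= 1 -> 80 * kap <= eps -> zeta = eps / 100 -> 0 < eps ->
  s3 <= 1 / 64 + 2 * zeta + 2 * mu + 4 * (3 * mu + 2 * kap) ->
  s2 - ik - kap * s3 <= nu - kap * (1 - 3 * ik) * be + mu -> be <= 1 / 64 + eps.
Proof.
move=> h1 b0 b2 h4 k0 m0 mE nuh k1 k80 zE e0 h3 h.
have a1 : kap * (1 - 3 * ik) * be <= kap * (eps / 20) + kap * s3.
  have -> : kap * (eps / 20) = 5 * mu by rewrite mE; field.
  lra.
have a2 : (1 - 3 * ik) * be <= eps / 20 + s3.
  by rewrite -(ler_pM2l k0) mulrDr mulrA.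
have a3 : ik * be <= mu * 2.
  by apply: (@le_trans _ _ (mu * be)); [rewrite ler_wpM2r|rewrite ler_wpM2l // ltW].
have a4 : mu <= eps / 100 by rewrite mE ler_piMl // divr_ge0 ?(ltW e0).
have a5 : be = (1 - 3 * ik) * be + 3 * (ik * be) by ring.
have a6 : mu * 80 <= eps * (1 / 100) * eps.
  rewrite mE; have : 80 * kap * (eps / 100) <= eps * (eps / 100) by rewrite ler_wpM2r // divr_ge0 // ltW.
  have -> : kap * (eps / 100) * 80 = 80 * kap * (eps / 100) by ring.
  by have -> : eps * (1 / 100) * eps = eps * (eps / 100) by field.
rewrite zE in h3; move: h3 a2 a3 a4 a5 k80 e0; clear -mE.
set X := (1 - 3 * ik) * be; set Y := ik * be; lra.
Qed.

(** [X] is the slack that [gamma_bad] permits. [kap] is a quarter of it, so that the path term does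
    not spoil near-extremality. [mu], the size of all other errors, is [kap] times eps / 100 and so
    stays small after division by [kap]. Finally k > 1 / mu absorbs the diagonal. *)
Theorem nonedge_stability (R : realType) (eps : R) : 0 < eps <= 1 ->
  exists2 delta : R, 0 < delta & forall (V : finType) (E : bool -> rel V), (0 < #|V|)%N ->
  ramsey_graph E -> indep_lt E (delta * #|V|%:R) ->
  1 / 8 - eps <= nonedge_density R E /\
  (nonedge_density R E <= 1 / 8 + delta -> bad_density R E <= 1 / 64 + eps).
Proof.
move=> /andP[e0 e1]; pose zeta := eps / 100; pose X := (zeta ^+ 2 / 5) ^+ 2.
have z0 : 0 < zeta by rewrite divr_gt0.
have z1 : zeta <= 1 / 100 by rewrite /zeta; lra.
have X0 : 0 < X by rewrite exprn_gt0 // divr_gt0 // exprn_gt0.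
have XZ : X <= zeta / 50.
  have y1 : zeta ^+ 2 / 5 <= zeta / 5.
    by rewrite ler_pM2r ?invr_gt0 // expr2 ger_pMr //; lra.
  have y0 : 0 < zeta ^+ 2 / 5 by rewrite divr_gt0 // exprn_gt0.
  rewrite /X expr2; apply: (@le_trans _ _ (zeta / 5 * (1 / 10))); last by lra.
  by apply: ler_pM => //; try exact: ltW; lra.
pose kap := X / 4; pose mu := kap * (eps / 100).
have kap0 : 0 < kap by rewrite divr_gt0.
have mu0 : 0 < mu by rewrite mulr_gt0 // divr_gt0.
have kz : 80 * kap <= eps by rewrite /kap; move: XZ; rewrite /zeta; lra.
have kap1 : kap <= 1 / 80 by lra.
have mue : mu <= kap / 100.
  by rewrite /mu -(mulr1 (kap / 100)) -(mulrA kap) ler_wpM2l ?(ltW kap0) //; lra.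
pose k := (Num.truncn mu^-1).+1.
have k0 : (0 < k)%N by [].
have kmu : k%:R^-1 <= mu.
  rewrite -[leRHS]invrK lef_pV2 ?posrE ?invr_gt0 ?ltr0n //; apply: ltW; exact: truncnS_gt.
have mu4 : 0 < mu / 2 / 2 by rewrite !divr_gt0.
pose lam := (mu / 2 / 2) ^+ k / (k%:R + 2).
have k20 : 0 < k%:R + 2 :> R by rewrite ltr_wpDl ?ler0n.
have lam0 : 0 < lam by rewrite divr_gt0 // exprn_gt0.
have lamk : (k%:R + 1) * lam < (mu / 2 / 2) ^+ k.
  rewrite /lam mulrA ltr_pdivrMr // mulrC ltr_pM2l ?exprn_gt0 // ltrD2l; lra.
have lam1 : lam <= mu / 2 / 2.
  rewrite /lam ler_pdivrMr //; apply: (@le_trans _ _ (mu / 2 / 2 * 1)).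
    rewrite mulr1 -[leRHS]expr1 ler_wiXn2l //; lra.
  by rewrite ler_wpM2l ?(ltW mu4) //; have := ler0n R k; lra.
have lam2 : lam ^+ 2 <= mu / 2.
  apply: (@le_trans _ _ lam); last by lra.
  by rewrite expr2 ger_pMl //; lra.
have l20 : 0 < lam ^+ 2 by rewrite exprn_gt0.
have two0 : 0 < 2 :> R by [].
have [s s0 cyl] := @cylinder_regularity R k bool (lam ^+ 2) mu 2 l20 mu0 two0.
(* Every set of the tuple has at least s |V| vertices, so independent sets are smaller than
   [lam ^+ 2] times each of them. *)
pose delta := Num.min mu (lam ^+ 2 * s).
have d0 : 0 < delta by rewrite lt_min mu0 mulr_gt0.
exists delta => // V E V0 rg ind; have [Es Ei Ex nr nb] := rg.
have FB (x : {ffun 'I_k -> V}) : - 2 <= functional E kap x <= 2.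
  by have /andP[] := functional_bounds E k0 kap0 x; move: kap1; clear => h f0 f1; apply/andP; split; lra.
have [W [Ws Wavg Wreg]] := cyl V E (functional E kap) V0 FB.
have VR : 0 < #|V|%:R :> R by rewrite ltr0n.
have W0 i : W i != set0.
  by rewrite -card_gt0 -(@ltr0n R); apply: lt_le_trans (Ws i); rewrite mulr_gt0.
have Wm i : delta * #|V|%:R <= lam ^+ 2 * #|W i|%:R.
  apply: (@le_trans _ _ (lam ^+ 2 * s * #|V|%:R)); first by rewrite ler_wpM2r // ge_min lexx orbT.
  by rewrite -mulrA ler_wpM2l // ltW.
have mu1 : mu <= 1 by lra.
pose g := @cluster_graph R V E k W lam mu (delta * #|V|%:R) Es Ei nr nb ind mu0 mu1 lam0 lam2 lamk W0 Wm Wreg.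
pose D := cl_nonedge R E W : 'I_k -> 'I_k -> R.
pose Bd := cl_bad R E W : 'I_k -> 'I_k -> 'I_k -> R.
have Dw i j : pair_weight R g i j <= D i j + 2 * mu.
  rewrite /D; have [<-|ij] := eqVneq i j.
    by rewrite /pair_weight /cl_nonedge eqxx; lra.
  rewrite (cl_nonedge_dens R Ex W0 ij) cluster_wq // -(cl_nonedge_dens R Ex W0 ij).
  by have /andP[] := cl_nonedge01 R E W0 i j.
pose K : R := k%:R; have K0 : 0 < K by rewrite ltr0n.
pose s2 := K ^- 2 * (\sum_i \sum_j D i j); pose s3 := K ^- 3 * (\sum_i \sum_j \sum_l Bd i j l).
have Dge : 1 / 8 - 2 * mu <= s2.
  have := total_ge R g; rewrite card_ord -/K => h.
  have h2 : \sum_i \sum_j pair_weight R g i j <= \sum_i \sum_j (D i j + 2 * mu).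
    by apply: ler_sum => i _; apply: ler_sum => j _; apply: Dw.
  have h3 : \sum_i \sum_j (D i j + 2 * mu) = \sum_i \sum_j D i j + 2 * mu * K ^+ 2.
    under eq_bigr => i _ do rewrite big_split /= sumr_const card_ord.
    by rewrite big_split /= sumr_const card_ord -!mulrnA -[X in _ + X]mulr_natr natrM -expr2.
  rewrite /s2 [leRHS]mulrC ler_pdivlMr ?exprn_gt0 //.
  by move: h h2; rewrite h3; move: (\sum_i _) (\sum_i _) (K ^+ 2); clear => a c d; lra.
have Dn i j : 0 <= D i j by have /andP[] := cl_nonedge01 R E W0 i j.
have B1 i j l : Bd i j l <= 2 * D i j by have [] := cl_bad_bounds R E W0 i j l.
have B2 i j l : Bd i j l <= 2 * D j l by have [] := cl_bad_bounds R E W0 i j l.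
have B3 i j l : Bd i j l <= 2 - D i l by have [] := cl_bad_bounds R E W0 i j l.
have s32 : s3 <= 2.
  rewrite /s3 [leLHS]mulrC ler_pdivrMr ?exprn_gt0 //; apply: sum3_le => i j l.
  by have := B3 i j l; have := Dn i l; clear; lra.
have main : s2 - K^-1 - kap * s3 <= nonedge_density R E - kap * (1 - 3 * K^-1) * bad_density R E + mu.
  have := avg_functional_full E V0 k0 kap0; have := avg_functional_clusters E kap k0 W.
  rewrite -/K -/D -/Bd -/s2 -/s3 => <-; move: Wavg; set a := avg W _; set b := avg _ _.
  by clear; lra.
have /andP[be0 be2] := bad_density_bounds R E V0.
have bound : s2 <= nonedge_density R E + 2 * kap + 2 * mu.
  by apply: (nonedge_bound_arith Dge s32 be0 kmu _ kap0 main); move: mue kap1; clear; lra.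
split; first by move: bound Dge mue kap0 kz; clear; lra.
move=> nle; have nle' : nonedge_density R E <= 1 / 8 + mu.
  by apply: le_trans nle _; rewrite lerD2l ge_min lexx.
apply: (bad_bound_arith Dge be0 be2 kmu kap0 mu0 erefl nle' _ kz erefl e0 _ main); first by move: kap1; clear; lra.
have k00 : 0 <= 3 * mu + 2 * kap by have := mu0; have := kap0; clear; lra.
have etak : (3 * mu + 2 * kap) + 2 * mu <= X.
  by move: mue X0; rewrite /kap; clear; lra.
have Dsum : \sum_i \sum_j D i j <= (1 / 8 + (3 * mu + 2 * kap)) * #|'I_k|%:R ^+ 2.
  rewrite card_ord -/K -ler_pdivrMr ?exprn_gt0 // [leLHS]mulrC -/s2; move: bound nle'; clear; lra.
have T0 : 0 < #|'I_k|%:R :> R by rewrite card_ord.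
have := gamma_bad T0 z0 z1 (ltW mu0) k00 etak Dn Dw Dsum B1 B2 B3.
by rewrite card_ord -/K /s3 [X in _ -> X <= _]mulrC ler_pdivrMr ?exprn_gt0.
Qed.

(** * Near-partitions *)

Lemma markov_card (R : realType) (V : finType) (f : V -> R) t c : (forall v, 0 <= f v) ->
  \sum_v f v <= c -> t * #|[set v | t < f v]|%:R <= c.
Proof.
move=> f0; apply: le_trans; set B := [set v | _].
apply: (@le_trans _ _ (\sum_(v in B) f v)); last first.
  by rewrite [leRHS](bigID (mem B)) /= lerDl sumr_ge0.
rewrite mulr_natr -sumr_const; apply: ler_sum => v; rewrite inE => /ltW //.
Qed.

Section NearPartition.
Variables (R : realType) (V : finType) (N : rel V) (rho : R).
Hypotheses (Nsym : symmetric N) (V0 : (0 < #|V|)%N).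
Hypotheses (rho0 : 0 < rho) (rho1 : rho <= 1 / 100).
Let n : R := #|V|%:R.
Let b u v : R := (N u v)%:R.
Let tau := rho ^+ 2.

Definition ndeg v : R := \sum_u b v u.
Definition npath v : R := \sum_u \sum_w b v u * b v w * (1 - b u w).
(** The paths of [npath] seen from an end rather than from the middle. *)
Definition nleave v : R := \sum_u \sum_w b v u * b u w * (1 - b v w).
Definition noverlap v w : R := \sum_u b v u * b w u.

Hypothesis deg_var : \sum_v (ndeg v - n / 8) ^+ 2 <= rho * tau ^+ 2 / 3 * n ^+ 3.
Hypothesis few_paths : \sum_v npath v <= rho * tau ^+ 2 / 3 * n ^+ 3.

Let n0 : 0 < n. Proof. by rewrite ltr0n. Qed.
Let b01 u v : 0 <= b u v <= 1. Proof. by rewrite ler0n lern1 leq_b1. Qed.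
Let b0 u v : 0 <= b u v. Proof. by rewrite ler0n. Qed.
Let b1 u v : 0 <= 1 - b u v. Proof. by rewrite subr_ge0; have /andP[] := b01 u v. Qed.
Let bs u v : b u v = b v u. Proof. by rewrite /b Nsym. Qed.
Let tau0 : 0 < tau. Proof. by rewrite exprn_gt0. Qed.
Let tau1 : tau <= rho / 100.
Proof. by rewrite /tau expr2 ler_wpM2l ?(ltW rho0) //; have := rho1; lra. Qed.

Lemma sum_nleave : \sum_v nleave v = \sum_v npath v.
Proof.
rewrite /nleave /npath exchange_big; apply: eq_bigr => v _; apply: eq_bigr => u _.
by apply: eq_bigr => w _; rewrite (bs u v).
Qed.

Definition typical v := [&& (ndeg v - n / 8) ^+ 2 <= tau ^+ 2 * n ^+ 2, npath v <= tau * n ^+ 2 &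
  nleave v <= tau * n ^+ 2].

Lemma few_atypical : #|[set v | ~~ typical v]|%:R <= rho * n.
Proof.
have t1 : tau <= 1 by have := rho1; have := tau1; lra.
have p0 v : 0 <= npath v.
  by apply: sumr_ge0 => u _; apply: sumr_ge0 => w _; rewrite !mulr_ge0.
have q0 v : 0 <= nleave v.
  by apply: sumr_ge0 => u _; apply: sumr_ge0 => w _; rewrite !mulr_ge0.
pose c := rho * tau ^+ 2 / 3 * n ^+ 3.
have cut (f : V -> R) t : (forall v, 0 <= f v) -> \sum_v f v <= c -> tau ^+ 2 <= t ->
    #|[set v | t * n ^+ 2 < f v]|%:R <= rho / 3 * n.
  move=> f0 fc tt; have h := markov_card (t * n ^+ 2) f0 fc; have t0 : 0 < tau ^+ 2 by rewrite exprn_gt0.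
  rewrite -(ler_pM2l (_ : 0 < tau ^+ 2 * n ^+ 2)); last by rewrite mulr_gt0 ?exprn_gt0.
  have -> : tau ^+ 2 * n ^+ 2 * (rho / 3 * n) = c by rewrite /c; field.
  by apply: le_trans h; rewrite ler_wpM2r // ler_wpM2r ?exprn_ge0 // ltW.
have t2 : tau ^+ 2 <= tau by rewrite expr2 ger_pMl.
have h1 := cut (fun v => (ndeg v - n / 8) ^+ 2) (tau ^+ 2) (fun v => sqr_ge0 _) deg_var (lexx _).
have h2 := cut npath tau p0 few_paths t2.
have h3 := cut nleave tau q0 _ t2; rewrite sum_nleave in h3; have {}h3 := h3 few_paths.
set A1 := [set v | _] in h1; set A2 := [set v | _] in h2; set A3 := [set v | _] in h3.
have : (#|[set v | ~~ typical v]| <= #|A1| + #|A2| + #|A3|)%N.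
  apply: (@leq_trans #|A1 :|: A2 :|: A3|); last first.
    by apply: leq_trans (leq_card_setU _ _).1 _; rewrite leq_add2r (leq_card_setU _ _).1.
  apply/subset_leq_card/subsetP => v; rewrite !inE /typical !negb_and -!ltNge.
  by case/or3P => ->; rewrite ?orbT.
by rewrite -(ler_nat R) !natrD; lra.
Qed.

Lemma typical_deg v : typical v -> (1 / 8 - tau) * n <= ndeg v <= (1 / 8 + tau) * n.
Proof.
move=> /and3P[h _ _].
have : `|ndeg v - n / 8| <= `|tau * n|.
  by rewrite -ler_sqr ?nnegrE // !real_normK ?num_real // exprMn.
rewrite (ger0_norm (mulr_ge0 (ltW tau0) (ltW n0))) ler_norml => /andP[h1 h2].
by apply/andP; split; lra.
Qed.

Lemma card_nbr_ndeg v : #|[set u | N v u]|%:R = ndeg v.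
Proof.
rewrite /ndeg -natr_sum; congr _%:R; rewrite -sum1_card big_mkcond; apply: eq_bigr => u _.
by rewrite inE /b; case: (N v u).
Qed.

(** A vertex not related to [v] with overlap above rho n ends that many paths leaving [v]. There are
    at most tau n^2 such paths, so with tau = rho^2 at most rho n such vertices; the others are
    related to [v]. *)
Lemma few_overlapping v : typical v ->
  #|[set w | rho * n < noverlap v w]|%:R <= (1 / 8 + tau + rho) * n.
Proof.
move=> tv; have /andP[_ d] := typical_deg tv; have /and3P[_ _ q] := tv.
pose f w := (1 - b v w) * noverlap v w.
have f0 w : 0 <= f w by rewrite mulr_ge0 //; apply: sumr_ge0 => u _; rewrite mulr_ge0.
have fq : \sum_w f w <= tau * n ^+ 2.
  apply: le_trans q; rewrite /nleave exchange_big; apply: ler_sum => w _.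
  by rewrite /f mulr_sumr; apply: ler_sum => u _; rewrite (bs w u) mulrC lexx.
have h := markov_card (rho * n) f0 fq; set A := [set w | _] in h.
have hA : #|A|%:R <= rho * n.
  rewrite -(ler_pM2l (mulr_gt0 rho0 n0)); apply: le_trans h _.
  by rewrite /tau; have -> : rho ^+ 2 * n ^+ 2 = rho * n * (rho * n) by ring.
have : (#|[set w | (rho * n < noverlap v w)%R]| <= #|[set u | N v u]| + #|A|)%N.
  apply: leq_trans (leq_card_setU _ _).1; apply/subset_leq_card/subsetP => w; rewrite !inE /f /b.
  by case: (N v w) => //=; rewrite subr0 mul1r.
rewrite -(ler_nat R) natrD card_nbr_ndeg; lra.
Qed.

Lemma noverlap_sym v w : noverlap v w = noverlap w v.
Proof. by apply: eq_bigr => u _; rewrite mulrC. Qed.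

(** Greedy choice: each chosen vertex spoils about n/8 candidates, so seven of them leave nearly
    n/8, more than the number of atypical vertices. *)
Lemma select m : (m <= 8)%N -> exists s : seq V,
  [/\ size s = m, all typical s & pairwise (fun v w => (noverlap v w <= rho * n)%R) s].
Proof.
elim: m => [|m IH] m8; first by exists [::].
have [s [sm st sp]] := IH (ltnW m8).
pose Ex v := [set w | rho * n < noverlap v w].
pose U := \bigcup_(v <- s) Ex v.
have hU : #|U|%:R <= m%:R * ((1 / 8 + tau + rho) * n).
  rewrite /U -sm; elim: s st {sm sp U} => [_|v s IHs /= /andP[tv ts]].
    by rewrite big_nil cards0 mul0r.
  rewrite big_cons; apply: (@le_trans _ _ (#|Ex v|%:R + #|\bigcup_(v <- s) Ex v|%:R)).
    by rewrite -natrD ler_nat (leq_card_setU _ _).1.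
  have := few_overlapping tv; have := IHs ts; rewrite -/(Ex v) -natr1 => h1 h2.
  by rewrite mulrDl mul1r; lra.
have [w wU] : exists w, w \notin U :|: [set v | ~~ typical v].
  apply/existsP; rewrite -negb_forall; apply/negP => /forallP all_in.
  have : n <= #|U|%:R + rho * n.
    apply: (@le_trans _ _ (#|U|%:R + #|[set v | ~~ typical v]|%:R)); last by rewrite lerD2l few_atypical.
    rewrite -natrD ler_nat; apply: leq_trans (leq_card_setU _ _).1.
    by apply/subset_leq_card/subsetP => v _; apply: all_in.
  have m7 : m%:R <= 7 :> R by rewrite (ler_nat R m 7).
  have h1 : m%:R * ((1 / 8 + tau + rho) * n) <= 7 * ((1 / 8 + tau + rho) * n).
    rewrite ler_wpM2r // mulr_ge0 ?(ltW n0) //; have := tau0; have := rho0; lra.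
  have h2 : (7 * (1 / 8 + tau + rho) + rho) * n < 1 * n.
    by rewrite ltr_pM2r //; have := tau1; have := rho1; lra.
  by move: hU h1 h2; rewrite mulrDl mul1r; lra.
move: wU; rewrite !inE negb_or negbK => /andP[wU tw].
exists (w :: s); rewrite /= sm tw st sp; split => //.
rewrite andbT; apply/allP => v vs; rewrite noverlap_sym leNgt; apply: contra wU => h.
by rewrite /U bigcup_seq; apply/bigcupP; exists v; rewrite ?inE.
Qed.

Lemma near_partition : exists f : V -> 'I_8,
  (forall i, #|[set v | f v == i]|%:R <= (1 / 8 + 58 * rho) * n) /\
  \sum_u \sum_v (N u v != (f u == f v))%:R <= 171 * rho * n ^+ 2.
Proof.
have [s [s8 st sp]] := @select 8 (leqnn _).
have /card_gt0P[x0 _] := V0.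
pose v (i : 'I_8) := nth x0 s i.
have vt i : typical (v i) by apply: (allP st); rewrite mem_nth // s8.
have vo i j : i != j -> noverlap (v i) (v j) <= rho * n.
  move=> ij; wlog lt_ij : i j ij / (i < j)%N.
    move=> wl; have [/wl|/wl|/val_inj e] := ltngtP i j; first exact.
      by rewrite noverlap_sym; apply; rewrite eq_sym.
    by rewrite e eqxx in ij.
  by apply: (pairwiseP x0 sp) => //; rewrite inE s8.
(* Vertices related to none of the eight get class 0 by default. They form [U], which is small:
   eight sets of size nearly n/8 with small overlaps almost cover everything. *)
pose f u := odflt ord0 [pick i | N (v i) u].
pose x i u := b (v i) u.
pose U := [set u | [forall i, ~~ N (v i) u]].
pose z u : R := (u \in U)%:R.
have fP u : u \notin U -> N (v (f u)) u.
  rewrite inE negb_forall => /existsP[i]; rewrite negbK /f; case: pickP => //= h.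
  by rewrite h.
pose ov u := \sum_i \sum_(j | j != i) x i u * x j u.
have ov0 u : 0 <= ov u by apply: sumr_ge0 => i _; apply: sumr_ge0 => j _; rewrite mulr_ge0.
have sum_ov : \sum_u ov u <= 56 * rho * n.
  rewrite /ov exchange_big; apply: (@le_trans _ _ (\sum_(i < 8) (7 * rho * n))).
    apply: ler_sum => i _; rewrite exchange_big.
    apply: (@le_trans _ _ (\sum_(j < 8 | j != i) (rho * n))).
      by apply: ler_sum => j ji; apply: vo; rewrite eq_sym.
    rewrite sumr_const (_ : #|_| = 7%N); last first.
      by apply: etrans (cardC1 i) _; rewrite card_ord.
    by rewrite -[leLHS]mulr_natl mulrA.
  by rewrite sumr_const card_ord -[leLHS]mulr_natl; lra.
have cover u : \sum_i x i u <= 1 - z u + ov u.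
  rewrite /z; have [uU|uU] := boolP (u \in U).
    rewrite big1 ?subrr ?add0r // => i _; move: uU; rewrite inE => /forallP/(_ i).
    by rewrite /x /b => /negbTE->.
  rewrite subr0 (bigD1 (f u)) //=; apply: lerD; first by have /andP[] := b01 (v (f u)) u.
  rewrite /ov [leRHS](bigD1 (f u)) //=; apply: ler_wpDr.
    by apply: sumr_ge0 => i _; apply: sumr_ge0 => j _; rewrite mulr_ge0.
  by apply: ler_sum => j _; rewrite /x {2}/b fP // mul1r.
have sum_z : \sum_u z u = #|U|%:R.
  rewrite /z -natr_sum; congr _%:R; rewrite -sum1_card [RHS]big_mkcond; apply: eq_bigr => u _.
  by case: (u \in U).
have hU : #|U|%:R <= 57 * rho * n.
  have : \sum_u \sum_i x i u <= \sum_u (1 - z u + ov u) by apply: ler_sum => u _; apply: cover.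
  rewrite big_split sumrB /= sumr_const -/n sum_z exchange_big /= => h.
  have : \sum_(i < 8) (1 / 8 - tau) * n <= \sum_(i < 8) \sum_u x i u.
    by apply: ler_sum => i _; have /andP[] := typical_deg (vt i).
  rewrite sumr_const card_ord -[leLHS]mulr_natl => h'.
  have e : 8 * ((1 / 8 - tau) * n) = n - 8 * (tau * n) by field.
  have t2 : tau * n <= rho / 100 * n by rewrite ler_wpM2r // ltW.
  have r0 : 0 <= rho * n by rewrite mulr_ge0 // ltW.
  by move: h h' sum_ov t2 r0; rewrite e; lra.
exists f; split=> [i|].
  have : (#|[set w | f w == i]| <= #|[set u | N (v i) u]| + #|U|)%N.
    apply: leq_trans (leq_card_setU _ _).1; apply/subset_leq_card/subsetP => w; rewrite inE => /eqP <-.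
    by rewrite in_setU; case: (boolP (w \in U)) => [_|/fP h]; rewrite ?orbT // inE h.
  rewrite -(ler_nat R) natrD card_nbr_ndeg; have /andP[_] := typical_deg (vt i).
  have t2 : tau * n <= rho / 100 * n by rewrite ler_wpM2r // ltW.
  have r0 : 0 <= rho * n by rewrite mulr_ge0 // ltW.
  lra.
(* A misjudged pair fails transitivity inside a neighbourhood, meets [U], leaves a neighbourhood, or
   has [w] in two neighbourhoods. Summed up, this costs 57 + 57 + 56 times rho n^2 plus 16 tau
   n^2. *)
have pw u w : (N u w != (f u == f w))%:R <= \sum_i x i u * x i w * (1 - b u w) + z u + z w +
    \sum_i x i u * b u w * (1 - x i w) + ov w.
  have s1 i : 0 <= x i u * x i w * (1 - b u w) by rewrite !mulr_ge0.
  have s2 i : 0 <= x i u * b u w * (1 - x i w) by apply: mulr_ge0; [rewrite mulr_ge0|apply: b1].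
  have S1 : 0 <= \sum_i x i u * x i w * (1 - b u w) by apply: sumr_ge0 => i _.
  have S2 : 0 <= \sum_i x i u * b u w * (1 - x i w) by apply: sumr_ge0 => i _.
  have z0 y : 0 <= z y by rewrite ler0n.
  have [uU|uU] := boolP (u \in U).
    have : z u = 1 by rewrite /z uU.
    have := z0 w; have := ov0 w; case: (_ != _) => /=; lra.
  have [wU|wU] := boolP (w \in U).
    have : z w = 1 by rewrite /z wU.
    have := z0 u; have := ov0 w; case: (_ != _) => /=; lra.
  have xu : x (f u) u = 1 by rewrite /x /b fP.
  have xw : x (f w) w = 1 by rewrite /x /b fP.
  have [Nuw|Nuw] := boolP (N u w); have [fuw|fuw] := eqVneq (f u) (f w) => /=;
    have zu := z0 u; have zw := z0 w; have ow := ov0 w; try lra.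
    have [xfw|xfw] := boolP (N (v (f u)) w).
      have : 1 <= ov w.
        rewrite /ov (bigD1 (f u)) //= (bigD1 (f w)) /=; last by rewrite eq_sym.
        rewrite {1}/x /b xfw xw mulr1 -addrA lerDl addr_ge0 //.
          by apply: sumr_ge0 => j _; rewrite mulr_ge0.
        by apply: sumr_ge0 => i _; apply: sumr_ge0 => j _; rewrite mulr_ge0.
      lra.
    have : 1 <= \sum_i x i u * b u w * (1 - x i w).
      rewrite (bigD1 (f u)) //= -[leLHS]addr0; apply: lerD; last by apply: sumr_ge0 => i _; apply: s2.
      by rewrite xu /x /b Nuw (negbTE xfw) subr0 !mulr1.
    lra.
  have : 1 <= \sum_i x i u * x i w * (1 - b u w).
    rewrite (bigD1 (f u)) //= -[leLHS]addr0; apply: lerD; last by apply: sumr_ge0 => i _; apply: s1.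
    by rewrite xu fuw xw /b (negbTE Nuw) subr0 !mulr1.
  lra.
have npathE i : \sum_u \sum_w x i u * x i w * (1 - b u w) = npath (v i) by [].
have nleaveE i : \sum_u \sum_w x i u * b u w * (1 - x i w) = nleave (v i) by [].
have cst (c : R) : \sum_(u : V) c = n * c by rewrite sumr_const [RHS]mulr_natl.
have t2 : tau * n ^+ 2 <= rho / 100 * n ^+ 2 by rewrite ler_wpM2r // exprn_ge0 // ltW.
have r0 : 0 <= rho * n ^+ 2 by rewrite mulr_ge0 ?exprn_ge0 // ltW.
have cst8 (c : R) : \sum_(i < 8) c = 8 * c by rewrite sumr_const card_ord [RHS]mulr_natl.
have B1 : \sum_i npath (v i) <= 8 * (tau * n ^+ 2).
  by rewrite -cst8; apply: ler_sum => i _; have /and3P[] := vt i.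
have B2 : \sum_i nleave (v i) <= 8 * (tau * n ^+ 2).
  by rewrite -cst8; apply: ler_sum => i _; have /and3P[] := vt i.
have B3 : n * #|U|%:R <= 57 * rho * n ^+ 2.
  by have := ler_wpM2l (ltW n0) hU; have -> : n * (57 * rho * n) = 57 * rho * n ^+ 2 by ring.
have B4 : n * \sum_u ov u <= 56 * rho * n ^+ 2.
  by have := ler_wpM2l (ltW n0) sum_ov; have -> : n * (56 * rho * n) = 56 * rho * n ^+ 2 by ring.
have tot : \sum_u \sum_w (N u w != (f u == f w))%:R <=
    \sum_i npath (v i) + n * #|U|%:R + n * #|U|%:R + \sum_i nleave (v i) + n * \sum_u ov u.
  apply: (@le_trans _ _ (\sum_u \sum_w (\sum_i x i u * x i w * (1 - b u w) + z u + z w +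
    \sum_i x i u * b u w * (1 - x i w) + ov w))).
    by apply: ler_sum => u _; apply: ler_sum => w _; apply: pw.
  under eq_bigr => u _ do rewrite !big_split /=.
  rewrite !big_split /= -sum_z.
  have -> : \sum_u \sum_w \sum_i x i u * x i w * (1 - b u w) = \sum_i npath (v i).
    under eq_bigr => u _ do rewrite exchange_big.
    by rewrite exchange_big.
  have -> : \sum_u \sum_w \sum_i x i u * b u w * (1 - x i w) = \sum_i nleave (v i).
    under eq_bigr => u _ do rewrite exchange_big.
    by rewrite exchange_big.
  rewrite !cst; under [X in _ + X + _ + _ + _ <= _]eq_bigr => u _ do rewrite cst.
  by rewrite -mulr_sumr.
lra.
Qed.

End NearPartition.

(** * Edit distance *)

Section Matching.
Variables (V I : finType) (f g : V -> I).

Let agree (s : {perm V}) := [set v | f v == g (s v)].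

Lemma agree_swap (s : {perm V}) v w : f v != g (s v) -> g (s w) = f v -> f w != f v ->
  (#|agree s| < #|agree (tperm v w * s)%g|)%N.
Proof.
move=> fv gw fw; apply/proper_card/properP; split.
  apply/subsetP => u; rewrite !inE => fu; rewrite permM tpermD //.
    by apply: contraNneq fv => ->.
  by apply: contraNneq fw => e; rewrite -gw e.
by exists v; rewrite !inE ?permM ?tpermL ?gw.
Qed.

(** Take [s] with the most agreements. If class i of [f] contains a mismatch, every vertex sent into
    class i of [g] lies in class i of [f], for otherwise a swap would gain; the mismatches there are
    then exactly the excess. *)
Lemma exists_matching : exists s : {perm V},
  (#|[set v | f v != g (s v)]| <= \sum_i (#|[set v | f v == i]| - #|[set v | g v == i]|))%N.
Proof.
case: (@arg_maxnP _ (1%g : {perm V}) xpredT (fun s => #|agree s|) isT) => s _ smax; exists s.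
have fib i : #|[set v | g v == i]| = #|[set v | g (s v) == i]|.
  rewrite -[RHS](card_imset _ (@perm_inj _ s)); apply: eq_card => v; rewrite inE.
  apply/idP/imsetP => [gv|[w]]; last by rewrite inE => h ->.
  by exists ((s^-1)%g v); rewrite ?inE permKV.
rewrite -sum1_card (partition_big f xpredT) //=; apply: leq_sum => i _; rewrite sum1dep_card fib.
have [->|/set0Pn[v]] := eqVneq [set v | (v \in [set v | f v != g (s v)]) && (f v == i)] set0.
  by rewrite cards0.
rewrite !inE => /andP[fv /eqP fi].
have sub : [set w | g (s w) == i] \subset [set w | f w == i].
  apply/subsetP => w; rewrite !inE => /eqP gw; apply/negPn/negP => fw.
  have := agree_swap fv (etrans gw (esym fi)); rewrite fi => /(_ fw).
  by apply/negP; rewrite -leqNgt; exact: (smax _ isT).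
rewrite -(cardsDS sub); apply/subset_leq_card/subsetP => w; rewrite !inE => /andP[fw /eqP <-].
by rewrite eqxx andbT eq_sym.
Qed.

End Matching.

Section DensityStability.
Variables (R : realType) (V : finType) (E : bool -> rel V) (eps : R).
Hypotheses (Esym : forall c, symmetric (E c)) (V0 : (0 < #|V|)%N) (eps0 : 0 <= eps).
Hypothesis nu_ge : 1 / 8 - eps <= nonedge_density R E.
Hypothesis bad_le : bad_density R E <= 1 / 64 + eps.

Definition nonadj : rel V := fun u v => ~~ (E true u v || E false u v).
Let n : R := #|V|%:R.
Let n0 : 0 < n. Proof. by rewrite ltr0n. Qed.

(** Both terms on the left are nonnegative, and together they are the path sum with the square
    completed at n/8; so both are small at once. *)
Lemma variance_paths :
  \sum_v (ndeg R nonadj v - n / 8) ^+ 2 + \sum_v npath R nonadj v <= 2 * eps * n ^+ 3.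
Proof.
pose S := \sum_u \sum_v nonedge R E u v; pose B := \sum_u \sum_v \sum_w bad3 R E u v w.
have hS : (1 / 8 - eps) * n ^+ 2 <= S.
  by move: nu_ge; rewrite /nonedge_density -/n -/S ler_pdivlMr ?exprn_gt0.
have hB : B <= (1 / 64 + eps) * n ^+ 3.
  by move: bad_le; rewrite /bad_density -/n -/B ler_pdivrMr ?exprn_gt0.
have sym u v : nonedge R E u v = nonedge R E v u.
  by rewrite /nonedge (Esym true u v) (Esym false u v).
have BE : B = \sum_v (ndeg R nonadj v ^+ 2 + npath R nonadj v).
  rewrite /B exchange_big; apply: eq_bigr => v _ /=.
  rewrite expr2 {1}/ndeg mulr_suml /npath -big_split; apply: eq_bigr => u _ /=.
  rewrite /ndeg mulr_sumr -big_split; apply: eq_bigr => w _ /=.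
  rewrite /bad3 (sym u v) /nonedge -/(nonadj v u) -/(nonadj v w) -/(nonadj u w); ring.
have SE : S = \sum_v ndeg R nonadj v by [].
have -> : \sum_v (ndeg R nonadj v - n / 8) ^+ 2 + \sum_v npath R nonadj v = B - n / 4 * S + n ^+ 3 / 64.
  rewrite BE SE mulr_sumr.
  have -> : n ^+ 3 / 64 = \sum_(v : V) (n ^+ 2 / 64).
    by rewrite sumr_const -[RHS]mulr_natr -/n; ring.
  by rewrite -sumrB -!big_split; apply: eq_bigr => v _ /=; field.
have hS2 := ler_wpM2l (ltW n0) hS.
have e1 : n * ((1 / 8 - eps) * n ^+ 2) = (1 / 8 - eps) * n ^+ 3 by ring.
rewrite e1 in hS2.
have e0 : 0 <= eps * n ^+ 3 by rewrite mulr_ge0 ?exprn_ge0 // ltW.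
have : n / 4 * S = (n * S) / 4 by ring.
by move: hB hS2 e0; lra.
Qed.

End DensityStability.

(** * Edge sets as coloured graphs *)

Section GraphDensity.
Variables (n : nat) (G : {set {set 'I_n}}).
Hypothesis graphG : is_graph G.

Lemma edge_card e : e \in G -> #|e| = 2%N.
Proof. by move=> eG; apply/eqP; move/forall_inP: graphG; apply. Qed.

Lemma adj_sym u v : adj G u v = adj G v u.
Proof. by rewrite /adj setUC. Qed.

Lemma adj_irr u : adj G u u = false.
Proof. by apply/negP => /edge_card; rewrite setUid cards1. Qed.

Lemma card_pairs (e : {set 'I_n}) : #|e| = 2%N -> #|[set p : 'I_n * 'I_n | [set p.1; p.2] == e]| = 2%N.
Proof.
move=> /eqP/cards2P[a [b [ab ->]]].
have -> : [set p : 'I_n * 'I_n | [set p.1; p.2] == [set a; b]] = [set (a, b); (b, a)].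
  apply/setP => -[u v]; rewrite !inE !xpair_eqE /=; apply/eqP/idP => [h|].
    have [ua va] : u \in [set a; b] /\ v \in [set a; b] by rewrite -h !inE !eqxx orbT.
    have [au bu] : a \in [set u; v] /\ b \in [set u; v] by rewrite h !inE !eqxx orbT.
    move: ua va au bu; rewrite !inE.
    move=> /orP[]/eqP-> /orP[]/eqP->; rewrite ?eqxx ?orbT //= ?orbb; first by rewrite [b == a]eq_sym (negbTE ab).
    by move=> /eqP e'; rewrite e' eqxx in ab.
  by case/orP=> /andP[/eqP-> /eqP->] //; rewrite setUC.
by rewrite cards2 xpair_eqE negb_and ab.
Qed.

Lemma card_adj : #|[set p : 'I_n * 'I_n | adj G p.1 p.2]| = (2 * nedges G)%N.
Proof.
rewrite -sum1_card (partition_big (fun p => [set p.1; p.2]) (mem G)) /=; last by move=> p; rewrite inE.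
rewrite (eq_bigr (fun=> 2%N)); first by rewrite sum_nat_const mulnC.
move=> e eG; rewrite sum1dep_card -(card_pairs (edge_card eG)); apply: eq_card => p.
by rewrite !inE /adj; case: eqP => [->|]; rewrite ?eG ?andbF.
Qed.

Lemma KpKq_free_ramsey : KpKq_free G 3 7 -> exists2 E : bool -> rel 'I_n, ramsey_graph E &
  forall u v, E true u v || E false u v = adj G u v.
Proof.
move=> /existsP[c /andP[/existsPn c3 /existsPn c7]].
exists (fun b u v => adj G u v && (c [set u; v] == b)); last first.
  by move=> u v; rewrite -andb_orr; case: (c _); rewrite andbT.
have mono b k (Q : {set 'I_n}) : clique (fun u v => adj G u v && (c [set u; v] == b)) Q ->
    (k <= #|Q|)%N -> exists S, mono_clique G c b k S.
  move=> cQ /sub_card_eq[S SQ Sk]; exists S; rewrite /mono_clique Sk eqxx /=.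
  apply/forall_inP => x xS; apply/forall_inP => y yS; apply/implyP => xy.
  by apply: cQ => //; apply: (subsetP SQ).
split.
- by move=> b u v; rewrite adj_sym setUC.
- by move=> b u; rewrite adj_irr.
- by move=> u v /andP[_ /eqP->]; rewrite andbF.
- move=> Q cQ; rewrite leqNgt; apply/negP => /(mono _ _ _ cQ)[S hS]; by have := c3 S; rewrite hS.
- move=> Q cQ; rewrite leqNgt; apply/negP => /(mono _ _ _ cQ)[S hS]; by have := c7 S; rewrite hS.
Qed.

Lemma indep_alpha (R : realType) (E : bool -> rel 'I_n) (m : R) :
  (forall u v, E true u v || E false u v = adj G u v) -> (alpha G)%:R < m -> indep_lt E m.
Proof.
move=> EG am I hI; apply: le_lt_trans am; rewrite ler_nat /alpha.
apply: (@leq_bigmax_cond _ (fun S => independent G S) (fun S : {set 'I_n} => #|S|)).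
apply/forall_inP => x xI; apply/forall_inP => y yI; apply/implyP => _.
by rewrite -EG negb_or hI.
Qed.

(** The diagonal counts as non-adjacent, so the identity is exact, without a term of order 1/n. *)
Lemma nonedge_density_nedges (R : realType) (E : bool -> rel 'I_n) : (0 < n)%N ->
  (forall u v, E true u v || E false u v = adj G u v) ->
  nonedge_density R E = 1 - 2 * (nedges G)%:R / n%:R ^+ 2.
Proof.
move=> n0 EG; rewrite /nonedge_density card_ord.
have -> : \sum_u \sum_v nonedge R E u v = n%:R ^+ 2 - 2 * (nedges G)%:R.
  have -> : 2 * (nedges G)%:R = \sum_u \sum_v (adj G u v)%:R :> R.
    rewrite -natrM -card_adj pair_big /= -natr_sum -sum1_card; congr _%:R.
    by rewrite big_mkcond; apply: eq_bigr => p _; rewrite inE; case: (adj _ _ _).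
  have -> : n%:R ^+ 2 = \sum_(u < n) \sum_(v < n) 1 :> R.
    by rewrite !sumr_const card_ord -mulrnA natrM expr2.
  rewrite -sumrB; apply: eq_bigr => u _; rewrite -sumrB; apply: eq_bigr => v _.
  by rewrite /nonedge EG; case: (adj _ _ _); rewrite ?subrr ?subr0.
by rewrite mulrBl divff // expf_neq0 // pnatr_eq0 -lt0n.
Qed.

End GraphDensity.

Lemma bigmin_leq (I : eqType) (r : seq I) (P : pred I) (F : I -> nat) x0 i : i \in r -> P i ->
  (\big[minn/x0]_(j <- r | P j) F j <= F i)%N.
Proof.
elim: r => // j r IH; rewrite in_cons big_cons => /orP[/eqP<- ->|ir Pi]; first exact: geq_minl.
by case: ifP => _; rewrite ?geq_min IH ?orbT.
Qed.

Lemma mem_relabel n (s : {perm 'I_n}) (Z : {set {set 'I_n}}) u v :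
  adj (relabel (s^-1)%g Z) u v = adj Z (s u) (s v).
Proof.
have im a b : (s^-1)%g @: [set s a; s b] = [set a; b] by rewrite imsetU !imset_set1 !permK.
apply/imsetP/idP => [[e eZ h]|h]; last by exists [set s u; s v]; rewrite ?im.
rewrite /adj; suff -> : [set s u; s v] = e by [].
by apply: (imset_inj (@perm_inj _ (s^-1)%g)); rewrite im.
Qed.

Lemma Delta_le n (S Z : {set {set 'I_n}}) (s : {perm 'I_n}) : is_graph S -> is_graph Z ->
  (Delta S Z <= #|[set p : 'I_n * 'I_n | adj S p.1 p.2 != adj Z (s p.1) (s p.2)]|)%N.
Proof.
move=> gS gZ; set T := relabel (s^-1)%g Z.
have gT : is_graph T.
  apply/forall_inP => e /imsetP[e' e'Z ->]; rewrite card_imset; last exact: perm_inj.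
  by rewrite (edge_card gZ).
have hT : is_graph T && isomorphic T Z.
  by rewrite gT; apply/existsP; exists (s^-1)%g.
apply: leq_trans (@bigmin_leq _ (index_enum _) (fun T' => is_graph T' && isomorphic T' Z)
  (fun T' => #|(S :\: T') :|: (T' :\: S)|) (#|S| + #|Z|)%N T (mem_index_enum _) hT) _.
set P := [set p | _].
apply: (@leq_trans #|(fun p : 'I_n * 'I_n => [set p.1; p.2]) @: P|); last exact: leq_imset_card.
apply/subset_leq_card/subsetP => e he.
have e2 : #|e| = 2%N.
  by move: he; rewrite !inE => /orP[/andP[_ /(edge_card gS)]|/andP[_ /(edge_card gT)]].
move/eqP/cards2P: e2 => [a [b [ab eab]]]; apply/imsetP; exists (a, b); rewrite ?inE //=.
move: he; rewrite -mem_relabel -/T /adj -eab !inE.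
by case: (e \in S); case: (e \in T).
Qed.

Section Stability.
Variable R : realType.

Lemma edge_bound (eps : R) : 0 < eps <= 1 -> exists2 delta : R, 0 < delta &
  forall n (G : {set {set 'I_n}}), (0 < n)%N -> is_graph G -> KpKq_free G 3 7 ->
  (alpha G)%:R < delta * n%:R -> (nedges G)%:R <= (7 / 16 + eps) * n%:R ^+ 2.
Proof.
move=> e01; have [delta d0 h] := nonedge_stability e01; exists delta => // n G n0 gG fG aG.
have [E rE EG] := KpKq_free_ramsey gG fG.
have := h _ E; rewrite card_ord => /(_ n0 rE (indep_alpha EG aG))[] + _.
rewrite (nonedge_density_nedges gG R n0 EG) => h1.
have n2 : 0 < n%:R ^+ 2 :> R by rewrite exprn_gt0 // ltr0n.
have : 2 * (nedges G)%:R / n%:R ^+ 2 <= 7 / 8 + eps by lra.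
rewrite ler_pdivrMr // => h2; have e0 : 0 <= eps * n%:R ^+ 2 by rewrite mulr_ge0 ?ltW //; case/andP: e01.
lra.
Qed.

Lemma near_eight_partite (rho : R) : 0 < rho -> rho <= 1 / 100 -> exists2 delta : R, 0 < delta &
  forall n (G : {set {set 'I_n}}), (0 < n)%N -> is_graph G -> KpKq_free G 3 7 ->
  (alpha G)%:R < delta * n%:R -> (7 / 16 - delta) * n%:R ^+ 2 <= (nedges G)%:R ->
  exists f : 'I_n -> 'I_8, (forall i, #|[set v | f v == i]|%:R <= (1 / 8 + 58 * rho) * n%:R :> R) /\
  \sum_u \sum_v (adj G u v != (f u != f v))%:R <= 171 * rho * n%:R ^+ 2.
Proof.
(* Chosen so that 2 eps = rho tau^2 / 3 with tau = rho^2, the error allowed by [near_partition]. *)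
move=> r0 r1; pose eps := rho ^+ 5 / 6.
have e0 : 0 < eps by rewrite divr_gt0 // exprn_gt0.
have e1 : 0 < eps <= 1.
  have : rho ^+ 5 <= 1 by rewrite exprn_ile1 //; lra.
  by rewrite e0 /eps /=; lra.
have [d0 d00 h] := nonedge_stability e1; exists (d0 / 2); first by rewrite divr_gt0.
move=> n G n0 gG fG aG eG; have [E rE EG] := KpKq_free_ramsey gG fG.
have nR : 0 < n%:R :> R by rewrite ltr0n.
have aG' : (alpha G)%:R < d0 * n%:R.
  by apply: lt_le_trans aG _; rewrite ler_pM2r //; lra.
have n0' : (0 < #|'I_n|)%N by rewrite card_ord.
have := h _ E n0' rE; rewrite {1}card_ord => /(_ (indep_alpha EG aG'))[h1 h2].
have {}h2 : bad_density R E <= 1 / 64 + eps.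
  apply: h2; rewrite (nonedge_density_nedges gG R n0 EG).
  have : (7 / 8 - d0) <= 2 * (nedges G)%:R / n%:R ^+ 2.
    by rewrite ler_pdivlMr ?exprn_gt0 //; lra.
  lra.
have := variance_paths (rg_sym rE) n0' (ltW e0) h1 h2; set N := nonadj E; rewrite card_ord => hv.
have Nadj u v : N u v = ~~ adj G u v by rewrite /N /nonadj EG.
have tE : 2 * eps = rho * (rho ^+ 2) ^+ 2 / 3 by rewrite /eps; field.
have p1 : 0 <= \sum_v npath R N v.
  apply: sumr_ge0 => v _; apply: sumr_ge0 => u _; apply: sumr_ge0 => w _.
  by rewrite !mulr_ge0 ?ler0n // subr_ge0 lern1 leq_b1.
have p2 : 0 <= \sum_v (ndeg R N v - n%:R / 8) ^+ 2 by apply: sumr_ge0 => v _; rewrite sqr_ge0.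
have [|||f [f1 f2]] := @near_partition R _ N rho _ n0' r0 r1.
- by move=> u v; rewrite !Nadj adj_sym.
- by rewrite card_ord -tE; lra.
- by rewrite card_ord -tE; lra.
exists f; split=> [i|]; first by have := f1 i; rewrite card_ord.
rewrite card_ord in f2; apply: le_trans f2; apply: ler_sum => u _; apply: ler_sum => v _.
by rewrite Nadj ler_nat; case: (adj G u v); case: (f u == f v).
Qed.

Theorem edit_distance_small (eps : R) : 0 < eps <= 1 -> exists2 delta : R, 0 < delta &
  forall n (S Z : {set {set 'I_n}}), (0 < n)%N -> is_graph S -> is_graph Z ->
  KpKq_free S 3 7 -> KpKq_free Z 3 7 -> (alpha S)%:R < delta * n%:R -> (alpha Z)%:R < delta * n%:R ->
  (7 / 16 - delta) * n%:R ^+ 2 <= (nedges S)%:R -> (7 / 16 - delta) * n%:R ^+ 2 <= (nedges Z)%:R ->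
  (Delta S Z)%:R <= eps * n%:R ^+ 2.
Proof.
(* The two near-partitions cost 171 rho n^2 each, and the mismatched vertices 2 * 3712 rho n^2; the
   total 7766 is below 8000. *)
move=> /andP[e0 e1]; pose rho := eps / 80 / 100.
have r0 : 0 < rho by rewrite !divr_gt0.
have r1 : rho <= 1 / 100 by rewrite /rho; lra.
have [delta d0 h] := near_eight_partite r0 r1; exists delta => // n S Z n0 gS gZ fS fZ aS aZ eS eZ.
have [f [f1 f2]] := h n S n0 gS fS aS eS; have [g [g1 g2]] := h n Z n0 gZ fZ aZ eZ.
have nR : 0 < n%:R :> R by rewrite ltr0n.
have [s hs] := exists_matching f g.
set M := [set v | f v != g (s v)] in hs.
have cst8 (c : R) : \sum_(i < 8) c = 8 * c by rewrite sumr_const card_ord [RHS]mulr_natl.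
have fibres : \sum_i #|[set v | g v == i]|%:R = n%:R :> R.
  rewrite -natr_sum; congr _%:R; rewrite -[RHS]card_ord -sum1_card (partition_big g xpredT) //=.
  by apply: eq_bigr => i _; rewrite sum1dep_card; apply: eq_card => v; rewrite !inE.
(* From the upper bounds on the other seven classes, as 406 = 7 * 58. *)
have glow i : (1 / 8 - 406 * rho) * n%:R <= #|[set v | g v == i]|%:R :> R.
  have : \sum_(j < 8 | j != i) #|[set v | g v == j]|%:R <= \sum_(j < 8 | j != i) (1 / 8 + 58 * rho) * n%:R :> R.
    by apply: ler_sum => j _; apply: g1.
  have cst7 : \sum_(j < 8 | j != i) (1 / 8 + 58 * rho) * n%:R = 7 * ((1 / 8 + 58 * rho) * n%:R) :> R.
    by have := cst8 ((1 / 8 + 58 * rho) * n%:R); rewrite (bigD1 i) //=; lra.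
  by rewrite cst7; move: fibres; rewrite (bigD1 i) //=; lra.
have hM : #|M|%:R <= 3712 * rho * n%:R.
  apply: (@le_trans _ _ (\sum_(i < 8) 464 * rho * n%:R)); last by rewrite cst8; lra.
  apply: (@le_trans _ _ (\sum_i (#|[set v | f v == i]| - #|[set v | g v == i]|)%N%:R)).
    by rewrite -natr_sum ler_nat.
  apply: ler_sum => i _; have gi := glow i; have fi := f1 i.
  have rn : 0 <= rho * n%:R by rewrite mulr_ge0 // ltW.
  case: (leqP #|[set v | f v == i]| #|[set v | g v == i]|) => [|/ltnW] le.
    by move: (le); rewrite -subn_eq0 => /eqP->; move: rn; clear; lra.
  by rewrite natrB //; move: gi fi rn; clear; lra.
apply: (@le_trans _ _ #|[set p : 'I_n * 'I_n | adj S p.1 p.2 != adj Z (s p.1) (s p.2)]|%:R).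
  by rewrite ler_nat; apply: Delta_le.
have -> : #|[set p : 'I_n * 'I_n | adj S p.1 p.2 != adj Z (s p.1) (s p.2)]|%:R =
    \sum_u \sum_v (adj S u v != adj Z (s u) (s v))%:R :> R.
  rewrite pair_big /= -natr_sum -sum1_card; congr _%:R.
  by rewrite big_mkcond; apply: eq_bigr => p _; rewrite inE; case: (_ != _).
have pw u v : (adj S u v != adj Z (s u) (s v))%:R <= (adj S u v != (f u != f v))%:R +
    (adj Z (s u) (s v) != (g (s u) != g (s v)))%:R + (u \in M)%:R + (v \in M)%:R :> R.
  rewrite !inE -!natrD ler_nat.
  case: (eqVneq (f u) (g (s u))) => [->|_]; case: (eqVneq (f v) (g (s v))) => [->|_] /=;
    rewrite ?addn1 ?addn0; last 3 first.
  - by apply: leq_trans (leq_b1 _) _.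
  - by apply: leq_trans (leq_b1 _) _.
  - by apply: leq_trans (leq_b1 _) _.
  by case: (adj S u v); case: (adj Z _ _); case: (g (s u) == g (s v)).
apply: le_trans (ler_sum _ (fun u _ => ler_sum _ (fun v _ => pw u v))) _.
under eq_bigr => u _ do rewrite !big_split /=.
rewrite !big_split /=.
have Zs : \sum_u \sum_v (adj Z (s u) (s v) != (g (s u) != g (s v)))%:R =
    \sum_u \sum_v (adj Z u v != (g u != g v))%:R :> R.
  rewrite [RHS](reindex_inj (@perm_inj _ s)) /=; apply: eq_bigr => u _.
  by rewrite [RHS](reindex_inj (@perm_inj _ s)).
have cst (c : R) : \sum_(u < n) c = n%:R * c by rewrite sumr_const card_ord [RHS]mulr_natl.
have sM : \sum_u (u \in M)%:R = #|M|%:R :> R.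
  rewrite -natr_sum; congr _%:R; rewrite -sum1_card [RHS]big_mkcond; apply: eq_bigr => u _.
  by case: (u \in M).
rewrite Zs; under [X in _ + _ + X + _]eq_bigr => u _ do rewrite cst.
rewrite -mulr_sumr sM cst.
have hM2 : n%:R * #|M|%:R <= 3712 * rho * n%:R ^+ 2.
  by have := ler_wpM2l (ltW nR) hM; have -> : n%:R * (3712 * rho * n%:R) = 3712 * rho * n%:R ^+ 2 by ring.
have -> : eps = 80 * (100 * rho) by rewrite /rho; field.
have r2 : 0 <= rho * n%:R ^+ 2 by rewrite mulr_ge0 ?exprn_ge0 // ltW.
by move: f2 g2 hM2 r2; clear; lra.
Qed.

End Stability.

(** * The lower bound *)

Section Polarity.
Variable F : finFieldType.
Hypothesis two0 : (2 : F) != 0.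
Let q := #|F|.

(** Squaring identifies 1 and -1, so on a finite field it is not injective and hence not
    surjective. *)
Lemma exists_nonsquare : exists g : F, forall t, t ^+ 2 != g.
Proof.
apply: contrapT => h.
have surj (g : F) : exists t : F, t ^+ 2 == g.
  apply: contrapT => no; apply: h; exists g => t; apply/negP => tg; apply: no; by exists t.
pose r g := xchoose (surj g); have rK : cancel r (fun t => t ^+ 2).
  by move=> g; apply/eqP; apply: (xchooseP (surj g)).
have sqK : cancel (fun t : F => t ^+ 2) r.
  by apply/(bij_can_sym (injF_bij (can_inj rK))).
have /(congr1 r) : (1 : F) ^+ 2 = (-1) ^+ 2 by rewrite sqrrN.
rewrite !sqK => e; case/eqP: two0; rewrite -[2]/(1 + 1) {2}e; exact: subrr.
Qed.

Variable g : F.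
Hypothesis g_nonsq : forall t, t ^+ 2 != g.

(** A polarity of the affine plane: the points related to [x] form a non-vertical line, and distinct
    points have distinct lines. *)
Definition polar (x y : F * F) := x.2 + y.2 == x.1 * y.1.
(** Parametrises the points with 2 x.2 - x.1^2 a non-square, one side of the conic of self-polar
    points. Restricted to them the polarity graph has no triangle. The parameters t and -t give the
    same point. *)
Definition pvertex (p : F * F) : F * F := (p.1, (p.1 ^+ 2 + g * p.2 ^+ 2) / 2).
Definition pvertices := pvertex @: [set p : F * F | p.2 != 0].

Lemma pvertexP x : x \in pvertices -> exists2 t : F, t != 0 & x.2 * 2 = x.1 ^+ 2 + g * t ^+ 2.
Proof. by case/imsetP => -[a t]; rewrite inE /= => t0 ->; exists t => //=; rewrite divfK. Qed.

Lemma polar_not_absolute x : x \in pvertices -> ~~ polar x x.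
Proof.
case/pvertexP => t t0 xt; apply/negP => /eqP h.
have : g * t ^+ 2 = 0.
  by apply: (addrI (x.1 ^+ 2)); rewrite -xt addr0 expr2 -h; ring.
move/eqP; rewrite mulf_eq0 expf_eq0 (negbTE t0) orbF => /eqP g0.
by have := g_nonsq 0; rewrite expr0n /= g0 eqxx.
Qed.

Lemma polar_triangle x y z : x \in pvertices -> y \in pvertices -> z \in pvertices ->
  polar x y -> polar y z -> polar x z -> False.
Proof.
move=> /pvertexP[t t0 xt] /pvertexP[u u0 yu] /pvertexP[v v0 zv] /eqP xy /eqP yz /eqP xz.
set a := x.1 in xt xy xz; set b := y.1 in yu xy yz; set c := z.1 in zv yz xz.
(* The three values [g t^2], [g u^2], [g v^2] are [-(a-b)(a-c)] and its permutations, and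
   their product is a square. *)
have e1 : g * t ^+ 2 = - ((a - b) * (a - c)).
  have -> : g * t ^+ 2 = x.2 * 2 - a ^+ 2 by rewrite xt; ring.
  have -> : x.2 * 2 = (x.2 + y.2) + (x.2 + z.2) - (y.2 + z.2) by ring.
  by rewrite xy xz yz; ring.
have e2 : g * u ^+ 2 = - ((b - a) * (b - c)).
  have -> : g * u ^+ 2 = y.2 * 2 - b ^+ 2 by rewrite yu; ring.
  have -> : y.2 * 2 = (x.2 + y.2) + (y.2 + z.2) - (x.2 + z.2) by ring.
  by rewrite xy xz yz; ring.
have e3 : g * v ^+ 2 = - ((c - a) * (c - b)).
  have -> : g * v ^+ 2 = z.2 * 2 - c ^+ 2 by rewrite zv; ring.
  have -> : z.2 * 2 = (x.2 + z.2) + (y.2 + z.2) - (x.2 + y.2) by ring.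
  by rewrite xy xz yz; ring.
have g0 : g != 0 by have := g_nonsq 0; rewrite expr0n eq_sym.
have e : g * (g * (t * u * v)) ^+ 2 = ((a - b) * (a - c) * (b - c)) ^+ 2.
  have -> : g * (g * (t * u * v)) ^+ 2 = (g * t ^+ 2) * (g * u ^+ 2) * (g * v ^+ 2) by ring.
  by rewrite e1 e2 e3; ring.
have w0 : g * (t * u * v) != 0 by rewrite !mulf_neq0.
case/eqP: (g_nonsq ((a - b) * (a - c) * (b - c) / (g * (t * u * v)))).
by rewrite expr_div_n -e mulfK // expf_neq0.
Qed.

Lemma card_pvertices : (q * (q - 1) <= 2 * #|pvertices|)%N.
Proof.
set A := [set p : F * F | p.2 != 0].
have -> : (q * (q - 1))%N = #|A|.
  have -> : A = setX [set: F] [set~ 0] by apply/setP => -[a t]; rewrite !inE.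
  by rewrite cardsX cardsT cardsC1 subn1.
rewrite -sum1_card (partition_big pvertex (mem pvertices)) /=; last first.
  by move=> p pA; apply: imset_f.
rewrite mulnC -sum_nat_const; apply: leq_sum => y /imsetP[[a t] _ ->].
rewrite sum1dep_card; apply: (@leq_trans #|[set (a, t); (a, - t)]|); last first.
  by rewrite cards2; case: eqP.
apply/subset_leq_card/subsetP => -[b u]; rewrite !inE /= => /andP[_].
rewrite xpair_eqE => /andP[/eqP /= ba /eqP /= h]; rewrite !xpair_eqE ba eqxx /= -eqf_sqr; apply/eqP.
have g0 : g != 0 by have := g_nonsq 0; rewrite expr0n eq_sym.
have h2 : (a ^+ 2 + g * u ^+ 2) = (a ^+ 2 + g * t ^+ 2).
  by rewrite -[LHS](divfK two0) -{1}ba h divfK.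
by apply: (mulfI g0); apply: (addrI (a ^+ 2)).
Qed.

Section Independent.
Variables (R : realType) (S : {set F * F}).
Hypothesis S_polar : {in S &, forall x y, ~~ polar x y}.
Let inc (x z : F * F) : R := (polar x z)%:R.

Lemma card_polar x : #|[set z | polar x z]| = q.
Proof.
have -> : [set z | polar x z] = [set (c, x.1 * c - x.2) | c in F].
  apply/setP => -[c d]; rewrite inE /polar /=; apply/eqP/imsetP => [h|[c' _ [-> ->]]]; last first.
    by rewrite addrC subrK.
  by exists c => //; rewrite -h addrC addKr.
by rewrite card_imset // => c d [].
Qed.

Lemma card_polar2 x y : x != y -> (#|[set z | polar x z && polar y z]| <= 1)%N.
Proof.
move=> xy; apply/card_le1_eqP => -[c d] [c' d']; rewrite !inE /polar /=.
move=> /andP[/eqP h1 /eqP h2] /andP[/eqP h3 /eqP h4].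
have e1 : (x.1 - y.1) * c = (x.1 - y.1) * c'.
  rewrite !mulrBl -h1 -h2 -h3 -h4; ring.
have xy1 : x.1 - y.1 != 0.
  apply: contraNneq xy => /eqP; rewrite subr_eq0 => /eqP e; apply/eqP.
  move: x y e h1 h2 {h3 h4 e1} => [x1 x2] [y1 y2] /= -> h1 h2; congr (_, _).
  by apply: (addIr d); rewrite h1 h2.
have e2 := mulfI xy1 e1; congr (_, _) => //; rewrite e2 in h1.
by apply: (addrI x.2); rewrite h1 h3.
Qed.

Lemma sum_card (A : pred (F * F)) : \sum_z (A z)%:R = #|[set z | A z]|%:R :> R.
Proof.
rewrite -natr_sum; congr _%:R; rewrite -sum1_card [RHS]big_mkcond; apply: eq_bigr => z _.
by rewrite inE; case: (A z).
Qed.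

(* The number of points of [S] on a random line has mean [#|S| / q] and variance at most
   [#|S| / q], but the polar line of a point of [S] misses [S]. *)
Lemma independent_polar : (#|S| ^ 2 <= q ^ 3)%N.
Proof.
have [->//|S0] := posnP #|S|.
have q0 : (0 < q)%N by apply/card_gt0P; exists 0.
pose f z : R := \sum_(x in S) inc x z; pose s : R := #|S|%:R; pose Q : R := q%:R.
have s0 : 0 < s by rewrite ltr0n.
have sum_f : \sum_z f z = s * Q.
  rewrite /f exchange_big (eq_bigr (fun=> Q)); first by rewrite sumr_const -[LHS]mulr_natl.
  by move=> x _; rewrite (sum_card (polar x)) card_polar.
have sum_f2 : \sum_z f z ^+ 2 <= s * Q + s * s.
  have -> : \sum_z f z ^+ 2 = \sum_(x in S) \sum_(y in S) \sum_z inc x z * inc y z.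
    under eq_bigr => z _ do rewrite expr2 mulr_suml.
    rewrite exchange_big; apply: eq_bigr => x _; rewrite exchange_big; apply: eq_bigr => z _.
    by rewrite mulr_sumr.
  have -> : s * Q + s * s = \sum_(x in S) (Q + s) by rewrite sumr_const -[RHS]mulr_natl mulrDr.
  apply: ler_sum => x xS; rewrite (bigD1 x) //=; apply: lerD.
    rewrite /Q -(card_polar x) -sum_card; apply: ler_sum => z _.
    by rewrite /inc; case: (polar x z); rewrite ?mulr0 ?mulr1.
  apply: (@le_trans _ _ (\sum_(y in S | y != x) 1)).
    apply: ler_sum => y /andP[_ yx].
    have -> : \sum_z inc x z * inc y z = #|[set z | polar x z && polar y z]|%:R.
      rewrite -sum_card; apply: eq_bigr => z _; rewrite /inc -natrM.
      by case: (polar x z); case: (polar y z).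
    by rewrite lern1 card_polar2 // eq_sym.
  rewrite sumr_const ler_nat; by apply/subset_leq_card/subsetP => y /andP[].
have cardV : \sum_(z : F * F) 1 = Q ^+ 2 :> R by rewrite sumr_const card_prod natrM -/q expr2.
have var : \sum_z (Q * f z - s) ^+ 2 <= Q ^+ 3 * s.
  have -> : \sum_z (Q * f z - s) ^+ 2 = Q ^+ 2 * (\sum_z f z ^+ 2) - 2 * Q * s * (\sum_z f z) + s ^+ 2 * (\sum_(z : F * F) 1).
    rewrite !mulr_sumr -sumrB -big_split; apply: eq_bigr => z _ /=; ring.
  rewrite cardV sum_f.
  have := ler_wpM2l (exprn_ge0 2 (ler0n R q)) sum_f2; rewrite -/Q.
  have -> : Q ^+ 2 * (s * Q + s * s) = Q ^+ 3 * s + Q ^+ 2 * s ^+ 2 by ring.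
  have -> : 2 * Q * s * (s * Q) = 2 * (Q ^+ 2 * s ^+ 2) by ring.
  rewrite (mulrC (s ^+ 2)); lra.
have low : s * s ^+ 2 <= \sum_z (Q * f z - s) ^+ 2.
  rewrite (bigID (mem S)) /= -[leLHS]addr0; apply: lerD; last by apply: sumr_ge0 => z _; rewrite sqr_ge0.
  have -> : s * s ^+ 2 = \sum_(z in S) s ^+ 2 by rewrite sumr_const -[RHS]mulr_natl.
  apply: ler_sum => z zS; rewrite (_ : f z = 0) ?mulr0 ?sub0r ?sqrrN //.
  rewrite /f big1 // => x xS; rewrite /inc; by rewrite (negbTE (S_polar xS zS)).
have : s * s ^+ 2 <= s * Q ^+ 3 by apply: le_trans low _; rewrite mulrC.
by rewrite (ler_pM2l s0) -!natrX ler_nat.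
Qed.

End Independent.
End Polarity.

(** * Blow-ups of coloured graphs *)

Definition coloured (T : finType) (E : bool -> rel T) : rel T := fun u v => E true u v || E false u v.

(** Vertices with the same image are not joined, so cliques map injectively. [D] leaves room for
    isolated vertices. *)
Lemma ramsey_pullback (V W : finType) (E : bool -> rel V) (D : pred W) (h : W -> V) : ramsey_graph E ->
  ramsey_graph (fun b u v => [&& D u, D v & E b (h u) (h v)]).
Proof.
case=> Es Ei Ex Er Eb.
have img b (Q : {set W}) : clique (fun u v => [&& D u, D v & E b (h u) (h v)]) Q ->
    clique (E b) (h @: Q) /\ #|h @: Q| = #|Q|.
  move=> cQ; split.
    move=> x y /imsetP[u uQ ->] /imsetP[v vQ ->] xy.
    by have /and3P[] : [&& D u, D v & E b (h u) (h v)] by apply: cQ => //; apply: contraNneq xy => ->.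
  apply: card_in_imset => u v uQ vQ e; apply/eqP; apply: contraT => uv.
  by have /and3P[_ _] := cQ u v uQ vQ uv; rewrite e Ei.
split.
- by move=> b u v; rewrite Es andbCA.
- by move=> b u; rewrite Ei !andbF.
- by move=> u v /and3P[_ _ /Ex/negbTE->]; rewrite !andbF.
- by move=> Q /img[cQ <-]; apply: Er.
- by move=> Q /img[cQ <-]; apply: Eb.
Qed.

Section GraphOf.
Variables (n : nat) (E : bool -> rel 'I_n).
Hypothesis rE : ramsey_graph E.

Definition graph_of (A : rel 'I_n) : {set {set 'I_n}} :=
  [set e | [exists p : 'I_n * 'I_n, A p.1 p.2 && (e == [set p.1; p.2])]].

Lemma mem_graph_of (A : rel 'I_n) u v : symmetric A -> ([set u; v] \in graph_of A) = A u v.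
Proof.
move=> As; rewrite inE; apply/existsP/idP => [[[a b] /= /andP[ab /eqP h]]|uv]; last first.
  by exists (u, v); rewrite uv eqxx.
have [ua va] : u \in [set a; b] /\ v \in [set a; b] by rewrite -h !inE !eqxx orbT.
have [au bu] : a \in [set u; v] /\ b \in [set u; v] by rewrite h !inE !eqxx orbT.
move: ua va au bu ab; rewrite !inE.
move=> /orP[]/eqP-> /orP[]/eqP-> //; rewrite ?orbb.
- by move=> _ /eqP->.
- by rewrite As.
- by move=> /eqP->.
Qed.

Let A := coloured E.
Let As : symmetric A. Proof. by move=> u v; rewrite /A /coloured !(rg_sym rE _ u). Qed.

Lemma adj_graph_of u v : adj (graph_of A) u v = A u v.
Proof. exact: mem_graph_of. Qed.

Lemma graph_of_is_graph : is_graph (graph_of A).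
Proof.
apply/forall_inP => e; rewrite inE => /existsP[[a b] /= /andP[ab /eqP->]].
rewrite cards2; have [e'|//] := eqVneq a b; move: ab; rewrite e' /A /coloured !(rg_irr rE) //.
Qed.

Lemma graph_of_free : KpKq_free (graph_of A) 3 7.
Proof.
apply/existsP; exists [ffun e => e \in graph_of (E true)].
have cl b k S : mono_clique (graph_of A) [ffun e => e \in graph_of (E true)] b k S ->
    #|S| = k /\ clique (E b) S.
  move=> /andP[/eqP-> h]; split=> // x y xS yS xy.
  move/forall_inP/(_ x xS)/forall_inP/(_ y yS): h; rewrite xy /= adj_graph_of ffunE.
  rewrite (mem_graph_of _ _ (rg_sym rE true)) /A /coloured => /andP[+ /eqP <-].
  by case: (boolP (E true x y)).
apply/andP; split; apply/negP => /existsP[S /cl[S3 cS]].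
  by have := rg_red rE cS; rewrite S3.
by have := rg_blue rE cS; rewrite S3.
Qed.

Lemma graph_of_alpha (R : realType) (m : R) : indep_lt E m -> (alpha (graph_of A))%:R < m.
Proof.
move=> im; rewrite /alpha; elim/big_ind: _ => [|x y hx hy|S /forall_inP iS].
- by have := im set0; rewrite cards0; apply=> u v; rewrite inE.
- by rewrite /maxn; case: ifP.
apply: im => u v uS vS; have [<-|uv] := eqVneq u v; first by rewrite !(rg_irr rE).
have /forall_inP/(_ v vS) := iS u uS; rewrite uv adj_graph_of /A /coloured /=.
by rewrite negb_or.
Qed.

Lemma graph_of_edges : (2 * nedges (graph_of A) = \sum_u \sum_v A u v)%N.
Proof.
rewrite -(card_adj graph_of_is_graph) pair_big /= -sum1_card big_mkcond.
by apply: eq_bigr => p _; rewrite inE adj_graph_of; case: (A _ _).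
Qed.

End GraphOf.

Theorem graph_of_ramsey (R : realType) (T : finType) (E : bool -> rel T) (m : R) n : #|T| = n ->
  ramsey_graph E -> indep_lt E m -> exists G : {set {set 'I_n}}, [/\ is_graph G, KpKq_free G 3 7,
  (alpha G)%:R < m & (2 * nedges G = \sum_u \sum_v coloured E u v)%N].
Proof.
move=> <- rE iE; pose E' b (u v : 'I_#|T|) := [&& true, true & E b (enum_val u) (enum_val v)].
have rE' : ramsey_graph E' by apply: (ramsey_pullback xpredT).
exists (graph_of (coloured E')); split.
- exact: graph_of_is_graph.
- exact: graph_of_free.
- apply: graph_of_alpha => // I hI; rewrite -(card_imset _ enum_val_inj); apply: iE.
  by move=> x y /imsetP[u uI ->] /imsetP[v vI ->]; apply: hI.
have bij P : {on P, bijective (enum_val : 'I_#|T| -> T)} := onW_bij P (@enum_val_bij T).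
rewrite graph_of_edges // [RHS](reindex _ (bij _)); apply: eq_bigr => u _.
by rewrite [RHS](reindex _ (bij _)).
Qed.

(* The colouring of [K_8] by differences in [Z/8] showing [r(3,4) > 8]. *)
Definition wagner (b : bool) (i j : 'I_8) : bool :=
  ((i + 8 - j) %% 8)%N \in (if b then [:: 1; 4; 7] else [:: 2; 3; 5; 6])%N.

Lemma wagner_sym b : symmetric (wagner b).
Proof.
move=> i j; apply/eqP; have : all (fun i => all (fun j =>
  (((i + 8 - j) %% 8)%N \in (if b then [:: 1; 4; 7] else [:: 2; 3; 5; 6])%N) ==
  (((j + 8 - i) %% 8)%N \in (if b then [:: 1; 4; 7] else [:: 2; 3; 5; 6])%N)) (iota 0 8)) (iota 0 8).
  by case: b.
by move/allP/(_ (val i)); rewrite mem_iota ltn_ord => /(_ isT)/allP/(_ (val j)); rewrite mem_iota ltn_ord => /(_ isT).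
Qed.

Lemma wagner_irr b : irreflexive (wagner b).
Proof. by move=> i; rewrite /wagner addnC addnK; case: b. Qed.

Lemma wagner_excl i j : wagner true i j -> ~~ wagner false i j.
Proof. by rewrite /wagner !inE => /or3P[]/eqP->. Qed.

Lemma wagner_total i j : i != j -> wagner true i j || wagner false i j.
Proof.
move=> ij; have : all (fun i => all (fun j => (i == j) ||
  (((i + 8 - j) %% 8)%N \in [:: 1; 4; 7; 2; 3; 5; 6]%N)) (iota 0 8)) (iota 0 8) by [].
move/allP/(_ (val i)); rewrite mem_iota ltn_ord => /(_ isT)/allP/(_ (val j)).
rewrite mem_iota ltn_ord => /(_ isT)/orP[/eqP/val_inj e|]; first by rewrite e eqxx in ij.
by rewrite /wagner !inE -!orbA.
Qed.

Lemma card_le2 (T : finType) (Q : {set T}) :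
  (forall x y z, x \in Q -> y \in Q -> z \in Q -> x != y -> y != z -> x != z -> False) -> (#|Q| <= 2)%N.
Proof.
move=> h; rewrite leqNgt cardE; apply/negP; case E: (enum Q) => [|x [|y [|z l]]] // _.
have mQ w : w \in x :: y :: z :: l -> w \in Q by rewrite -E mem_enum.
have := enum_uniq Q; rewrite E /= !inE !negb_or -!andbA => /and5P[xy xz _ yz _].
by apply: (h x y z); rewrite // mQ // !inE eqxx ?orbT.
Qed.

Lemma wagner_red (Q : {set 'I_8}) : clique (wagner true) Q -> (#|Q| <= 2)%N.
Proof.
move=> cQ; apply: card_le2 => x y z xQ yQ zQ xy yz xz.
have : all (fun i => all (fun j => all (fun l => ~~ [&&
   ((i + 8 - j) %% 8)%N \in [:: 1; 4; 7]%N, ((j + 8 - l) %% 8)%N \in [:: 1; 4; 7]%N &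
   ((i + 8 - l) %% 8)%N \in [:: 1; 4; 7]%N]) (iota 0 8)) (iota 0 8)) (iota 0 8) by [].
move/allP/(_ (val x)); rewrite mem_iota ltn_ord => /(_ isT)/allP/(_ (val y)).
rewrite mem_iota ltn_ord => /(_ isT)/allP/(_ (val z)); rewrite mem_iota ltn_ord => /(_ isT)/negP; apply.
by apply/and3P; split; apply: cQ.
Qed.

Lemma wagner_blue (Q : {set 'I_8}) : clique (wagner false) Q -> (#|Q| <= 3)%N.
Proof.
move=> cQ; rewrite leqNgt cardE; apply/negP; case E: (enum Q) => [|x [|y [|z [|w l]]]] // _.
have mQ a : a \in x :: y :: z :: w :: l -> a \in Q by rewrite -E mem_enum.
have := enum_uniq Q; rewrite E /= !inE !negb_or -!andbA => /and5P[xy xz xw _ /and4P[yz yw _ /andP[zw _]]].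
have [xQ yQ zQ wQ] : [/\ x \in Q, y \in Q, z \in Q & w \in Q].
  by split; apply: mQ; rewrite !inE eqxx ?orbT.
pose c i j := ((i + 8 - j) %% 8)%N \in [:: 2; 3; 5; 6]%N.
have : all (fun i => all (fun j => c i j ==> all (fun l => [&& c j l & c i l] ==> all (fun k => ~~ [&& c i k, c j k & c l k])
  (iota 0 8)) (iota 0 8)) (iota 0 8)) (iota 0 8) by [].
have ci (i j : 'I_8) : i \in Q -> j \in Q -> i != j -> c (val i) (val j) by move=> iQ jQ ij; apply: cQ.
move/allP/(_ (val x)); rewrite mem_iota ltn_ord => /(_ isT)/allP/(_ (val y)).
rewrite mem_iota ltn_ord ci // => /(_ isT)/allP/(_ (val z)); rewrite mem_iota ltn_ord !ci // => /(_ isT)/allP/(_ (val w)).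
by rewrite mem_iota ltn_ord !ci // => /(_ isT).
Qed.

Section WagnerBlowUp.
Variables (X : finType) (B : rel X).
Hypotheses (Bsym : symmetric B) (Birr : irreflexive B).
Hypothesis Btri : forall x y z, B x y -> B y z -> B x z -> False.
Let T := ('I_8 * X)%type.

Definition wagner_blowup (b : bool) (u v : T) :=
  wagner b u.1 v.1 || [&& ~~ b, u.1 == v.1 & B u.2 v.2].

Lemma card_fibres (Q : {set T}) (P : {set 'I_8}) m : (forall u, u \in Q -> u.1 \in P) ->
  (forall i, #|[set u in Q | u.1 == i]| <= m)%N -> (#|Q| <= #|P| * m)%N.
Proof.
move=> QP h; rewrite -sum1_card (partition_big fst (mem P)) //= -sum_nat_const.
apply: leq_sum => i _; rewrite sum1dep_card; apply: leq_trans (h i).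
by apply/subset_leq_card/subsetP => u; rewrite !inE.
Qed.

Lemma clique_fst b (Q : {set T}) : clique (wagner_blowup b) Q -> clique (wagner b) (fst @: Q).
Proof.
move=> cQ i j /imsetP[u uQ ->] /imsetP[v vQ ->] ij.
have uv : u != v by apply: contraNneq ij => ->.
have /orP[//|/and3P[_ e _]] := cQ u v uQ vQ uv.
by rewrite e in ij.
Qed.

(** A red clique has at most one vertex in each part; a blue clique meets at most three parts, in at
    most two vertices each, since [B] has no triangle. *)
Lemma wagner_blowup_ramsey : ramsey_graph wagner_blowup.
Proof.
split.
- by move=> b u v; rewrite /wagner_blowup wagner_sym eq_sym Bsym.
- by move=> b u; rewrite /wagner_blowup wagner_irr Birr !andbF.
- move=> u v; rewrite /wagner_blowup orbF => h; rewrite negb_or wagner_excl //=.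
  by apply/nandP; left; apply: contraTneq h => ->; rewrite wagner_irr.
- move=> Q cQ; have := wagner_red (clique_fst cQ); apply: leq_trans.
  rewrite -[leqRHS]muln1; apply: card_fibres => [u uQ|i]; first exact: imset_f.
  apply/card_le1_eqP => u v; rewrite !inE => /andP[uQ /eqP ui] /andP[vQ /eqP vi].
  apply/eqP; apply: contraT => uv; have := cQ v u vQ uQ uv.
  by rewrite /wagner_blowup ui vi wagner_irr.
move=> Q cQ; have := wagner_blue (clique_fst cQ); rewrite -(leq_pmul2r (isT : 0 < 2)%N); apply: leq_trans.
apply: card_fibres => [u uQ|i]; first exact: imset_f.
apply: card_le2 => u v w; rewrite !inE => /andP[uQ /eqP ui] /andP[vQ /eqP vi] /andP[wQ /eqP wi] uv vw uw.
have in_part a c : a \in Q -> c \in Q -> a != c -> a.1 = i -> c.1 = i -> B a.2 c.2.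
  move=> aQ cQ' ac ai ci; have := cQ a c aQ cQ' ac.
  by rewrite /wagner_blowup ai ci wagner_irr /= eqxx.
by apply: (@Btri u.2 v.2 w.2); apply: in_part.
Qed.

Lemma wagner_blowup_indep (I : {set T}) :
  {in I &, forall u v, ~~ wagner_blowup true u v && ~~ wagner_blowup false u v} ->
  {in snd @: I &, forall x y, ~~ B x y} /\ #|snd @: I| = #|I|.
Proof.
move=> hI; have same u v : u \in I -> v \in I -> u.1 = v.1.
  move=> uI vI; apply/eqP; apply: contraT => uv; have := hI u v uI vI.
  by move=> /andP[/norP[h1 _] /norP[h2 _]]; have := wagner_total uv; rewrite (negbTE h1) (negbTE h2).
split.
  move=> x y /imsetP[u uI ->] /imsetP[v vI ->]; have := hI u v uI vI.
  by move=> /andP[_ /norP[_]]; rewrite (same u v uI vI) eqxx.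
apply: card_in_imset => u v uI vI e; have := same u v uI vI; move: e; case: u {uI} => ? ?; case: v {vI} => ? ? /=.
by move=> -> ->.
Qed.

Lemma wagner_blowup_edges :
  (56 * #|X| ^ 2 <= \sum_u \sum_v coloured wagner_blowup u v)%N.
Proof.
apply: (@leq_trans (\sum_(u : T) \sum_(v : T) (u.1 != v.1))); last first.
  apply: leq_sum => u _; apply: leq_sum => v _; rewrite /coloured /wagner_blowup.
  by case: eqVneq => //= uv; case/orP: (wagner_total uv) => ->; rewrite ?orbT.
have row (i : 'I_8) : (\sum_(v : T) (i != v.1) = 7 * #|X|)%N.
  rewrite -(pair_bigA _ (fun j (x : X) => (i != j) : nat)) /=.
  under eq_bigr do rewrite sum_nat_const.
  rewrite -big_distrr /= mulnC; congr (_ * _)%N.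
  rewrite (bigD1 i) //= eqxx add0n (eq_bigr (fun=> 1%N)); last by move=> j; rewrite eq_sym => ->.
  by rewrite sum1_card; apply: etrans (cardC1 i) _; rewrite card_ord.
under eq_bigr do rewrite row.
by rewrite sum_nat_const card_prod card_ord; nia.
Qed.

End WagnerBlowUp.

Section PolarGraph.
Variables (R : realType) (F : finFieldType) (g : F).
Hypotheses (two0 : (2 : F) != 0) (g_nonsq : forall t, t ^+ 2 != g).

Let X := {x : F * F | x \in pvertices g}.
Let B : rel X := fun x y => polar (val x) (val y).

Lemma polar_graph_exists : exists (Y : finType) (A : rel Y), [/\ symmetric A, irreflexive A,
  forall x y z, A x y -> A y z -> A x z -> False,
  (#|F| * (#|F| - 1) <= 2 * #|Y|)%N &
  forall S : {set Y}, {in S &, forall x y, ~~ A x y} -> (#|S| ^ 2 <= #|F| ^ 3)%N].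
Proof.
exists X, B; split.
- by move=> x y; rewrite /B /polar addrC mulrC.
- by move=> x; apply/negbTE/(polar_not_absolute two0 g_nonsq)/(valP x).
- move=> x y z; apply: (polar_triangle two0 g_nonsq); exact: valP.
- by rewrite card_sig; apply: card_pvertices.
- move=> S hS; rewrite -(card_imset _ val_inj); apply: (independent_polar R).
  by move=> x y /imsetP[x' xS ->] /imsetP[y' yS ->]; apply: hS.
Qed.

End PolarGraph.

Theorem dense_graph_exists (R : realType) (delta : R) : 0 < delta -> exists n (G : {set {set 'I_n}}),
  [/\ (0 < n)%N, is_graph G, KpKq_free G 3 7, (alpha G)%:R < delta * n%:R &
   (7 * n ^ 2 <= 16 * nedges G)%N].
Proof.
(* Independent sets have at most p^(3/2) vertices, out of at least p^2, so p > delta^(-2) is enough.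
   The added 3 makes the prime p odd. *)
move=> d0; pose N := (Num.truncn (delta ^- 2)).+3.
have [p Np pr] := prime_above N.
have [p2 p0] : (2 < p)%N /\ (0 < p)%N by lia.
have cF : #|'F_p| = p by apply: card_Fp.
have two0 : (2 : 'F_p) != 0.
  rewrite -(dvdn_pcharf (pchar_Fp pr)); apply/negP => /dvdn_leq; lia.
have [g gn] := exists_nonsquare two0.
have [Y [B [Bs Bi Bt BY BS]]] := polar_graph_exists R two0 gn.
rewrite cF in BY BS.
have Y0 : (0 < #|Y|)%N by nia.
have cT : #|{: 'I_8 * Y}| = (8 * #|Y|)%N by rewrite card_prod card_ord.
have pR : 0 < p%:R :> R by rewrite ltr0n.
have pd : 1 < delta ^+ 2 * p%:R.
  rewrite mulrC -ltr_pdivrMr ?exprn_gt0 // mul1r; apply: lt_le_trans (truncnS_gt _) _.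
  by rewrite ler_nat; apply: leq_trans Np; rewrite /N !ltnS !leqW.
have Y2 : p%:R ^+ 2 <= 4 * #|Y|%:R :> R by rewrite -natrX -natrM ler_nat; nia.
have iT : indep_lt (wagner_blowup B) (delta * (8 * #|Y|)%:R).
  move=> I /wagner_blowup_indep[hI <-]; have := BS _ hI; set s := #|_| => s3.
  have dY : 0 <= delta * (8 * #|Y|)%:R by rewrite mulr_ge0 // ltW.
  rewrite -(ltr_pXn2r (isT : (0 < 2)%N)) ?nnegrE //.
  have {}s3 : s%:R ^+ 2 <= p%:R ^+ 3 :> R by rewrite -!natrX ler_nat.
  apply: le_lt_trans s3 _; rewrite exprMn natrM.
  have h : p%:R ^+ 2 * p%:R ^+ 2 <= (8 * #|Y|%:R) ^+ 2 :> R.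
    rewrite expr2; apply: ler_pM; rewrite ?exprn_ge0 //; have := ler0n R #|Y|; lra.
  apply: (@lt_le_trans _ _ (delta ^+ 2 * (p%:R ^+ 2 * p%:R ^+ 2))).
    have -> : delta ^+ 2 * (p%:R ^+ 2 * p%:R ^+ 2) = (delta ^+ 2 * p%:R) * p%:R ^+ 3 by ring.
    by rewrite ltr_pMl // exprn_gt0.
  by rewrite ler_wpM2l // exprn_ge0 // ltW.
have [G [gG fG aG eG]] := graph_of_ramsey cT (wagner_blowup_ramsey Bs Bi Bt) iT.
exists (8 * #|Y|)%N, G; split => //; first by rewrite muln_gt0 Y0.
have := wagner_blowup_edges B; rewrite -eG.
by clear; set e := nedges G; move: e; move: #|Y| => y e; nia.
Qed.

(** * Existence of the limits *)

Lemma sum_mem_card (T : finType) (A : {set T}) : (\sum_x (x \in A) = #|A|)%N.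
Proof. by rewrite -sum1_card [RHS]big_mkcond; apply: eq_bigr => x _; case: (x \in A). Qed.

Lemma sum_prod (I J : finType) (f : I * J -> nat) : (\sum_p f p = \sum_i \sum_j f (i, j))%N.
Proof. by rewrite pair_bigA; apply: eq_bigr => -[]. Qed.

Lemma alpha_max n (G : {set {set 'I_n}}) (S : {set 'I_n}) : independent G S -> (#|S| <= alpha G)%N.
Proof. exact: (@leq_bigmax_cond _ (fun S => independent G S) (fun S : {set 'I_n} => #|S|)). Qed.

(** Each vertex is repeated t times, and r isolated vertices are added to reach every order. In each
    of the t layers an independent set restricts to an independent set of [G]. *)
Lemma graph_blowup (R : realType) n (G : {set {set 'I_n}}) (t r : nat) : (0 < n)%N -> is_graph G ->
  KpKq_free G 3 7 -> exists G' : {set {set 'I_(n * t + r)}}, [/\ is_graph G', KpKq_free G' 3 7,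
  (alpha G' <= t * alpha G + r)%N & (t ^ 2 * nedges G <= nedges G')%N].
Proof.
move=> n0 gG fG; have [E rE EG] := KpKq_free_ramsey gG fG.
pose T := ('I_n * 'I_t + 'I_r)%type.
have cT : #|{: T}| = (n * t + r)%N by rewrite card_sum card_prod !card_ord.
pose D (z : T) := if z is inl _ then true else false.
pose h (z : T) : 'I_n := if z is inl p then p.1 else Ordinal n0.
pose E' b (u v : T) := [&& D u, D v & E b (h u) (h v)].
have rE' : ramsey_graph E' := ramsey_pullback D h rE.
have iE' : indep_lt E' ((t * alpha G + r).+1%:R : R).
  move=> I hI; rewrite ltr_nat ltnS -sum_mem_card big_sumType /=; apply: leq_add; last first.
    by rewrite -[leqRHS]card_ord -sum1_card; apply: leq_sum => j _; apply: leq_b1.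
  rewrite sum_prod exchange_big /=.
  apply: (@leq_trans (\sum_(s < t) alpha G)); last by rewrite sum_nat_const card_ord.
  apply: leq_sum => s _; apply: (@leq_trans #|[set a | (inl (a, s) : T) \in I]|).
    by rewrite -sum_mem_card; apply: leq_sum => a _; rewrite inE.
  apply: alpha_max; apply/forall_inP => a; rewrite inE => aI; apply/forall_inP => c; rewrite inE => cI.
  by apply/implyP => _; rewrite -EG negb_or; have := hI _ _ aI cI.
have [G' [gG' fG' aG' eG']] := graph_of_ramsey cT rE' iE'.
exists G'; split => //; first by move: aG'; rewrite ltr_nat ltnS.
rewrite -(leq_pmul2l (isT : (0 < 2)%N)) eG' big_sumType /=; apply: leq_trans (leq_addr _ _).
have eG : (2 * nedges G = \sum_a \sum_c adj G a c)%N.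
  rewrite -(card_adj gG) pair_big /= -sum_mem_card; apply: eq_bigr => p _; by rewrite inE.
rewrite mulnCA eG big_distrr /=.
rewrite sum_prod.
apply: leq_sum => a _.
apply: (@leq_trans (\sum_(s < t) (t * \sum_c adj G a c)))%N.
  by rewrite sum_nat_const card_ord mulnA.
apply: leq_sum => s _; rewrite big_sumType /=; apply: leq_trans (leq_addr _ _).
rewrite sum_prod big_distrr /=.
apply: leq_sum => c _; rewrite -EG.
by rewrite (eq_bigr (fun=> (E true a c || E false a c : nat))) // sum_nat_const card_ord.
Qed.

Section TuranDensity.
Variable R : realType.

Lemma nedges_le n (G : {set {set 'I_n}}) : is_graph G -> (nedges G <= n ^ 2)%N.
Proof.
move=> gG; apply: (@leq_trans (2 * nedges G)); first by rewrite leq_pmull.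
by rewrite -(card_adj gG) (leq_trans (max_card _)) // card_prod card_ord mulnn.
Qed.

Lemma RT_ge n p q (m : R) (G : {set {set 'I_n}}) : is_graph G -> KpKq_free G p q ->
  (alpha G)%:R < m -> (nedges G <= RT n p q m)%N.
Proof.
move=> gG fG aG; rewrite /RT.
apply: (@leq_bigmax_cond _ (fun G => [&& is_graph G, KpKq_free G p q & (alpha G)%:R < m]) (@nedges n)).
by rewrite gG fG.
Qed.

Lemma RT_le n p q (m : R) (c : nat) : (forall G : {set {set 'I_n}}, is_graph G -> KpKq_free G p q ->
  (alpha G)%:R < m -> (nedges G <= c)%N) -> (RT n p q m <= c)%N.
Proof. by move=> h; apply/bigmax_leqP => G /and3P[]; apply: h. Qed.

Lemma RT_attained n p q (m : R) : (0 < RT n p q m)%N -> exists G : {set {set 'I_n}},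
  [/\ is_graph G, KpKq_free G p q, (alpha G)%:R < m & nedges G = RT n p q m].
Proof.
move=> RT0; set P := fun G : {set {set 'I_n}} => [&& is_graph G, KpKq_free G p q & (alpha G)%:R < m].
have P0 : (0 < #|P|)%N.
  rewrite lt0n; apply: contraTneq RT0 => /card0_eq P0.
  by rewrite /RT big_pred0 // => G; have := P0 G; rewrite inE.
have [G /and3P[gG fG aG] e] := eq_bigmax_cond (@nedges n) P0.
by exists G; split => //; rewrite -e.
Qed.

Lemma RT_ratio_bounds p q (delta : R) n : 0 <= RT_ratio p q delta n <= 1.
Proof.
rewrite /RT_ratio divr_ge0 ?exprn_ge0 //=; have [->|n0] := posnP n.
  by rewrite expr0n invr0 mulr0 ler01.
rewrite ler_pdivrMr ?exprn_gt0 ?ltr0n // mul1r -natrX ler_nat.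
by apply: RT_le => G gG _ _; apply: nedges_le.
Qed.

(** Strictness of alpha(G) < delta n leaves a gap [beta], and t beta > n makes room for the fewer
    than n isolated vertices. The condition t e >= 2 covers the loss from dividing by at most (n (t
    + 1))^2 instead of (n t)^2. *)
Lemma RT_ratio_blowup (delta : R) n e : 0 < delta -> 0 < e -> exists N0, forall N, (N0 <= N)%N ->
  RT_ratio 3 7 delta n - e <= RT_ratio 3 7 delta N.
Proof.
move=> d0 e0; have [u0|] := leP (RT_ratio 3 7 delta n) 0.
  exists 0%N => N _; have /andP[h _] := RT_ratio_bounds 3 7 delta N; apply: le_trans h; lra.
set u := RT_ratio 3 7 delta n => u0; have /andP[_] := RT_ratio_bounds 3 7 delta n; rewrite -/u => u1.
have n0 : (0 < n)%N.
  by rewrite lt0n; apply: contraTneq u0 => z; rewrite /u /RT_ratio z expr0n invr0 mulr0 ltxx.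
have nR : 0 < n%:R :> R by rewrite ltr0n.
have RT0 : (0 < RT n 3 7 (delta * n%:R))%N.
  by rewrite lt0n; apply: contraTneq u0 => z; rewrite /u /RT_ratio z mul0r ltxx.
have [G [gG fG aG eG]] := RT_attained RT0.
pose beta := delta * n%:R - (alpha G)%:R; have b0 : 0 < beta by rewrite subr_gt0.
pose T0 := maxn (Num.truncn (n%:R / beta)).+1 (Num.truncn (2 / e)).+1.
exists (n * T0)%N => N NT; pose t := (N %/ n)%N.
have tT : (T0 <= t)%N by rewrite leq_divRL // mulnC.
have tb : n%:R < t%:R * beta.
  rewrite -ltr_pdivrMr //; apply: lt_le_trans (truncnS_gt _) _.
  by rewrite ler_nat; apply: leq_trans tT; apply: leq_maxl.
have te : 2 <= t%:R * e.
  rewrite -ler_pdivrMr //; apply: ltW; apply: lt_le_trans (truncnS_gt _) _.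
  by rewrite ler_nat; apply: leq_trans tT; apply: leq_maxr.
have NE : N = (n * t + N %% n)%N by rewrite mulnC; exact: divn_eq.
have rn : (N %% n < n)%N by rewrite ltn_mod.
move: NE rn; move: (N %% n)%N => r NE rn; rewrite NE.
have [G' [gG' fG' aG' eG']] := graph_blowup R t r n0 gG fG.
have t0 : (0 < t)%N by apply: leq_trans tT; rewrite leq_max.
have tR : 0 < t%:R :> R by rewrite ltr0n.
have aG'' : (alpha G')%:R < delta * (n * t + r)%:R.
  have h1 : (alpha G')%:R <= t%:R * (alpha G)%:R + r%:R :> R by rewrite -natrM -natrD ler_nat.
  have h2 : r%:R <= n%:R :> R by rewrite ler_nat ltnW.
  have h3 : 0 <= delta * r%:R by rewrite mulr_ge0 // ltW.
  rewrite natrD natrM mulrDr; move: tb; rewrite /beta.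
  have -> : t%:R * (delta * n%:R - (alpha G)%:R) = delta * (n%:R * t%:R) - t%:R * (alpha G)%:R by ring.
  lra.
have RTN := RT_ge gG' fG' aG''.
have n2 : 0 < (n * t + r)%:R :> R by rewrite ltr0n addn_gt0 muln_gt0 n0 t0.
rewrite /RT_ratio ler_pdivlMr ?exprn_gt0 //.
have h1 : t%:R ^+ 2 * (u * n%:R ^+ 2) <= (RT (n * t + r) 3 7 (delta * (n * t + r)%:R))%:R.
  rewrite /u /RT_ratio divfK ?expf_neq0 ?gt_eqF // -eG -natrX -natrM ler_nat.
  exact: leq_trans RTN.
apply: le_trans h1.
have [ue|ue] := leP (u - e) 0.
  by apply: (@le_trans _ _ 0); [rewrite mulr_le0_ge0 ?exprn_ge0|rewrite !mulr_ge0 ?exprn_ge0 // ltW].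
have h2 : (n * t + r)%:R <= n%:R * (t%:R + 1) :> R.
  by rewrite natrD natrM mulrDr mulr1 lerD2l ler_nat ltnW.
apply: (@le_trans _ _ ((u - e) * (n%:R * (t%:R + 1)) ^+ 2)).
  by rewrite ler_wpM2l ?(ltW ue) // ler_sqr ?nnegrE ?mulr_ge0 ?addr_ge0 // ltW.
have -> : (u - e) * (n%:R * (t%:R + 1)) ^+ 2 = ((u - e) * (t%:R + 1) ^+ 2) * n%:R ^+ 2 by ring.
rewrite mulrA ler_wpM2r ?exprn_ge0 //.
have h3 : 0 <= (1 - u) * (2 * t%:R + 1) by rewrite mulr_ge0 //; lra.
have h4 : 2 * (t%:R + 1) <= (t%:R * e) * (t%:R + 1) by rewrite ler_wpM2r //; lra.
have h5 : 0 <= (t%:R + 1) * e by rewrite mulr_ge0 ?(ltW e0) //; lra.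
have -> : (u - e) * (t%:R + 1) ^+ 2 = t%:R ^+ 2 * u + (2 * t%:R + 1) - (1 - u) * (2 * t%:R + 1)
   - (t%:R * e) * (t%:R + 1) - (t%:R + 1) * e by ring.
lra.
Qed.

Local Open Scope classical_set_scope.

(** By [RT_ratio_blowup] each ratio is eventually matched up to any error, so the limit is the
    supremum. The last two claims say this in the form used for the two bounds. *)
Lemma RT_ratio_limit (delta : R) : 0 < delta -> exists L : R, [/\ RT_ratio 3 7 delta @ \oo --> L,
  (forall n, RT_ratio 3 7 delta n <= L) & forall c, (forall n, RT_ratio 3 7 delta n <= c) -> L <= c].
Proof.
move=> d0; pose A := range (RT_ratio 3 7 delta); pose L := sup A.
have supA : has_sup A.
  split; first by exists (RT_ratio 3 7 delta 0%N); exists 0%N.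
  by exists 1 => _ [n _ <-]; have /andP[] := RT_ratio_bounds 3 7 delta n.
have ub n : RT_ratio 3 7 delta n <= L by apply: ub_le_sup; [case: supA|exists n].
exists L; split => //; last by move=> c h; apply: ge_sup; [case: supA|move=> _ [n _ <-]].
apply/cvgrPdist_le => e e0.
have e2 : 0 < e / 2 by rewrite divr_gt0.
have [_ [n _ <-] hn] := sup_adherent e2 supA.
have [N0 hN] := RT_ratio_blowup n d0 e2.
near=> N.
have h1 := ub N; have h2 : RT_ratio 3 7 delta n - e / 2 <= RT_ratio 3 7 delta N.
  by apply: hN; near: N; exists N0.
by rewrite ger0_norm; move: hn h1 h2; rewrite -/L; lra.
Unshelve. all: by end_near. Qed.

End TuranDensity.

(** * The value of rho(3,7) and weak stability *)

Unset Implicit Arguments.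
From mathcomp Require Import all_classical all_reals all_analysis.
Local Open Scope classical_set_scope.
Local Open Scope ring_scope.

Theorem mainTheorem2 (R : realType) :
  (* rho(3,7,delta) is well defined for every 0 < delta < 1 ... *)
  (forall delta : R, 0 < delta < 1 -> cvgn (RT_ratio 3 7 delta)) /\
  (* ... and rho(3,7) = lim_{delta -> 0+} rho(3,7,delta) = 7/16 *)
  ((fun delta : R => limn (RT_ratio 3 7 delta)) x @[x --> 0^'+] --> (7 / 16 : R)) /\
  (* weak stability *)
  (forall (S Z : forall n : nat, {set {set 'I_n}}),
     (forall n, is_graph (S n) /\ is_graph (Z n)) ->
     (forall n, KpKq_free (S n) 3 7 /\ KpKq_free (Z n) 3 7) ->
     (fun n => (alpha (S n))%:R / n%:R : R) @ \oo --> 0 ->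
     (fun n => (alpha (Z n))%:R / n%:R : R) @ \oo --> 0 ->
     (fun n => ((nedges (S n))%:R - 7 / 16 * n%:R ^+ 2) / n%:R ^+ 2 : R) @ \oo --> 0 ->
     (fun n => ((nedges (Z n))%:R - 7 / 16 * n%:R ^+ 2) / n%:R ^+ 2 : R) @ \oo --> 0 ->
     (fun n => (Delta (S n) (Z n))%:R / n%:R ^+ 2 : R) @ \oo --> 0).
Proof.
split; last split.
- by move=> delta /andP[d0 _]; have [L [cL _ _]] := RT_ratio_limit d0; apply/cvg_ex; exists L.
- apply/cvgrPdist_le => e e0.
  have e1 : 0 < Num.min e 1 <= 1 by rewrite lt_min e0 ltr01 ge_min lexx orbT.
  have [d0 d00 ub] := edge_bound e1.
  near=> delta.
  have del0 : 0 < delta by near: delta; exact: nbhs_right_gt.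
  have deld : delta < d0 by near: delta; exact: nbhs_right_lt.
  have [L [cL geL leL]] := RT_ratio_limit del0.
  rewrite (cvg_lim _ cL) //.
  (* [L] bounds every ratio, so a dense graph of one single order is enough. *)
  have low : 7 / 16 <= L.
    have [n [G [n0 gG fG aG eG]]] := dense_graph_exists del0.
    apply: le_trans (geL n); rewrite /RT_ratio ler_pdivlMr ?exprn_gt0 ?ltr0n //.
    have h1 : (nedges G)%:R <= (RT n 3 7 (delta * n%:R))%:R :> R by rewrite ler_nat; apply: RT_ge.
    have : 7 * n%:R ^+ 2 <= 16 * (nedges G)%:R :> R by rewrite -natrX -!natrM ler_nat.
    lra.
  have upp : L <= 7 / 16 + e.
    apply: leL => n; have [->|n0] := posnP n; first by rewrite /RT_ratio expr0n invr0 mulr0; lra.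
    have n2 : 0 < n%:R ^+ 2 :> R by rewrite exprn_gt0 // ltr0n.
    rewrite /RT_ratio ler_pdivrMr //.
    have [RT0|] := posnP (RT n 3 7 (delta * n%:R)); first by rewrite RT0 mulr_ge0 // ?ltW //; lra.
    move/RT_attained => [G [gG fG aG <-]].
    apply: le_trans (ub n G n0 gG fG _) _.
      by apply: lt_le_trans aG _; rewrite ler_wpM2r // ltW.
    by rewrite ler_pM2r // lerD2l ge_min lexx.
  by rewrite ler_norml; apply/andP; split; lra.
move=> S Z gSZ fSZ aS aZ eS eZ; apply/cvgrPdist_le => e e0.
have e1 : 0 < Num.min e 1 <= 1 by rewrite lt_min e0 ltr01 ge_min lexx orbT.
have [d d0 close] := edit_distance_small e1.
have alphaP (U : forall n : nat, {set {set 'I_n}}) :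
    (fun n => (alpha (U n))%:R / n%:R : R) @ \oo --> 0 ->
    \forall n \near \oo, (0 < n)%N -> (alpha (U n))%:R < d * n%:R.
  move=> /cvgrPdist_lt/(_ d d0); apply: filterS => n; rewrite sub0r normrN => h n0.
  by rewrite -ltr_pdivrMr ?ltr0n //; apply: le_lt_trans h; apply: ler_norm.
have edgeP (U : forall n : nat, {set {set 'I_n}}) :
    (fun n => ((nedges (U n))%:R - 7 / 16 * n%:R ^+ 2) / n%:R ^+ 2 : R) @ \oo --> 0 ->
    \forall n \near \oo, (0 < n)%N -> (7 / 16 - d) * n%:R ^+ 2 <= (nedges (U n))%:R.
  move=> /cvgrPdist_lt/(_ d d0); apply: filterS => n; rewrite sub0r normrN => h n0.
  have n2 : 0 < n%:R ^+ 2 :> R by rewrite exprn_gt0 // ltr0n.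
  have : - d <= ((nedges (U n))%:R - 7 / 16 * n%:R ^+ 2) / n%:R ^+ 2.
    by move: h; rewrite ltr_norml => /andP[/ltW].
  by rewrite ler_pdivlMr //; lra.
near=> n.
have n0 : (0 < n)%N by near: n; exists 1%N.
have [gS gZ] := gSZ n; have [fS fZ] := fSZ n.
have n2 : 0 < n%:R ^+ 2 :> R by rewrite exprn_gt0 // ltr0n.
rewrite sub0r normrN ger0_norm ?divr_ge0 ?(ltW n2) // ler_pdivrMr //.
apply: (@le_trans _ _ (Num.min e 1 * n%:R ^+ 2)); last by rewrite ler_pM2r // ge_min lexx.
apply: close => //.
- by move: n0; near: n; apply: alphaP.
- by move: n0; near: n; apply: alphaP.
- by move: n0; near: n; apply: edgeP.
- by move: n0; near: n; apply: edgeP.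
Unshelve. all: by end_near. Qed.
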